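(* Let $a>b>0$ be constants, $k=\frac{a+b}{2}$ and $\varepsilon=\frac{b}{a+b}<\frac12$. There is an absolute constant $C>1$ such that if $a>20$ and $k(1-2\varepsilon)^2>C$, then partial recovery is possible in the semirandom block model with parameters $(a,b,n)$, and moreover it can be achieved by a polynomial-time algorithm (against every monotone adversary).
   Context: Stochastic block model $G(n,a/n,b/n)$: each of $n$ vertices independently receives a spin $\sigma_v\in\{+1,-1\}$ uniformly at random; each unordered pair $\{u,v\}$ is an edge independently with probability $a/n$ if $\sigma_u=\sigma_v$ and $b/n$ otherwise. Semirandom block model: sample $G_{\mathrm{pre}}\sim G(n,a/n,b/n)$; a monotone adversary, seeing $G_{\mathrm{pre}}$ and the spins, may delete any number of edges joining opposite-spin vertices and add any number of edges joining equal-spin vertices; the resulting graph is observed. An assignment $\hat\sigma\in\{\pm1\}^n$ achieves $\eta$-partial recovery if at least $\eta n$ of its entries agree with the true spins, possibly after a global sign flip. Partial recovery is achieved if for some $\eta>\frac12$, $\eta$-partial recovery holds with probability $1-o(1)$ as $n\to\infty$. *)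

(* Defs.v *)
(* MathComp / MathComp-Analysis *)
From HB Require Import structures.
From mathcomp Require Import all_boot all_order all_algebra.
From mathcomp Require Import all_classical all_reals topology normedtype.

Set Implicit Arguments.
Unset Strict Implicit.
Unset Printing Implicit Defensive.

Import Order.TTheory GRing.Theory Num.Theory.
Import numFieldNormedType.Exports.

Local Open Scope ring_scope.
Local Open Scope classical_set_scope.

(* The spin +1 is [true] and the spin -1 is [false]. *)
Definition spins (n : nat) : finType := {ffun 'I_n -> bool}.

Definition flip n (s : spins n) : spins n := [ffun v => ~~ s v].

Definition simple_graph n (e : {ffun 'I_n * 'I_n -> bool}) : bool :=
  [forall u, forall v, e (u, v) == e (v, u)] && [forall u, ~~ e (u, u)].

Record sgraph (n : nat) : Type := SGraph {
  edge_fun : {ffun 'I_n * 'I_n -> bool};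
  _ : simple_graph edge_fun
}.

HB.instance Definition _ n := [isSub for @edge_fun n].
HB.instance Definition _ n := [Finite of sgraph n by <:].

Definition adj n (G : sgraph n) (u v : 'I_n) : bool := edge_fun G (u, v).

Section BlockModel.
Variable R : realType.

Definition edge_prob (a b : R) n (s : spins n) (u v : 'I_n) : R :=
  (if s u == s v then a else b) / n%:R.

(* Joint mass function of the spins and of G(n, a/n, b/n).  It is a probability
   mass function as soon as 0 <= a, b <= n; only the limit n -> oo is used, so
   the remaining values of n do not matter. *)
Definition sbm_pmf (a b : R) n (s : spins n) (G : sgraph n) : R :=
  2^-1 ^+ n *
  \prod_(e : 'I_n * 'I_n | (e.1 < e.2)%N)
     (if adj G e.1 e.2 then edge_prob a b s e.1 e.2
      else 1 - edge_prob a b s e.1 e.2).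

Definition sbm_prob (a b : R) n (E : spins n -> sgraph n -> bool) : R :=
  \sum_(s : spins n) \sum_(G : sgraph n | E s G) sbm_pmf a b s G.

End BlockModel.

Definition adversary := forall n, spins n -> sgraph n -> sgraph n.

Definition monotone_adversary (A : adversary) : Prop :=
  forall n (s : spins n) (G : sgraph n) (u v : 'I_n),
    (s u = s v -> adj G u v -> adj (A n s G) u v) /\
    (s u <> s v -> adj (A n s G) u v -> adj G u v).

(* An estimator sees the observed graph only. *)
Definition estimator := forall n, sgraph n -> spins n.

Definition agreement n (s t : spins n) : nat := #|[pred v | s v == t v]|.

Definition eta_recovers (R : realType) (eta : R) n (t s : spins n) : bool :=
  (eta * n%:R <= (agreement t s)%:R) ||
  (eta * n%:R <= (agreement (flip t) s)%:R).

Definition semirandom_partial_recovery (R : realType) (a b : R)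
    (f : estimator) : Prop :=
  exists2 eta : R, 1 / 2 < eta &
    forall A : adversary, monotone_adversary A ->
      (fun n => sbm_prob a b
         (fun (s : spins n) G => eta_recovers eta (f n (A n s G)) s))
        @ \oo --> (1 : R).

(* Polynomial time is measured on the random access machine of Cook and Reckhow,
   over the natural numbers (hence with truncated subtraction).  Every
   instruction costs one step; as addition and subtraction are the only
   arithmetic operations, register lengths grow by at most one bit per step and
   this machine is polynomially equivalent to Turing machines. *)
Inductive instr : Type :=
| IConst of nat & nat          (* X_i <- c *)
| IAdd of nat & nat & nat      (* X_i <- X_j + X_k *)
| ISub of nat & nat & nat      (* X_i <- X_j - X_k *)
| ILoad of nat & nat           (* X_i <- X_(X_j) *)
| IStore of nat & nat          (* X_(X_i) <- X_j *)
| IJump of nat & nat           (* go to instruction m if X_j > 0 *)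
| IRead of nat                 (* X_i <- next input item, 0 if exhausted *)
| IPrint of nat.               (* append X_i to the output *)

Record state : Type := State {
  pc : nat;
  reg : nat -> nat;
  inp : seq nat;
  out : seq nat
}.

Definition upd (m : nat -> nat) (i x : nat) : nat -> nat :=
  fun j => if j == i then x else m j.

Definition exec (c : instr) (st : state) : state :=
  let: State p m w o := st in
  match c with
  | IConst i x  => State p.+1 (upd m i x) w o
  | IAdd i j k  => State p.+1 (upd m i (m j + m k)%N) w o
  | ISub i j k  => State p.+1 (upd m i (m j - m k)%N) w o
  | ILoad i j   => State p.+1 (upd m i (m (m j))) w o
  | IStore i j  => State p.+1 (upd m (m i) (m j)) w o
  | IJump l j   => State (if (0 < m j)%N then l else p.+1) m w o
  | IRead i     => State p.+1 (upd m i (head 0%N w)) (behead w) o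
  | IPrint i    => State p.+1 m w (rcons o (m i))
  end.

Definition program := seq instr.

Definition halted (P : program) (st : state) : bool := (size P <= pc st)%N.

Definition step (P : program) (st : state) : state :=
  if onth P (pc st) is Some c then exec c st else st.

Definition init (w : seq nat) : state := State 0 (fun=> 0%N) w [::].

Definition outputs_within (P : program) (w : seq nat) (t : nat)
    (o : seq nat) : Prop :=
  let st := iter t (step P) (init w) in halted P st /\ out st = o.

(* The number of vertices, then the adjacency matrix in row-major order. *)
Definition encode_graph n (G : sgraph n) : seq nat :=
  n :: [seq nat_of_bool (adj G u v) | u <- enum 'I_n, v <- enum 'I_n].

Definition encode_spins n (s : spins n) : seq nat :=
  [seq nat_of_bool (s v) | v <- enum 'I_n].

(* A single program serves all n; time polynomial in n and time polynomial in
   the input size n ^ 2 + 1 amount to the same. *)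
Definition polynomial_time (f : estimator) : Prop :=
  exists (P : program) (c d : nat), forall n (G : sgraph n),
    outputs_within P (encode_graph G) (c * n ^ d + c)%N (encode_spins (f n G)).

(* Main.v *)
Require Import Defs.
From mathcomp Require Import all_boot all_order all_algebra.
From mathcomp Require Import all_classical all_reals topology normedtype.
From mathcomp Require Import sequences exp.
From mathcomp Require Import zify ring lra.

(* The estimator approximately solves the semidefinite program
     maximise <M, X>,  M = n A - kappa J,  X positive semidefinite, X_ii = 1,
   where A is the observed adjacency matrix and kappa an integer within 1 of
   (a + b) / 2, and rounds the solution.

   Statistics.  Since |X_ij| <= 1, the monotone changes can only increase the
   advantage of the planted solution x x^T over X, so the optimum also beats
   x x^T for the adjacency matrix before the changes.  The expectation of the
   latter is (a - b) / 2n x x^T plus a multiple of J that kappa cancels, and by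
   a Chernoff bound and a union bound over sign vectors its fluctuation has cut
   norm O(n sqrt a), hence by Grothendieck's inequality a comparable pairing
   with every feasible X.  So X is close to x x^T once a - b >> sqrt a.

   Solver.  The multipliers of the constraints X_ii = 1 are updated by online
   gradient descent, the best response being the density matrix proportional to
   a high even power of the penalised matrix; the answer is the average of the
   responses.  Powers are computed exactly in integers, by loops of length a
   power of n, so that only additions and subtractions occur.

   Rounding.  Among the sign patterns of the rows of X, choose the one
   inconsistent with the fewest signs of entries of X. *)

Set Implicit Arguments.
Unset Strict Implicit.
Unset Printing Implicit Defensive.

Import Order.TTheory GRing.Theory Num.Theory.
Import numFieldNormedType.Exports.

(** * Compiling a loop language to the random access machine *)

Section Imperative.
Local Open Scope nat_scope.

(** The adversary sees everything, yet costs no union bound: probability enters only through the cut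
    norm of the noise before the changes, and under that bound the estimator succeeds
    deterministically, whatever the monotone changes are. The cut norm is preferred to the spectral
    norm because, at bounded average degree, vertices of high degree spoil the latter. No eigenvalue
    is ever taken. The power method is analysed through the log-convexity in k of the traces of Z^T
    N^k Z, and the responses are even powers because these are Gram matrices, the form in which
    Grothendieck's inequality takes the solution. The powers of n in the solver are generous: a
    spare factor n >= 100 absorbs the numerical constants. The solution is feasible only up to 1 / n
    on the diagonal, at a cost of O(n ^ 2) that the noise term n ^ 2 sqrt a dominates. The noise is
    at most 11 n sqrt a in cut norm, Grothendieck's inequality multiplies by 98, and 10 ^ 5 sqrt a
    <= (a - b) / 2 then leaves at most a tenth of the signs of X wrong, enough for agreement 3 /
    5. *)

Inductive cmd : Type :=
| CConst of nat & nat
| CAdd of nat & nat & nat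
| CSub of nat & nat & nat
| CIdx of nat & nat
| CLoad of nat & nat & nat & nat
| CStore of nat & nat & nat & nat
| CRead of nat
| CPrint of nat
| CSkip
| CSeq of cmd & cmd
| CIf of nat & cmd & cmd
| CFor of cmd.

Record memory := Memory {
  scal : nat -> nat;
  mat : nat -> nat -> nat -> nat;
  minp : seq nat;
  mout : seq nat }.

Definition set_scal (s : memory) k x :=
  Memory (upd (scal s) k x) (mat s) (minp s) (mout s).

Definition mat_upd (M : nat -> nat -> nat -> nat) k i j x :=
  fun k' i' j' => if [&& k' == k, i' == i & j' == j] then x else M k' i' j'.

Definition set_mat (s : memory) k i j x :=
  Memory (scal s) (mat_upd (mat s) k i j x) (minp s) (mout s).

(* Environments list the values of the enclosing loop counters, innermost
   first. *)
Fixpoint run (n : nat) (c : cmd) (env : seq nat) (s : memory) : memory :=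
  match c with
  | CConst k x => set_scal s k x
  | CAdd k a b => set_scal s k (scal s a + scal s b)
  | CSub k a b => set_scal s k (scal s a - scal s b)
  | CIdx k x => set_scal s k (nth 0 env x)
  | CLoad k m x y => set_scal s k (mat s m (nth 0 env x) (nth 0 env y))
  | CStore m x y k => set_mat s m (nth 0 env x) (nth 0 env y) (scal s k)
  | CRead k =>
      Memory (upd (scal s) k (head 0 (minp s))) (mat s) (behead (minp s)) (mout s)
  | CPrint k => Memory (scal s) (mat s) (minp s) (rcons (mout s) (scal s k))
  | CSkip => s
  | CSeq c1 c2 => run n c2 env (run n c1 env s)
  | CIf k c1 c2 => if 0 < scal s k then run n c1 env s else run n c2 env s
  | CFor c1 => foldl (fun s i => run n c1 (i :: env) s) s (iota 0 n)
  end.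

(* Memory layout, by residue modulo 8: scalars at 0, loop counters at 2, loop
   counters times n at 3, matrix entries at 4.  The special registers are 1
   (always 0), 5 and 6 (temporaries) and 7 (holds n). *)
Definition scal_addr k := 8 * k.
(** Counters are stored by nesting level, whereas commands name them by de Bruijn index. An index
    out of scope reads register 1, hence 0, in agreement with [nth 0]. *)
Definition ctr_addr (d x : nat) := if x < d then 8 * (d - x.+1) + 2 else 1.
Definition ctrn_addr (d x : nat) := if x < d then 8 * (d - x.+1) + 3 else 1.
Definition mat_addr (n k i j : nat) := 8 * (2 ^ k * (i * n + j).*2.+1) + 4.

(** [p] is the absolute position of the code, needed because jumps are absolute; [d] is the loop
    depth. A loop is entered at its test, so that n = 0 is no exception. Since n times the counter
    is kept up to date by additions, addresses need no multiplication. *)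
Fixpoint compile (p d : nat) (c : cmd) : seq instr :=
  let addr m x y :=
    [:: IAdd 6 (ctrn_addr d x) (ctr_addr d y); IAdd 6 6 6; IConst 5 1; IAdd 6 6 5]
    ++ nseq m.+3 (IAdd 6 6 6) ++ [:: IConst 5 4; IAdd 6 6 5] in
  match c with
  | CConst k x => [:: IConst (scal_addr k) x]
  | CAdd k a b => [:: IAdd (scal_addr k) (scal_addr a) (scal_addr b)]
  | CSub k a b => [:: ISub (scal_addr k) (scal_addr a) (scal_addr b)]
  | CIdx k x => [:: IAdd (scal_addr k) (ctr_addr d x) 1]
  | CLoad k m x y => rcons (addr m x y) (ILoad (scal_addr k) 6)
  | CStore m x y k => rcons (addr m x y) (IStore 6 (scal_addr k))
  | CRead k => [:: IRead (scal_addr k)]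
  | CPrint k => [:: IPrint (scal_addr k)]
  | CSkip => [::]
  | CSeq c1 c2 =>
      let p1 := compile p d c1 in p1 ++ compile (p + size p1) d c2
  | CIf k c1 c2 =>
      let p2 := compile p.+1 d c2 in
      let q := p + (size p2).+3 in
      let p1 := compile q d c1 in
      IJump q (scal_addr k) ::
      p2 ++ [:: IConst 5 1; IJump (q + size p1) 5] ++ p1
  | CFor c1 =>
      let p1 := compile (p + 4) d.+1 c1 in
      let v := 8 * d + 2 in
      [:: IConst v 0; IConst v.+1 0; IConst 5 1; IJump (p + (size p1 + 7)) 5]
      ++ p1 ++ [:: IConst 5 1; IAdd v v 5; IAdd v.+1 v.+1 7;
                   ISub 5 7 v; IJump (p + 4) 5]
  end.

Fixpoint cost (n : nat) (c : cmd) : nat :=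
  match c with
  | CLoad _ m _ _ | CStore m _ _ _ => m + 10
  | CSkip => 0
  | CSeq c1 c2 => cost n c1 + cost n c2
  | CIf _ c1 c2 => cost n c1 + cost n c2 + 3
  | CFor c1 => n * (cost n c1 + 5) + 6
  | _ => 1
  end.

(** Every loop runs exactly n times, so polynomial time is a matter of syntax. *)
Lemma cost_poly c : exists a d, forall n, cost n c <= a * n.+1 ^ d.
Proof.
have le1 n d x : x <= x * n.+1 ^ d by rewrite leq_pmulr ?expn_gt0.
elim: c => [k x|k x y|k x y|k x|k m x y|m x y k|k|k||c1 [a1 [d1 H1]] c2 [a2 [d2 H2]]
  |k c1 [a1 [d1 H1]] c2 [a2 [d2 H2]]|c1 [a1 [d1 H1]]]; try by exists 1, 0 => n.
- by exists (m + 10), 0 => n /=; rewrite muln1.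
- by exists (m + 10), 0 => n /=; rewrite muln1.
- exists (a1 + a2), (d1 + d2) => n /=; rewrite expnD mulnDl.
  apply: leq_add.
    by apply: leq_trans (H1 n) _; rewrite mulnA; apply: le1.
  by apply: leq_trans (H2 n) _; rewrite mulnCA; apply: leq_pmull; rewrite expn_gt0.
- exists (a1 + a2 + 3), (d1 + d2) => n /=; rewrite expnD !mulnDl.
  apply: leq_add; [apply: leq_add|].
  + by apply: leq_trans (H1 n) _; rewrite mulnA; apply: le1.
  + by apply: leq_trans (H2 n) _; rewrite mulnCA; apply: leq_pmull; rewrite expn_gt0.
  + by rewrite mulnA; apply: leq_trans (le1 n d1 3) (le1 _ _ _).
- exists (a1 + 11), d1.+1 => n /=.
  rewrite expnS mulnCA.
  apply: (@leq_trans (n.+1 * (cost n c1 + 11))).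
    nia.
  rewrite leq_mul2l /= mulnDl; apply: leq_add => //; exact: le1.
Qed.

(** * Simulation of the loop language by the compiled code *)

#[local] Arguments onth : simpl never.

Fixpoint code_at (P : program) p (C : seq instr) : Prop :=
  if C is c :: C' then onth P p = Some c /\ code_at P p.+1 C' else True.

Lemma code_at_cat P p C1 C2 :
  code_at P p (C1 ++ C2) <-> code_at P p C1 /\ code_at P (p + size C1) C2.
Proof.
elim: C1 p => [|c C1 IH] p /=; first by rewrite addn0; split=> [|[]].
by rewrite IH addSnnS; tauto.
Qed.

Lemma code_at_all P pre : code_at (pre ++ P) (size pre) P.
Proof.
elim: P pre => [|c P IH] pre //=; split.
  by rewrite onth_cat ltnn subnn.
by have := IH (rcons pre c); rewrite cat_rcons size_rcons.
Qed.

Definition reach P b st st' := exists2 t, t <= b & iter t (step P) st = st'.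

Lemma reach_refl P b st : reach P b st st.
Proof. by exists 0. Qed.

Lemma reach_pc P b p p' m w o :
  p = p' -> reach P b (State p m w o) (State p' m w o).
Proof. by move=> ->; apply: reach_refl. Qed.

Lemma reach_trans P b1 b2 s1 s2 s3 :
  reach P b1 s1 s2 -> reach P b2 s2 s3 -> reach P (b1 + b2) s1 s3.
Proof.
move=> [t1 H1 <-] [t2 H2 <-]; exists (t2 + t1); first by rewrite addnC leq_add.
by rewrite iterD.
Qed.

Lemma reach_step P b p m w o st' c :
  onth P p = Some c -> reach P b (exec c (State p m w o)) st' ->
  reach P b.+1 (State p m w o) st'.
Proof.
move=> H [t tb <-]; exists t.+1 => //.
by rewrite iterSr [step P (State _ _ _ _)]/step H.
Qed.

Lemma reach_le P b b' st st' : b <= b' -> reach P b st st' -> reach P b' st st'.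
Proof. by move=> H [t tb <-]; exists t => //; apply: leq_trans H. Qed.

(** The range [maxn 1 n] instead of n keeps index 0 legal when n = 0, where an index out of scope
    still denotes entry 0. *)
Definition rep n (env : seq nat) (s : memory) (m : nat -> nat) : Prop :=
  [/\ m 1 = 0 /\ m 7 = n,
      forall k, m (scal_addr k) = scal s k,
      forall x, m (ctr_addr (size env) x) = nth 0 env x,
      forall x, m (ctrn_addr (size env) x) = nth 0 env x * n &
      forall k i j, i < maxn 1 n -> j < maxn 1 n ->
        m (mat_addr n k i j) = mat s k i j].

Definition off_temp (m m' : nat -> nat) :=
  forall a, a != 5 -> a != 6 -> m' a = m a.

Lemma rep_off_temp n env s m m' : off_temp m m' -> rep n env s m -> rep n env s m'.
Proof.
move=> E [[H1 H2] H3 H4 H5 H6]; split.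
- by rewrite !E.
- by move=> k; rewrite E //; rewrite /scal_addr; lia.
- by move=> k; rewrite E //; rewrite /ctr_addr; case: ifP => _; lia.
- by move=> k; rewrite E //; rewrite /ctrn_addr; case: ifP => _; lia.
- by move=> k i j Hi Hj; rewrite E ?H6 //; rewrite /mat_addr; lia.
Qed.

Lemma off_temp_refl m : off_temp m m. Proof. by []. Qed.

Lemma off_temp_upd5 m m' x : off_temp m m' -> off_temp m (upd m' 5 x).
Proof. by move=> E a H1 H2; rewrite /upd (negbTE H1) E. Qed.

Lemma off_temp_upd6 m m' x : off_temp m m' -> off_temp m (upd m' 6 x).
Proof. by move=> E a H1 H2; rewrite /upd (negbTE H2) E. Qed.

Lemma rep_set_scal n env s m k x :
  rep n env s m -> rep n env (set_scal s k x) (upd m (scal_addr k) x).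
Proof.
rewrite /upd /scal_addr => -[[H1 H2] H3 H4 H5 H6]; split.
- by rewrite !ifN; [split|lia|lia].
- by move=> k'; rewrite /scal_addr eqn_pmul2l //= /upd H3.
- by move=> y; rewrite -H4 ifN // /ctr_addr; case: ifP => _; lia.
- by move=> y; rewrite -H5 ifN // /ctrn_addr; case: ifP => _; lia.
- by move=> k' i j Hi Hj; rewrite -H6 // ifN // /mat_addr; lia.
Qed.

(** Keeps the matrices apart in memory: the 2-adic valuation is the matrix number and the odd part
    the entry number, so every matrix has unbounded room and addresses are computed by doublings. *)
Lemma pow2_odd_inj k k' q q' :
  2 ^ k * q.*2.+1 = 2 ^ k' * q'.*2.+1 -> k = k' /\ q = q'.
Proof.
elim: k k' => [|k IH] [|k'] //.
- by rewrite !expn0 !mul1n => -[]; lia.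
- by rewrite expn0 mul1n expnS; lia.
- by rewrite expn0 mul1n expnS; lia.
- rewrite !expnS -!mulnA => /eqP; rewrite eqn_pmul2l // => /eqP /IH [-> ->] //.
Qed.

Lemma mat_addr_inj n k i j k' i' j' :
  i < maxn 1 n -> j < maxn 1 n -> i' < maxn 1 n -> j' < maxn 1 n ->
  mat_addr n k i j = mat_addr n k' i' j' -> [/\ k = k', i = i' & j = j'].
Proof.
move=> Hi Hj Hi' Hj' E.
have /pow2_odd_inj [-> E'] : 2 ^ k * (i * n + j).*2.+1 = 2 ^ k' * (i' * n + j').*2.+1.
  by rewrite /mat_addr in E; lia.
case: n Hi Hj Hi' Hj' E' {E} => [|n]; first by rewrite maxn0 => *; split; lia.
rewrite (maxn_idPr _) // => _ Hj _ Hj' E.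
have Ei : i = i'.
  by have := congr1 (fun x => x %/ n.+1) E; rewrite !divnMDl // !divn_small // !addn0.
by subst i'; split=> //; lia.
Qed.

Lemma rep_set_mat n env s m k i j x :
  i < maxn 1 n -> j < maxn 1 n ->
  rep n env s m -> rep n env (set_mat s k i j x) (upd m (mat_addr n k i j) x).
Proof.
rewrite /upd => Hi Hj [[H1 H2] H3 H4 H5 H6]; split.
- by rewrite !ifN; [split| |]; rewrite /mat_addr; lia.
- by move=> y; rewrite -H3 ifN // /scal_addr /mat_addr; lia.
- by move=> y; rewrite -H4 ifN // /ctr_addr /mat_addr; case: ifP => _; lia.
- by move=> y; rewrite -H5 ifN // /ctrn_addr /mat_addr; case: ifP => _; lia.
- move=> k' i' j' Hi' Hj'; rewrite /= /mat_upd.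
  case: eqP => [/mat_addr_inj [] // -> -> ->|ne]; first by rewrite !eqxx.
  rewrite H6 //; case: ifP => // /and3P[/eqP ? /eqP ? /eqP ?]; by subst.
Qed.

Lemma rep_io n env s m w o :
  rep n env s m -> rep n env (Memory (scal s) (mat s) w o) m.
Proof. by case. Qed.

Lemma nth_lt_max n (env : seq nat) x :
  all (fun i => i < maxn 1 n) env -> nth 0 env x < maxn 1 n.
Proof.
move=> /all_nthP H; case: (ltnP x (size env)) => [/H //|/(nth_default 0) ->].
by rewrite leq_max.
Qed.

Lemma reach_double P k p m w o :
  code_at P p (nseq k (IAdd 6 6 6)) ->
  exists2 m', reach P k (State p m w o) (State (p + k) m' w o) &
    off_temp m m' /\ m' 6 = 2 ^ k * m 6.
Proof.
elim: k p m => [|k IH] p m /=.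
  by move=> _; exists m; rewrite ?addn0 ?mul1n; [apply: reach_refl|split].
move=> [H0 /(IH _ (upd m 6 (m 6 + m 6))) [m' R [E1 E2]]].
exists m'; first by apply: (reach_step H0); rewrite -addSnnS.
split; first by move=> a H1 H2; rewrite E1 // /upd (negbTE H2).
by rewrite E2 /upd eqxx expnS addnn -mul2n; lia.
Qed.

Definition addr_code d m x y :=
  [:: IAdd 6 (ctrn_addr d x) (ctr_addr d y); IAdd 6 6 6; IConst 5 1; IAdd 6 6 5]
  ++ nseq m.+3 (IAdd 6 6 6) ++ [:: IConst 5 4; IAdd 6 6 5].

Lemma size_addr_code d m x y : size (addr_code d m x y) = m + 9.
Proof. by rewrite /addr_code /= size_cat size_nseq /=; lia. Qed.

Lemma reach_addr P p n env s m k x y w o :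
  rep n env s m -> code_at P p (addr_code (size env) k x y) ->
  exists2 m', reach P (k + 9) (State p m w o) (State (p + (k + 9)) m' w o) &
    off_temp m m' /\ m' 6 = mat_addr n k (nth 0 env x) (nth 0 env y).
Proof.
move=> [_ _ H4 H5 _].
rewrite /addr_code code_at_cat => -[[C1 [C2 [C3 [C4 _]]]]].
rewrite code_at_cat size_nseq => -[C5 [C6 [C7 _]]].
pose v := (nth 0 env x * n + nth 0 env y).*2.+1.
have [m1 R1 [E1 E2]] := @reach_double P k.+3 (p + 4)
  (upd (upd (upd (upd m 6 (nth 0 env x * n + nth 0 env y)) 6 (v.-1)) 5 1) 6 v) w o C5.
exists (upd (upd m1 5 4) 6 (mat_addr n k (nth 0 env x) (nth 0 env y))).
  apply: (@reach_le _ (k.+3 + 2).+4); first lia.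
  apply: (reach_step C1) => /=; rewrite H5 H4.
  apply: (reach_step C2) => /=; rewrite {2 3}/upd eqxx.
  apply: (reach_step C3) => /=.
  apply: (reach_step C4) => /=.
  rewrite [_ + (upd _ _ _ 5)](_ : _ = v); last by rewrite /upd /= /v -addnn addn1.
  rewrite addnn -[(_).*2]/(v.-1).
  rewrite -addn4; apply: (reach_trans R1).
  apply: (reach_step C6); apply: (reach_step C7) => /=.
  rewrite [_ + (upd _ _ _ 5)](_ : _ = mat_addr n k (nth 0 env x) (nth 0 env y)); last first.
    by rewrite /upd /= E2 /upd eqxx /mat_addr -/v !expnS; lia.
  rewrite [(_).+2](_ : _ = p + (k + 9)); last lia.
  exact: reach_refl.
split; last by rewrite /upd eqxx.
apply/off_temp_upd6/off_temp_upd5 => a H1 H2.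
by rewrite E1 // /upd (negbTE H1) (negbTE H2).
Qed.

Lemma rep_ctr0 n env s m :
  rep n env s m -> 
  rep n (0 :: env) s (upd (upd (upd m (8 * size env + 2) 0) (8 * size env + 2).+1 0) 5 1).
Proof.
move=> [[H1 H2] H3 H4 H5 H6]; apply: rep_off_temp (off_temp_upd5 _ (off_temp_refl _)) _.
rewrite /upd; split.
- by rewrite !ifN; [split| | | |]; lia.
- by move=> y; rewrite -H3 !ifN // /scal_addr; lia.
- case=> [|y]; rewrite /ctr_addr /=; first by rewrite subn1 /= ifN ?eqxx //; lia.
  rewrite -H4 /ctr_addr ltnS subSS; case: ltnP => ?; rewrite !ifN //; lia.
- case=> [|y]; rewrite /ctrn_addr /=; first by rewrite subn1 /= ifT //; lia.
  rewrite -H5 /ctrn_addr ltnS subSS; case: ltnP => ?; rewrite !ifN //; lia.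
- by move=> k i j Hi Hj; rewrite -H6 // !ifN // /mat_addr; lia.
Qed.

Lemma rep_ctrS n i env s m :
  rep n (i :: env) s m ->
  rep n (i.+1 :: env) s
    (upd (upd (upd m 5 1) (8 * size env + 2) i.+1) (8 * size env + 2).+1 (i.+1 * n)).
Proof.
move/(rep_off_temp (off_temp_upd5 1 (off_temp_refl m))) => [[H1 H2] H3 H4 H5 H6].
move: (upd m 5 1) H1 H2 H3 H4 H5 H6 => {}m H1 H2 H3 H4 H5 H6.
rewrite /upd; split.
- by rewrite !ifN; [split| | | |]; lia.
- by move=> y; rewrite -H3 !ifN // /scal_addr; lia.
- case=> [|y]; rewrite /ctr_addr /=; first by rewrite subn1 /= ifN ?eqxx //; lia.
  have := H4 y.+1; rewrite /ctr_addr /= => <-.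
  by rewrite ltnS subSS; case: ltnP => ?; rewrite !ifN //; lia.
- case=> [|y]; rewrite /ctrn_addr /=; first by rewrite subn1 /= ifT //; lia.
  have := H5 y.+1; rewrite /ctrn_addr /= => <-.
  by rewrite ltnS subSS; case: ltnP => ?; rewrite !ifN //; lia.
- by move=> k i' j Hi Hj; rewrite -H6 // !ifN // /mat_addr; lia.
Qed.

Lemma rep_pop n i env s m : rep n (i :: env) s m -> rep n env s m.
Proof.
move=> [H12 H3 H4 H5 H6]; split=> // x.
- by have := H4 x.+1; rewrite /ctr_addr /= ltnS subSS.
- by have := H5 x.+1; rewrite /ctrn_addr /= ltnS subSS.
Qed.

Lemma compile_correct n c env s P p m :
  code_at P p (compile p (size env) c) ->
  all (fun i => i < maxn 1 n) env -> rep n env s m ->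
  let s' := run n c env s in
  exists2 m', reach P (cost n c) (State p m (minp s) (mout s))
    (State (p + size (compile p (size env) c)) m' (minp s') (mout s')) &
    rep n env s' m'.
Proof.
elim: c env s p m => [k x|k x y|k x y|k x|k a x y|a x y k|k|k||c1 IH1 c2 IH2
  |k c1 IH1 c2 IH2|c IH] env s p m.
- move=> /= [C _] ve H; exists (upd m (scal_addr k) x); last exact: rep_set_scal.
  by apply: (reach_step C); rewrite addn1; apply: reach_pc; lia.
- move=> /= [C _] ve H; exists (upd m (scal_addr k) (scal s x + scal s y)); last exact: rep_set_scal.
  by apply: (reach_step C); rewrite addn1 /=; case: H => _ H3 *; rewrite !H3; apply: reach_pc; lia.
- move=> /= [C _] ve H; exists (upd m (scal_addr k) (scal s x - scal s y)); last exact: rep_set_scal.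
  by apply: (reach_step C); rewrite addn1 /=; case: H => _ H3 *; rewrite !H3; apply: reach_pc; lia.
- move=> /= [C _] ve H; exists (upd m (scal_addr k) (nth 0 env x)); last exact: rep_set_scal.
  apply: (reach_step C); rewrite addn1 /=; case: H => [[-> _] _ -> *].
  by rewrite addn0; apply: reach_pc; lia.
- have -> : compile p (size env) (CLoad k a x y) = addr_code (size env) a x y ++ [:: ILoad (scal_addr k) 6].
    by rewrite cats1.
  rewrite code_at_cat size_cat size_addr_code [size [:: _]]/= => -[C1 [C2 _]] ve H.
  have [m1 R1 [E1 E2]] := reach_addr (minp s) (mout s) H C1.
  exists (upd m1 (scal_addr k) (mat s a (nth 0 env x) (nth 0 env y))).
    rewrite [cost _ _]/= addnS -addn1; apply: (reach_trans R1).
    apply: (reach_step C2) => /=; rewrite E2.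
    have /(rep_off_temp E1) [_ _ _ _ ->] := H; try exact: nth_lt_max.
    by apply: reach_pc; lia.
  by apply: rep_set_scal; apply: rep_off_temp H.
- have -> : compile p (size env) (CStore a x y k) = addr_code (size env) a x y ++ [:: IStore 6 (scal_addr k)].
    by rewrite cats1.
  rewrite code_at_cat size_cat size_addr_code [size [:: _]]/= => -[C1 [C2 _]] ve H.
  have [m1 R1 [E1 E2]] := reach_addr (minp s) (mout s) H C1.
  exists (upd m1 (mat_addr n a (nth 0 env x) (nth 0 env y)) (scal s k)).
    rewrite [cost _ _]/= addnS -addn1; apply: (reach_trans R1).
    apply: (reach_step C2) => /=; rewrite E2.
    have /(rep_off_temp E1) [_ -> _ _ _] := H.
    by apply: reach_pc; lia.
  by apply: rep_set_mat; rewrite ?nth_lt_max //; apply: rep_off_temp H.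
- move=> /= [C _] ve H; exists (upd m (scal_addr k) (head 0 (minp s))).
    by apply: (reach_step C); rewrite addn1; apply: reach_pc; lia.
  exact: (rep_io _ _ (rep_set_scal k _ H)).
- move=> /= [C _] ve H; exists m; last exact: rep_io.
  by apply: (reach_step C); rewrite addn1 /=; case: H => _ -> *; apply: reach_pc; lia.
- by move=> /= _ ve H; exists m => //; rewrite addn0; apply: reach_pc; lia.
- rewrite /= code_at_cat size_cat => -[C1 C2] ve H.
  have [m1 R1 H1] := IH1 _ _ _ _ C1 ve H.
  have [m2 R2 H2] := IH2 _ _ _ _ C2 ve H1.
  exists m2 => //; rewrite addnA; exact: (reach_trans R1 R2).
- rewrite /=; set c2' := compile _ _ c2; set q := p + _; set c1' := compile _ _ c1.
  rewrite code_at_cat => -[C0 [C2 [C3 [C4 C1]]]] ve H.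
  have Eq : (p.+1 + size c2').+2 = q by rewrite /q; lia.
  have Ee : p + (size (c2' ++ [:: IConst 5 1, IJump (q + size c1') 5 & c1'])).+1 = q + size c1'.
    by rewrite size_cat /= /q; lia.
  rewrite Ee.
  rewrite Eq in C1.
  case: ifP => sk.
    have [m1 R1 H1] := IH1 _ _ _ _ C1 ve H.
    exists m1 => //; apply: (@reach_le _ (cost n c1).+1); first lia.
    apply: (reach_step C0) => /=; case: (H) => _ -> _ _ _; rewrite sk; exact: R1.
  have [m2 R2 H2] := IH2 _ _ _ _ C2 ve H.
  exists (upd m2 5 1); last by apply: rep_off_temp H2; apply/off_temp_upd5.
  apply: (@reach_le _ (cost n c2 + 2).+1); first lia.
  apply: (reach_step C0) => /=; case: (H) => _ -> _ _ _; rewrite sk.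
  apply: (reach_trans R2).
  apply: (reach_step C3); apply: (reach_step C4) => /=; rewrite {1}/upd /=; apply: reach_pc; lia.
- rewrite /=; set c' := compile _ _ c; set v := 8 * size env + 2.
  move=> [C1 [C2 [C3 [C4]]]]; rewrite code_at_cat => -[Cb [D1 [D2 [D3 [D4 [D5 _]]]]]] ve H.
  rewrite -[p.+4]addn4 in Cb D1 D2 D3 D4 D5.
  set tst := p + (size c' + 7) in C4.
  have Et : (p + 4 + size c').+3 = tst by rewrite /tst; lia.
  have Ee : p + (size (c' ++ [:: IConst 5 1; IAdd v v 5; IAdd v.+1 v.+1 7; ISub 5 7 v;
      IJump (p + 4) 5])).+4
     = tst.+2 by rewrite size_cat /= /tst; lia.
  rewrite Ee.
  rewrite !Et in D4 D5.
  pose loop j := foldl (fun s i => run n c (i :: env) s) s (iota 0 j).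
  (* Induction on the number k of iterations left, starting from the loop test; the 2 extra steps
     are the final, failing test. *)
  have Hlen k j m1 : j + k = n -> rep n (j :: env) (loop j) m1 ->
    exists2 m2, reach P (k * (cost n c + 5) + 2)
       (State tst m1 (minp (loop j)) (mout (loop j)))
       (State tst.+2 m2 (minp (loop n)) (mout (loop n))) & rep n env (loop n) m2.
    elim: k j m1 => [|k IHk] j m1 Ej H1.
      exists (upd m1 5 0); last first.
        apply: (rep_off_temp (off_temp_upd5 _ (off_temp_refl _))).
        by move: H1; rewrite -Ej addn0; apply: rep_pop.
      have Ejn : j = n by rewrite -Ej addn0.
      apply: (reach_step D4); apply: (reach_step D5) => /=.
      have [[_ ->] _ /(_ 0)] := H1; rewrite /ctr_addr /= subn1 /= -/v => -> _ _.
      by rewrite Ejn subnn /upd eqxx /=; apply: reach_pc; lia.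
    have jn : j < n by rewrite -Ej; lia.
    have jn' : all (fun i => i < maxn 1 n) (j :: env).
      by rewrite /= ve andbT leq_max jn orbT.
    have H1' : rep n (j :: env) (loop j) (upd m1 5 (n - j)).
      by apply: (rep_off_temp (off_temp_upd5 _ (off_temp_refl _))).
    have [m2 R2 H2] := IH (j :: env) _ _ _ Cb jn' H1'.
    have Eloop : run n c (j :: env) (loop j) = loop j.+1.
      by rewrite /loop -addn1 iotaD foldl_cat.
    rewrite Eloop in R2 H2.
    have [m3 R3 H3] := IHk j.+1 _ (ltac:(lia)) (rep_ctrS H2).
    exists m3 => //.
    apply: (@reach_le _ (cost n c + (k * (cost n c + 5) + 2).+3).+2); first lia.
    apply: (reach_step D4); apply: (reach_step D5) => /=.
    have [[_ E7] _ /(_ 0)] := H1; rewrite E7 /ctr_addr /= subn1 /= -/v => -> _ _.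
    rewrite [upd _ 5 _ 5]/upd eqxx subn_gt0 jn.
    apply: (reach_trans R2).
    apply: (reach_step D1); apply: (reach_step D2); apply: (reach_step D3) => /=.
    have [[_ F7] _ /(_ 0) F0 /(_ 0) F1 _] := H2.
    move: F0 F1; rewrite /ctr_addr /ctrn_addr /= subn1 /= -/v => F0 F1.
    have Ev : 8 * size env + 3 = v.+1 by rewrite /v; lia.
    rewrite Ev in F1.
    have -> : upd m2 5 1 v + upd m2 5 1 5 = j.+1.
      by rewrite /upd eqxx ifN ?F0 ?addn1 // /v; lia.
    have -> : upd (upd m2 5 1) v j.+1 v.+1 + upd (upd m2 5 1) v j.+1 7 = j.+1 * n.
      rewrite /upd !ifN; try by rewrite /v; lia.
      by rewrite F1 F7 mulSn addnC.
    rewrite Et; exact: R3.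
  have [m2 R2 H2] := Hlen n 0 _ (add0n n) (rep_ctr0 H).
  exists m2 => //.
  rewrite [n * _ + 6](_ : _ = (n * (cost n c + 5) + 2).+4); last lia.
  apply: (reach_step C1) => /=; apply: (reach_step C2) => /=.
  apply: (reach_step C3) => /=; apply: (reach_step C4) => /=.
  exact: R2.
Qed.

Definition program_of c : program := IRead 7 :: compile 1 0 c.

Definition initial_memory (w : seq nat) :=
  Memory (fun=> 0) (fun _ _ _ => 0) w [::].

Lemma program_of_correct c : exists a d, forall n w,
  outputs_within (program_of c) (n :: w) (a * n ^ d + a)
    (mout (run n c [::] (initial_memory w))).
Proof.
have [a [d Hc]] := cost_poly c.
exists (a * 2 ^ d + a + 1), d => n w.
set P := program_of c.
have CP : code_at P 1 (compile 1 0 c) by exact: (code_at_all _ [:: IRead 7]).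
pose m0 := upd (fun=> 0) 7 n.
have H0 : rep n [::] (initial_memory w) m0.
  rewrite /m0 /upd; split=> //.
  - by move=> k; rewrite ifN // /scal_addr; lia.
  - by move=> x; rewrite nth_nil.
  - by move=> x; rewrite nth_nil.
  - by move=> k i j _ _; rewrite ifN // /mat_addr; lia.
have [m' [t tb Rt] H'] := compile_correct (env := [::]) CP isT H0.
rewrite /outputs_within.
have Hst : exists2 t', t' <= (cost n c).+1 & iter t' (step P) (init (n :: w)) =
   State (size P) m' (minp (run n c [::] (initial_memory w))) (mout (run n c [::] (initial_memory w))).
  exists t.+1 => //; rewrite iterSr -[step P _]/(State 1 m0 w [::]) Rt.
  by [].
have [t' t'b Rt'] := Hst.
have le : t' <= (a * 2 ^ d + a + 1) * n ^ d + (a * 2 ^ d + a + 1).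
  apply: (leq_trans t'b); apply: (leq_ltn_trans (Hc n)).
  have : n.+1 ^ d <= 2 ^ d * n ^ d + 1.
    have [->|n0] := posnP n; first by rewrite exp1n addn1.
    rewrite -expnMn; apply: leq_trans (leq_addr _ _); case: (d) => // d'; rewrite leq_exp2r //; lia.
  move=> /(leq_mul (leqnn a)) Hn.
  apply: (leq_ltn_trans Hn); nia.
rewrite -(subnK le) iterD Rt'.
set st := State _ _ _ _.
have -> : forall k, iter k (step P) st = st.
  by elim=> [|k IHk] //=; rewrite IHk /step /= onth_default.
by rewrite /halted /=.
Qed.

(** * Arithmetic expressions over arrays *)

Inductive exp : Type :=
| EConst of nat
| EIdx of nat
| EMat of nat & nat & nat
| EAdd of exp & exp
| ESub of exp & exp
| EIf of exp & exp & exp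
| ESum of exp
| EMul of nat & exp & exp
| EDiv of nat & exp & exp.

Definition arrays := nat -> nat -> nat -> nat.

(* Products and quotients are truncated so that they run in time n ^ q. *)
Fixpoint ev (n : nat) (M : arrays) (env : seq nat) (e : exp) : nat :=
  match e with
  | EConst c => c
  | EIdx x => nth 0 env x
  | EMat k x y => M k (nth 0 env x) (nth 0 env y)
  | EAdd a b => ev n M env a + ev n M env b
  | ESub a b => ev n M env a - ev n M env b
  | EIf a b c => if 0 < ev n M env a then ev n M env b else ev n M env c
  | ESum a => \sum_(i < n) ev n M (nat_of_ord i :: env) a
  | EMul q a b => ev n M env a * minn (ev n M env b) (n ^ q)
  | EDiv q a b =>
      if ev n M env b == 0 then n ^ q
      else minn (ev n M env a %/ ev n M env b) (n ^ q)
  end.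

Fixpoint scoped (d : nat) (e : exp) : bool :=
  match e with
  | EConst _ => true
  | EIdx x => x < d
  | EMat _ x y => (x < d) && (y < d)
  | EAdd a b | ESub a b | EMul _ a b | EDiv _ a b => scoped d a && scoped d b
  | EIf a b c => [&& scoped d a, scoped d b & scoped d c]
  | ESum a => scoped d.+1 a
  end.

Definition agree n (M M' : arrays) :=
  forall k i j, i < n -> j < n -> M k i j = M' k i j.

(** Allows statements to run inside loops, whose counters lengthen the environment by [rest]: a
    scoped expression cannot see them, nor any entry outside the n by n range. *)
Lemma ev_ext n M M' env rest e :
  agree n M M' -> all (fun i => i < n) env -> scoped (size env) e ->
  ev n M (env ++ rest) e = ev n M' env e.
Proof.
move=> HM; elim: e env => //= [x|k x y|a IHa b IHb|a IHa b IHb|a IHa b IHb c IHc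
  |a IHa|q a IHa b IHb|q a IHa b IHb] env Henv.
- by rewrite nth_cat => ->.
- by move=> /andP[Hx Hy]; rewrite !nth_cat Hx Hy HM //; apply: (all_nthP 0 Henv).
- by move=> /andP[Ha Hb]; rewrite IHa ?IHb.
- by move=> /andP[Ha Hb]; rewrite IHa ?IHb.
- by move=> /and3P[Ha Hb Hc]; rewrite IHa ?IHb ?IHc.
- by move=> Ha; apply: eq_bigr => i _; rewrite -cat_cons IHa //= ltn_ord.
- by move=> /andP[Ha Hb]; rewrite IHa ?IHb.
- by move=> /andP[Ha Hb]; rewrite IHa ?IHb.
Qed.

Definition CForN q c := iter q CFor c.

Lemma run_for n c env (P : nat -> memory -> Prop) s :
  P 0 s -> (forall i s, i < n -> P i s -> P i.+1 (run n c (i :: env) s)) ->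
  P n (run n (CFor c) env s).
Proof.
move=> P0 PS /=.
have H j : j <= n -> P j (foldl (fun s0 i => run n c (i :: env) s0) s (iota 0 j)).
  elim: j => [|j IH] // jn; rewrite -addn1 iotaD foldl_cat /= add0n addn1.
  by apply: PS => //; apply: IH; apply: ltnW.
exact: H.
Qed.

(** The preservation hypothesis ranges over all environments because the body runs under q
    additional counters. *)
Lemma run_forN n q c env (P : nat -> memory -> Prop) s :
  P 0 s -> (forall i env s, P i s -> P i.+1 (run n c env s)) ->
  P (n ^ q) (run n (CForN q c) env s).
Proof.
move=> P0 PS.
suff H : forall i env s, P i s -> P (i + n ^ q) (run n (CForN q c) env s) by apply: (H 0).
elim: q {P0} => [|q IH] i {}env {}s Pi; first by rewrite addn1; apply: PS.
rewrite expnS; apply: (@run_for n _ _ (fun j s => P (i + j * n ^ q) s)).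
  by rewrite mul0n addn0.
by move=> j s' _ Pj; rewrite mulSn [n ^ q + _]addnC addnA; apply: IH.
Qed.

(** Stack discipline: the value lands in scalar [r] and lower scalars are preserved. A product
    counts its second factor down; a quotient counts subtractions, so that a zero divisor yields n ^
    q, as in [ev]. *)
Fixpoint cexp (r : nat) (e : exp) : cmd :=
  match e with
  | EConst c => CConst r c
  | EIdx x => CIdx r x
  | EMat k x y => CLoad r k.+1 x y
  | EAdd a b => CSeq (CSeq (cexp r a) (cexp r.+1 b)) (CAdd r r r.+1)
  | ESub a b => CSeq (CSeq (cexp r a) (cexp r.+1 b)) (CSub r r r.+1)
  | EIf a b c => CSeq (cexp r a) (CIf r (cexp r b) (cexp r c))
  | ESum a => CSeq (CConst r 0) (CFor (CSeq (cexp r.+1 a) (CAdd r r r.+1)))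
  | EMul q a b =>
      CSeq (CSeq (CSeq (cexp r a) (cexp r.+1 b))
                 (CSeq (CConst r.+2 0) (CConst r.+3 1)))
           (CSeq (CForN q (CIf r.+1 (CSeq (CAdd r.+2 r.+2 r) (CSub r.+1 r.+1 r.+3)) CSkip))
                 (CSeq (CConst r.+1 0) (CAdd r r.+2 r.+1)))
  | EDiv q a b =>
      CSeq (CSeq (CSeq (cexp r a) (cexp r.+1 b))
                 (CSeq (CConst r.+2 0) (CConst r.+3 1)))
           (CSeq (CForN q (CSeq (CSub r.+4 r.+1 r)
                    (CIf r.+4 CSkip
                       (CSeq (CSub r r r.+1) (CAdd r.+2 r.+2 r.+3)))))
                 (CSeq (CConst r.+1 0) (CAdd r r.+2 r.+1)))
  end.

Definition frame r (s s' : memory) :=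
  [/\ forall k, k < r -> scal s' k = scal s k, mat s' = mat s,
      minp s' = minp s & mout s' = mout s].

Lemma frame_trans r s1 s2 s3 : frame r s1 s2 -> frame r s2 s3 -> frame r s1 s3.
Proof.
move=> [A1 A2 A3 A4] [B1 B2 B3 B4]; split; rewrite ?B2 ?B3 ?B4 //.
by move=> k kr; rewrite B1 ?A1.
Qed.

Lemma frame_set r k x s : r <= k -> frame r s (set_scal s k x).
Proof.
by move=> rk; split=> //= i ir; rewrite /upd ifN //; apply/eqP => E; lia.
Qed.

Lemma frame_le r r' s s' : r <= r' -> frame r' s s' -> frame r s s'.
Proof. by move=> rr [A1 A2 A3 A4]; split=> // k kr; apply: A1; lia. Qed.

Lemma frame_scal r s s' k : frame r s s' -> k < r -> scal s' k = scal s k.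
Proof. by case=> A *; apply: A. Qed.

Lemma run_cexp n e r env s :
  let s' := run n (cexp r e) env s in
  frame r s s' /\ scal s' r = ev n (fun k => mat s k.+1) env e.
Proof.
elim: e r env s => [c|x|k x y|a IHa b IHb|a IHa b IHb|a IHa b IHb c IHc
  |a IHa|q a IHa b IHb|q a IHa b IHb] r env s.
- by split; [apply: frame_set|rewrite /= /upd eqxx].
- by split; [apply: frame_set|rewrite /= /upd eqxx].
- by split; [apply: frame_set|rewrite /= /upd eqxx].
- rewrite [run _ _ _ _]/=; set s1 := run n _ env s; set s2 := run n _ env s1.
  have [F1 E1] : frame r s s1 /\ _ := IHa r env s.
  have [F2 E2] : frame r.+1 s1 s2 /\ _ := IHb r.+1 env s1.
  split.
    apply: (frame_trans F1); apply: (frame_trans (frame_le (leqnSn r) F2)).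
    exact: frame_set.
  rewrite /= /upd eqxx (frame_scal F2) // E1 E2.
  by have [_ -> _ _] := F1.
- rewrite [run _ _ _ _]/=; set s1 := run n _ env s; set s2 := run n _ env s1.
  have [F1 E1] : frame r s s1 /\ _ := IHa r env s.
  have [F2 E2] : frame r.+1 s1 s2 /\ _ := IHb r.+1 env s1.
  split.
    apply: (frame_trans F1); apply: (frame_trans (frame_le (leqnSn r) F2)).
    exact: frame_set.
  rewrite /= /upd eqxx (frame_scal F2) // E1 E2.
  by have [_ -> _ _] := F1.
- rewrite [run _ _ _ _]/=; set s1 := run n _ env s.
  have [F1 E1] : frame r s s1 /\ _ := IHa r env s.
  have [_ Em _ _] := F1.
  rewrite E1 /=; case: ifP => _; rewrite -Em.
    by have [F2 E2] := IHb r env s1; split=> //; apply: frame_trans F2.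
  by have [F2 E2] := IHc r env s1; split=> //; apply: frame_trans F2.
- rewrite [run _ _ _ _]/=.
  set s0 := set_scal s r 0.
  pose Q j s' := frame r s s' /\
    scal s' r = \sum_(0 <= i < j) ev n (fun k => mat s k.+1) (i :: env) a.
  rewrite -/(run n (CFor (CSeq (cexp r.+1 a) (CAdd r r r.+1))) env s0).
  have : Q n (run n (CFor (CSeq (cexp r.+1 a) (CAdd r r r.+1))) env s0).
    apply: run_for.
      by split; [exact: frame_set|rewrite big_nil /= /upd eqxx].
    move=> i s1 _ [F1 E1] /=; set s2 := run n _ _ s1.
    have [F2 E2] : frame r.+1 s1 s2 /\ _ := IHa r.+1 (i :: env) s1.
    split.
      apply: (frame_trans F1); apply: (frame_trans (frame_le (leqnSn r) F2)).
      exact: frame_set.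
    rewrite big_nat_recr //= /upd eqxx (frame_scal F2) // E1 E2.
    by have [_ -> _ _] := F1.
  by rewrite /Q big_mkord.
- rewrite [cexp _ _]/= [run _ _ _ _]/=.
  set s1 := run n _ env s; set s2 := run n _ env s1.
  have [F1 E1] : frame r s s1 /\ _ := IHa r env s.
  have [F2 E2] : frame r.+1 s1 s2 /\ _ := IHb r.+1 env s1.
  have [_ Em _ _] := F1; rewrite Em in E2.
  set s3 := set_scal (set_scal s2 r.+2 0) r.+3 1.
  pose A := ev n (fun k => mat s k.+1) env a.
  pose B := ev n (fun k => mat s k.+1) env b.
  pose Q j s' := frame r s s' /\ [/\ scal s' r = A, scal s' r.+1 = B - j,
    scal s' r.+2 = A * minn B j & scal s' r.+3 = 1].
  have : Q (n ^ q) (run n (CForN q (CIf r.+1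
    (CSeq (CAdd r.+2 r.+2 r) (CSub r.+1 r.+1 r.+3)) CSkip)) env s3).
    apply: run_forN.
      split.
        apply: (frame_trans F1); apply: (frame_trans (frame_le (leqnSn r) F2)).
        by apply: frame_trans; apply: frame_set; lia.
      rewrite minn0 muln0 subn0 /= /upd; split.
      - by rewrite !ifN ?(frame_scal F2) ?E1; lia.
      - by rewrite !ifN ?E2; lia.
      - by rewrite ifN ?eqxx; lia.
      - by rewrite eqxx.
    move=> j env' s' [F' [H0 H1 H2 H3]] /=.
    case: ifP => Hpos; last first.
      split=> //; split=> //; first by rewrite H1; lia.
      by rewrite H2; congr (_ * _); lia.
    split.
      by apply: (frame_trans F'); apply: frame_trans; apply: frame_set; lia.
    rewrite /= /upd; split.
    - by rewrite !ifN; lia.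
    - by rewrite eqxx !ifN ?H1 ?H3; lia.
    - rewrite ifN ?eqxx ?H0 ?H2; last lia.
      rewrite H1 in Hpos.
      by rewrite -mulnSr; congr (_ * _); lia.
    - by rewrite !ifN; lia.
  move=> [F' [H0 H1 H2 H3]]; split.
    by apply: (frame_trans F'); apply: frame_trans; apply: frame_set; lia.
  by rewrite /= /upd eqxx ifN ?H2 ?eqxx ?addn0 //; lia.
- rewrite [cexp _ _]/= [run _ _ _ _]/=.
  set s1 := run n _ env s; set s2 := run n _ env s1.
  have [F1 E1] : frame r s s1 /\ _ := IHa r env s.
  have [F2 E2] : frame r.+1 s1 s2 /\ _ := IHb r.+1 env s1.
  have [_ Em _ _] := F1; rewrite Em in E2.
  set s3 := set_scal (set_scal s2 r.+2 0) r.+3 1.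
  pose A := ev n (fun k => mat s k.+1) env a.
  pose B := ev n (fun k => mat s k.+1) env b.
  pose quo j := if B == 0 then j else minn (A %/ B) j.
  pose Q j s' := frame r s s' /\ [/\ scal s' r = A - quo j * B, scal s' r.+1 = B,
    scal s' r.+2 = quo j & scal s' r.+3 = 1].
  have : Q (n ^ q) (run n (CForN q (CSeq (CSub r.+4 r.+1 r)
                    (CIf r.+4 CSkip
                       (CSeq (CSub r r r.+1) (CAdd r.+2 r.+2 r.+3))))) env s3).
    apply: run_forN.
      split.
        apply: (frame_trans F1); apply: (frame_trans (frame_le (leqnSn r) F2)).
        by apply: frame_trans; apply: frame_set; lia.
      have -> : quo 0 = 0 by rewrite /quo minn0; case: eqP.
      rewrite mul0n subn0 /= /upd; split.
      - by rewrite !ifN ?(frame_scal F2) ?E1; lia.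
      - by rewrite !ifN ?E2; lia.
      - by rewrite ifN ?eqxx; lia.
      - by rewrite eqxx.
    move=> j env' s' [F' [H0 H1 H2 H3]] /=.
    (* A further subtraction takes place exactly when the remainder is still at least [B]. *)
    have Hq : quo j.+1 = if B <= A - quo j * B then (quo j).+1 else quo j.
      rewrite /quo; have [->|B0] := eqVneq B 0; first by rewrite leq0n.
      rewrite -lt0n in B0.
      case: (leqP (A %/ B) j) => Hj.
        rewrite (minn_idPl _) ?ifN //; last by apply: leq_trans Hj _.
        by rewrite -ltnNge ltn_subLR 1?mulnC -?ltn_divLR //; lia.
      rewrite (minn_idPr Hj) ifT // leq_subRL.
        by rewrite -mulSnr -leq_divRL.
      by rewrite -leq_divRL //; lia.
    rewrite {1}/upd eqxx subn_gt0 H0 H1 ltnNge /Q Hq.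
    case: (leqP B (A - quo j * B)) => Hle /=.
      split.
        apply: (frame_trans F').
        by apply: frame_trans; [|apply: frame_trans]; apply: frame_set; lia.
      rewrite /= /upd; split.
      - by rewrite eqxx !ifN ?H0 ?H1 ?mulSn; lia.
      - by rewrite !ifN ?H1; lia.
      - by rewrite eqxx !ifN ?H2 ?H3 ?addn1; lia.
      - by rewrite !ifN ?H3; lia.
    split; first by apply: (frame_trans F'); apply: frame_set; lia.
    by rewrite /= /upd; split; rewrite !ifN //; lia.
  move=> [F' [H0 H1 H2 H3]]; split.
    by apply: (frame_trans F'); apply: frame_trans; apply: frame_set; lia.
  by rewrite /= /upd eqxx ifN ?H2 ?eqxx ?addn0 //; lia.
Qed.

(** * Array programs *)

Inductive stmt : Type :=
| SAssign of nat & exp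
| SSeq of stmt & stmt
| SLoop of nat & stmt.

Definition assign (M : arrays) k (F : nat -> nat -> nat) : arrays :=
  fun k' i j => if k' == k then F i j else M k' i j.

(* [SAssign k e] updates all entries of array [k] simultaneously; in [e],
   variable 1 is the row and variable 0 the column. *)
Fixpoint sem n (c : stmt) (M : arrays) : arrays :=
  match c with
  | SAssign k e => assign M k (fun i j => ev n M [:: j; i] e)
  | SSeq c1 c2 => sem n c2 (sem n c1 M)
  | SLoop q c1 => iter (n ^ q) (sem n c1) M
  end.

Fixpoint sscoped (c : stmt) : bool :=
  match c with
  | SAssign _ e => scoped 2 e
  | SSeq c1 c2 => sscoped c1 && sscoped c2
  | SLoop _ c1 => sscoped c1
  end.

(* Array 0 of the machine is a buffer. *)
Fixpoint cstmt (c : stmt) : cmd :=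
  match c with
  | SAssign k e =>
      CSeq (CFor (CFor (CSeq (cexp 0 e) (CStore 0 1 0 0))))
           (CFor (CFor (CSeq (CLoad 0 0 1 0) (CStore k.+1 1 0 0))))
  | SSeq c1 c2 => CSeq (cstmt c1) (cstmt c2)
  | SLoop q c1 => CForN q (cstmt c1)
  end.

Definition models n (s : memory) (M : arrays) w o :=
  [/\ agree n (fun k => mat s k.+1) M, minp s = w & mout s = o].

(** The state of a row-major sweep that has reached position (i, j). *)
Definition filled n k (F : nat -> nat -> nat) i j (s s' : memory) :=
  [/\ forall k', k' != k -> mat s' k' = mat s k',
      forall i' j', i' < n -> j' < n -> (i' < i) || (i' == i) && (j' < j) ->
        mat s' k i' j' = F i' j',
      minp s' = minp s & mout s' = mout s].

Lemma run_fill n k F body env s :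
  (forall i j s1, i < n -> j < n -> filled n k F i j s s1 ->
     filled n k F i j.+1 s (run n body [:: j, i & env] s1)) ->
  filled n k F n 0 s (run n (CFor (CFor body)) env s).
Proof.
move=> H; apply: (@run_for n _ _ (fun i s' => filled n k F i 0 s s')).
  by split=> // i' j' _ _; rewrite ltn0 andbF.
move=> i s1 ilt Hs1.
have [] : filled n k F i n s (run n (CFor body) (i :: env) s1).
  apply: (@run_for n _ _ (fun j s' => filled n k F i j s s')) => //.
  by move=> j s2 jlt; apply: H.
move=> A1 A2 A3 A4; split=> // i' j' Hi' Hj'.
rewrite ltn0 andbF orbF ltnS leq_eqVlt => /orP Hc; apply: A2 => //.
by case: Hc => ->; rewrite ?orbT //= Hj' orbT.
Qed.

Lemma cstmt_correct n c env s M w o :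
  sscoped c -> models n s M w o -> models n (run n (cstmt c) env s) (sem n c M) w o.
Proof.
elim: c env s M => [k e|c1 IH1 c2 IH2|q c IH] env s M.
- move=> /= sc [HM Hw Ho].
  rewrite -/(run n (CFor (CFor (CSeq (cexp 0 e) (CStore 0 1 0 0)))) env s).
  set s1 := run n _ env s.
  pose F i j := ev n M [:: j; i] e.
  (* New entries go to the buffer, so that [e] reads the old array during the whole sweep. *)
  have [A1 A2 A3 A4] : filled n 0 F n 0 s s1.
    apply: run_fill => i j s2 ilt jlt [B1 B2 B3 B4] /=.
    have [[_ Em Ei Eo] Ee] := run_cexp n e 0 [:: j, i & env] s2.
    split; rewrite /= ?Em ?Ei ?Eo //.
      move=> k' kn0; apply/funext => i'; apply/funext => j'.
      by rewrite /mat_upd (negbTE kn0) /= B1.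
    move=> i' j' Hi Hj Hc; rewrite /mat_upd eqxx /=.
    case: (eqVneq i' i) => [E1|ni]; case: (eqVneq j' j) => [E2|nj] /=;
      try by rewrite B2 //; lia.
    - rewrite E1 E2 Ee -cat1s -(cat1s i env) catA; apply: ev_ext; rewrite /= ?ilt ?jlt //.
      by move=> k' i2 j2 H1 H2; rewrite B1 // HM.
  rewrite -/(run n (CFor (CFor (CSeq (CLoad 0 0 1 0) (CStore k.+1 1 0 0)))) env s1).
  set s2 := run n _ env s1.
  have [B1 B2 B3 B4] : filled n k.+1 F n 0 s1 s2.
    apply: run_fill => i j s3 ilt jlt [B1 B2 B3 B4] /=.
    split=> //=.
      move=> k' kn0; apply/funext => i'; apply/funext => j'.
      by rewrite /mat_upd (negbTE kn0) /= B1.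
    move=> i' j' Hi Hj Hc; rewrite /mat_upd eqxx /=.
    case: (eqVneq i' i) => [E1|ni]; case: (eqVneq j' j) => [E2|nj] /=;
      try by rewrite B2 //; lia.
    - by rewrite E1 E2 {1}/upd eqxx B1 // A2 // ilt.
  split; rewrite ?B3 ?B4 ?A3 ?A4 // => k' i j ilt jlt; rewrite /assign.
  case: eqP => [->|nk]; first by rewrite B2 // ilt.
  by rewrite B1 //; [rewrite A1 // HM|apply/eqP => -[]].
- by move=> /= /andP[s1 s2] H; apply: IH2 => //; apply: IH1.
- move=> /= sc H.
  apply: (@run_forN n q _ env (fun i s' => models n s' (iter i (sem n c) M) w o)) => //.
  by move=> i env' s' Hi /=; apply: IH.
Qed.

(** * Input and output *)

Definition adj_arrays n (G : sgraph n) : arrays := fun k i j =>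
  if k is 0 then
    if (insub i, insub j) is (Some u, Some v) then nat_of_bool (adj G u v) else 0
  else 0.

Definition read_graph : cmd := CFor (CFor (CSeq (CRead 0) (CStore 1 1 0 0))).

Definition print_diag k : cmd :=
  CFor (CSeq (CLoad 0 k.+1 0 0) (CSeq (CIf 0 (CConst 0 1) CSkip) (CPrint 0))).

Lemma drop_enum_ord n (u : 'I_n) : drop u (enum 'I_n) = u :: drop u.+1 (enum 'I_n).
Proof. by rewrite (drop_nth u) ?size_enum_ord // nth_ord_enum. Qed.

Lemma run_read_graph n (G : sgraph n) :
  models n (run n read_graph [::] (initial_memory (behead (encode_graph G))))
    (adj_arrays G) [::] [::].
Proof.
pose f u v := nat_of_bool (adj G u v).
pose rows i := [seq f u v | u <- drop i (enum 'I_n), v <- enum 'I_n].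
pose Q i j w s := [/\ forall k i' j', k != 1 -> mat s k i' j' = 0,
  forall u v : 'I_n, (u < i) || (u == i :> nat) && (v < j) -> mat s 1 u v = f u v,
  minp s = w & mout s = [::]].
have : Q n 0 (rows n) (run n read_graph [::] (initial_memory (behead (encode_graph G)))).
  apply: (@run_for n _ _ (fun i s => Q i 0 (rows i) s)).
    by split=> // [u v|]; rewrite ?ltn0 ?andbF // /rows drop0.
  move=> i s ilt Hs; pose u := Ordinal ilt.
  have Er : rows i = [seq f u v | v <- drop 0 (enum 'I_n)] ++ rows i.+1.
    by rewrite /rows -[i]/(nat_of_ord u) (drop_enum_ord u) drop0.
  have [] : Q i n ([seq f u v | v <- drop n (enum 'I_n)] ++ rows i.+1)
    (run n (CFor (CSeq (CRead 0) (CStore 1 1 0 0))) [:: i] s).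
    apply: (@run_for n _ _ (fun j s => Q i j ([seq f u v | v <- drop j (enum 'I_n)] ++ rows i.+1) s)).
      by rewrite -Er.
    move=> j s1 jlt [A1 A2 A3 A4]; pose v := Ordinal jlt.
    have Ew : minp s1 = f u v :: [seq f u v | v <- drop j.+1 (enum 'I_n)] ++ rows i.+1.
      by rewrite A3 -{1}[j]/(nat_of_ord v) (drop_enum_ord v).
    split; rewrite /= ?Ew //.
      by move=> k i' j' k1; rewrite /mat_upd (negbTE k1) A1.
    move=> u' v' Hc; rewrite /mat_upd eqxx /= {1}/upd eqxx /=.
    case: (eqVneq (nat_of_ord u') i) => [E1|ni]; case: (eqVneq (nat_of_ord v') j) => [E2|nj] /=;
      try by rewrite A2 //; lia.
    by congr (f _ _); apply: val_inj.
  rewrite drop_oversize ?size_enum_ord //= => A1 A2 A3 A4; split=> // u' v'.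
  rewrite ltn0 andbF orbF ltnS leq_eqVlt => /orP Hc; apply: A2.
  by case: Hc => ->; rewrite ?orbT //= ltn_ord orbT.
rewrite /rows drop_oversize ?size_enum_ord //= => -[A1 A2 A3 A4]; split=> //.
case=> [|k] i j ilt jlt /=; last by rewrite A1.
by rewrite !insubT (A2 (Ordinal ilt) (Ordinal jlt)) //= ilt.
Qed.

Lemma run_print_diag n k (s : memory) M w :
  models n s M w [::] ->
  mout (run n (print_diag k) [::] s) = [seq nat_of_bool (0 < M k v v) | v <- iota 0 n].
Proof.
move=> [HM Hw Ho].
pose Q i s' := mat s' = mat s /\ mout s' = [seq nat_of_bool (0 < M k v v) | v <- iota 0 i].
have [] // : Q n (run n (print_diag k) [::] s).
apply: run_for => // i s1 ilt [A1 A2].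
have E : mat s1 k.+1 i i = M k i i by rewrite A1 HM.
rewrite /Q -[in iota 0 i.+1]addn1 iotaD map_cat -A2 cats1 add0n.
rewrite /= /upd eqxx E.
by case: (posnP (M k i i)) => [->|H]; rewrite ?H /= /upd eqxx ?E.
Qed.

Theorem stmt_polynomial_time (c0 : stmt) k :
  sscoped c0 ->
  polynomial_time (fun n (G : sgraph n) =>
    [ffun v : 'I_n => 0 < sem n c0 (adj_arrays G) k v v]).
Proof.
move=> sc.
have [a [d H]] := program_of_correct (CSeq read_graph (CSeq (cstmt c0) (print_diag k))).
exists (program_of (CSeq read_graph (CSeq (cstmt c0) (print_diag k)))), a, d => n G.
have := H n (behead (encode_graph G)).
set o := mout _; set o' := encode_spins _.
suff -> : o = o' by [].
rewrite /o [run _ _ _ _]/= -/(run n read_graph _ _).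
have := cstmt_correct [::] sc (run_read_graph G).
move/run_print_diag => -> ; rewrite /o' /encode_spins -val_enum_ord -map_comp.
by apply: eq_map => v /=; rewrite ffunE.
Qed.

End Imperative.

(** * The solver *)

Section Algorithm.
Local Open Scope nat_scope.

Definition epow q := iter q ESum (EConst 1).
(** The factor n ^ q equals the truncation bound, so this product is exact. *)
Definition escale q e := EMul q e (epow q).
Definition eeq x y :=
  EIf (ESub (EIdx x) (EIdx y)) (EConst 0)
    (EIf (ESub (EIdx y) (EIdx x)) (EConst 0) (EConst 1)).
Definition enot e := EIf e (EConst 0) (EConst 1).
Definition eeqb e f := EIf e f (enot f).

(* Arrays: 0 adjacency; 1, 2 positive and negative part of the matrix of the
   current step; 3, 4 of its powers; 5, 6 buffers; 7 trace; 8, 9 positive and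
   negative part of the running sum of solutions; 10 step counter times n ^ 12;
   11 signs; 12 number of inconsistent pairs of each row; 13 output. *)
Definition power_step : stmt :=
  SSeq (SAssign 5 (ESum (EAdd (EMul 28 (EMat 3 2 0) (EMat 1 0 1))
                              (EMul 28 (EMat 4 2 0) (EMat 2 0 1)))))
  (SSeq (SAssign 6 (ESum (EAdd (EMul 28 (EMat 3 2 0) (EMat 2 0 1))
                               (EMul 28 (EMat 4 2 0) (EMat 1 0 1)))))
  (SSeq (SAssign 3 (EMat 5 1 0)) (SAssign 4 (EMat 6 1 0)))).

(* The matrix of the step is n ^ 14 M + n ^ 26 I - diag L, where L is the vector
   of multipliers.  These move by O(n ^ 13) in each of the n ^ 12 steps, so that
   the shift by n ^ 26 makes the matrix positive definite and its entries stay
   below n ^ 28, which makes the truncation in [power_step] inactive. *)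
Definition load_matrix (kappa : nat) : stmt :=
  SSeq (SAssign 1 (EAdd (escale 15 (EMat 0 1 0))
                        (EIf (eeq 1 0) (EAdd (epow 26) (EMat 10 1 0)) (EConst 0))))
  (SSeq (SAssign 2 (EAdd (escale 14 (EConst kappa))
                         (EIf (eeq 1 0) (EMat 8 1 0) (EConst 0))))
  (SSeq (SAssign 3 (eeq 1 0)) (SAssign 4 (EConst 0)))).

Definition add_density : stmt :=
  SSeq (SAssign 7 (ESub (ESum (EMat 3 0 0)) (ESum (EMat 4 0 0))))
  (SSeq (SAssign 8 (EAdd (EMat 8 1 0)
          (EDiv 13 (escale 13 (ESub (EMat 3 1 0) (EMat 4 1 0))) (EMat 7 1 0))))
  (SSeq (SAssign 9 (EAdd (EMat 9 1 0)
          (EDiv 13 (escale 13 (ESub (EMat 4 1 0) (EMat 3 1 0))) (EMat 7 1 0))))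
        (SAssign 10 (EAdd (EMat 10 1 0) (epow 12))))).

Definition solver_step kappa : stmt :=
  SSeq (load_matrix kappa)
  (SSeq (SLoop 15 (SSeq power_step power_step)) add_density).

(** Array 13 adds up the sign patterns of the rows that no row beats in the lexicographic order of
    (number of inconsistencies, index); exactly one row qualifies, so the sum is its pattern. *)
Definition rounding : stmt :=
  SSeq (SAssign 11 (enot (ESub (EMat 9 1 0) (EMat 8 1 0))))
  (SSeq (SAssign 12 (ESum (ESum
           (enot (eeqb (eeqb (EMat 11 3 1) (EMat 11 3 0)) (EMat 11 1 0))))))
  (SAssign 13 (ESum (EIf
     (ESum (EIf (ESub (EMat 12 1 1) (EMat 12 0 0)) (EConst 1)
        (EIf (ESub (EMat 12 0 0) (EMat 12 1 1)) (EConst 0)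
             (ESub (EIdx 1) (EIdx 0)))))
     (EConst 0) (EMat 11 0 1))))).

Definition solver kappa : stmt := SSeq (SLoop 12 (solver_step kappa)) rounding.

Definition sdp_estimator kappa : estimator := fun n G =>
  [ffun v : 'I_n => 0 < sem n (solver kappa) (adj_arrays G) 13 v v].

Lemma sdp_estimator_polynomial kappa : polynomial_time (sdp_estimator kappa).
Proof. exact: stmt_polynomial_time. Qed.

Lemma ev_epow n M env q : ev n M env (epow q) = n ^ q.
Proof.
elim: q env => [|q IH] env //=; under eq_bigr do rewrite IH.
by rewrite sum_nat_const card_ord expnS.
Qed.

Lemma ev_escale n M env q e : ev n M env (escale q e) = ev n M env e * n ^ q.
Proof. by rewrite /escale [LHS]/= ev_epow minnn. Qed.

Lemma ev_eeq n M env x y : ev n M env (eeq x y) = (nth 0 env x == nth 0 env y).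
Proof. by rewrite /= !subn_gt0; case: ltngtP. Qed.

Lemma ev_enot n M env e : ev n M env (enot e) = (ev n M env e == 0).
Proof. by rewrite /=; case: (ev n M env e). Qed.

Lemma ev_eeqb n M env e f :
  ev n M env (eeqb e f) = if 0 < ev n M env e then ev n M env f else (ev n M env f == 0).
Proof. by rewrite /eeqb [LHS]/= -ev_enot. Qed.

#[local] Arguments ev : simpl never.
#[local] Arguments sem : simpl never.
#[local] Arguments epow : simpl never.
#[local] Arguments escale : simpl never.
#[local] Arguments eeq : simpl never.
#[local] Arguments enot : simpl never.
#[local] Arguments eeqb : simpl never.

Lemma ev_const n M env c : ev n M env (EConst c) = c. Proof. by []. Qed.
Lemma ev_idx n M env x : ev n M env (EIdx x) = nth 0 env x. Proof. by []. Qed.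
Lemma ev_mat n M env k x y :
  ev n M env (EMat k x y) = M k (nth 0 env x) (nth 0 env y).
Proof. by []. Qed.
Lemma ev_add n M env a b : ev n M env (EAdd a b) = ev n M env a + ev n M env b.
Proof. by []. Qed.
Lemma ev_sub n M env a b : ev n M env (ESub a b) = ev n M env a - ev n M env b.
Proof. by []. Qed.
Lemma ev_if n M env a b c : ev n M env (EIf a b c) =
  if 0 < ev n M env a then ev n M env b else ev n M env c.
Proof. by []. Qed.
Lemma ev_sum n M env a :
  ev n M env (ESum a) = \sum_(i < n) ev n M (nat_of_ord i :: env) a.
Proof. by []. Qed.
Lemma ev_mul n M env q a b :
  ev n M env (EMul q a b) = ev n M env a * minn (ev n M env b) (n ^ q).
Proof. by []. Qed.
Lemma ev_div n M env q a b : ev n M env (EDiv q a b) =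
  if ev n M env b == 0 then n ^ q
  else minn (ev n M env a %/ ev n M env b) (n ^ q).
Proof. by []. Qed.
Definition evE := (ev_epow, ev_escale, ev_eeq, ev_enot, ev_eeqb, ev_const, ev_idx,
  ev_mat, ev_add, ev_sub, ev_if, ev_sum, ev_mul, ev_div).

Lemma sem_seq n c1 c2 M : sem n (SSeq c1 c2) M = sem n c2 (sem n c1 M).
Proof. by []. Qed.
Lemma sem_assign n k e M :
  sem n (SAssign k e) M = assign M k (fun i j => ev n M [:: j; i] e).
Proof. by []. Qed.
Lemma sem_loop n q c M : sem n (SLoop q c) M = iter (n ^ q) (sem n c) M.
Proof. by []. Qed.
Definition semE := (sem_seq, sem_assign).

Definition pos_part n (M : arrays) i j :=
  M 0 i j * n ^ 15 + (if i == j then n ^ 26 + M 10 i j else 0).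
Definition neg_part n kappa (M : arrays) i j :=
  kappa * n ^ 14 + (if i == j then M 8 i j else 0).

Lemma sem_load n kappa M :
  let M' := sem n (load_matrix kappa) M in
  [/\ forall i j, M' 1 i j = pos_part n M i j,
      forall i j, M' 2 i j = neg_part n kappa M i j,
      forall i j, M' 3 i j = (i == j),
      forall i j, M' 4 i j = 0 &
      forall k, k \notin [:: 1; 2; 3; 4] -> M' k = M k].
Proof.
rewrite /load_matrix !semE; split=> [i j|i j|i j|i j|k]; rewrite /assign /= ?evE /=.
- by rewrite /pos_part lt0b.
- by rewrite /neg_part lt0b.
- by [].
- by [].
- by rewrite !inE !negb_or => /and4P[/negbTE -> /negbTE -> /negbTE -> /negbTE ->].
Qed.

Lemma sem_power n M (P := sem n power_step M) :
  [/\ forall i j, P 3 i j = \sum_(k < n)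
        (M 3 i k * minn (M 1 k j) (n ^ 28) + M 4 i k * minn (M 2 k j) (n ^ 28)),
      forall i j, P 4 i j = \sum_(k < n)
        (M 3 i k * minn (M 2 k j) (n ^ 28) + M 4 i k * minn (M 1 k j) (n ^ 28)) &
      forall k, k \notin [:: 3; 4; 5; 6] -> P k = M k].
Proof.
rewrite /P /power_step !semE; split=> [i j|i j|k].
- by rewrite /assign /= !evE /= ?evE; apply: eq_bigr => k _; rewrite ?evE.
- by rewrite /assign /= !evE /= ?evE; apply: eq_bigr => k _; rewrite ?evE.
- by rewrite /assign !inE !negb_or => /and4P[/negbTE -> /negbTE -> /negbTE -> /negbTE ->].
Qed.

Definition quotient n (x y z : nat) :=
  if z == 0 then n ^ 13 else minn ((x - y) * n ^ 13 %/ z) (n ^ 13).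

Lemma sem_add_density n M (P := sem n add_density M)
    (tr := \sum_(i < n) M 3 i i - \sum_(i < n) M 4 i i) :
  [/\ forall i j, P 8 i j = M 8 i j + quotient n (M 3 i j) (M 4 i j) tr,
      forall i j, P 9 i j = M 9 i j + quotient n (M 4 i j) (M 3 i j) tr,
      forall i j, P 10 i j = M 10 i j + n ^ 12 &
      P 0 = M 0].
Proof.
rewrite /P /add_density !semE; split=> [i j|i j|i j|//]; rewrite /assign /= !evE /=; 
 rewrite /quotient /tr ?evE //.
Qed.

(** * One solver step as a computation with real matrices *)

Section Iteration.
Local Open Scope ring_scope.
Variables (R : realType) (n : nat).

(** Signed matrices are carried as differences of two arrays because the machine computes with
    natural numbers. *)
Definition diff_mx (M : arrays) k l : 'M[R]_n :=
  \matrix_(i, j) ((M k i j)%:R - (M l i j)%:R).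

(** Truncation acts only on the right factors, the entries of the base matrix, so the powers
    themselves may grow without bound. *)
Lemma diff_mx_power (M : arrays) :
  (forall i j : 'I_n, M 1 i j <= n ^ 28)%N -> (forall i j : 'I_n, M 2 i j <= n ^ 28)%N ->
  diff_mx (sem n power_step M) 3 4 = diff_mx M 3 4 *m diff_mx M 1 2.
Proof.
move=> H1 H2; have [E3 E4 _] := sem_power n M.
apply/matrixP => i j; rewrite !mxE E3 E4 !natr_sum -sumrB; apply: eq_bigr => k _.
rewrite !mxE !(minn_idPl (H1 _ _)) !(minn_idPl (H2 _ _)) !natrD !natrM; ring.
Qed.

Lemma diff_mx_powers (M : arrays) m :
  (forall i j : 'I_n, M 1 i j <= n ^ 28)%N -> (forall i j : 'I_n, M 2 i j <= n ^ 28)%N ->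
  let M' := iter m (sem n (SSeq power_step power_step)) M in
  diff_mx M' 3 4 = diff_mx M 3 4 *m diff_mx M 1 2 ^+ m.*2 /\
  (forall k, k \notin [:: 3; 4; 5; 6] -> M' k = M k).
Proof.
move=> H1 H2; elim: m => [|m]; first by rewrite /= expr0 mulmx1.
cbv zeta; rewrite iterS sem_seq; set M' := iter m _ M => -[IH1 IH2].
have [_ _ E1] := sem_power n M'; have [_ _ E2] := sem_power n (sem n power_step M').
split; last by move=> k Hk; rewrite E2 // E1 // IH2.
have F1 : M' 1 = M 1 by rewrite IH2.
have F2 : M' 2 = M 2 by rewrite IH2.
have D1 : diff_mx M' 1 2 = diff_mx M 1 2 by rewrite /diff_mx F1 F2.
rewrite diff_mx_power ?E1 // ?F1 ?F2 //.
rewrite diff_mx_power ?F1 ?F2 //.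
have -> : diff_mx (sem n power_step M') 1 2 = diff_mx M 1 2.
  by rewrite /diff_mx !E1 // F1 F2.
by rewrite D1 IH1 doubleS !exprSr -!mulmxE !mulmxA.
Qed.

Definition step_mx kappa (M : arrays) : 'M[R]_n :=
  \matrix_(i, j) ((pos_part n M i j)%:R - (neg_part n kappa M i j)%:R).

Definition power_mx kappa M : 'M[R]_n := step_mx kappa M ^+ (n ^ 15).*2.

Lemma quotient_le x y z : (quotient n x y z <= n ^ 13)%N.
Proof. by rewrite /quotient; case: eqP => // _; exact: geq_minr. Qed.

(** Only the fractional part is lost: the cap n ^ 13 is inactive since x - y <= z. *)
Lemma quotient_approx (x y z : nat) : (0 < z)%N -> (y <= x)%N -> (x - y <= z)%N ->
  quotient n y x z = 0%N /\
  `|(quotient n x y z)%:R - n%:R ^+ 13 * ((x%:R - y%:R) / z%:R) : R| <= 1.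
Proof.
move=> z0 yx xyz; rewrite /quotient gtn_eqF // (eqP (_ : y - x == 0)%N) ?mul0n ?div0n ?min0n //.
split=> //; rewrite (minn_idPl _); last first.
  by apply: leq_trans (leq_div2r z (leq_mul xyz (leqnn _))) _; rewrite mulKn.
rewrite -natrB // -natrX mulrA -natrM mulnC.
set d := (_ * _)%N; have z0' : 0 < z%:R :> R by rewrite ltr0n.
rewrite {2}(divn_eq d z) natrD natrM mulrDl mulfK ?gt_eqF // opprD addrA subrr add0r normrN.
rewrite ger0_norm ?divr_ge0 // ler_pdivrMr // mul1r ler_nat ltnW // ltn_mod //.
Qed.

(* One iteration adds the truncation of [n ^ 12] times the density matrix
   proportional to [power_mx], normalised to have trace [n]. *)
Lemma solver_step_spec kappa M (M' := sem n (solver_step kappa) M)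
    (P := power_mx kappa M) :
  (forall i j : 'I_n, pos_part n M i j <= n ^ 28)%N ->
  (forall i j : 'I_n, neg_part n kappa M i j <= n ^ 28)%N ->
  0 < \tr P -> (forall i j, `|P i j| <= \tr P) ->
  [/\ M' 0 = M 0,
      forall i j, M' 10 i j = (M 10 i j + n ^ 12)%N,
      forall i : 'I_n, (M' 8 i i <= M 8 i i + n ^ 13)%N,
      forall i : 'I_n, 0 <= P i i ->
        `|(M' 8 i i)%:R - (M 8 i i)%:R - n%:R ^+ 13 * (P i i / \tr P)| <= 1 &
      forall i j : 'I_n, `|((M' 8 i j)%:R - (M' 9 i j)%:R) - ((M 8 i j)%:R - (M 9 i j)%:R)
         - n%:R ^+ 13 * (P i j / \tr P)| <= 1].
Proof.
move=> H1 H2 tr0 Pbd.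
rewrite /M' /solver_step 2!sem_seq; set M1 := sem n (load_matrix kappa) M.
rewrite sem_loop; set M2 := iter _ _ _.
have := sem_load n kappa M; rewrite -/M1 => -[L1 L2 L3 L4 L5].
have B1 (i j : 'I_n) : (M1 1 i j <= n ^ 28)%N by rewrite L1.
have B2 (i j : 'I_n) : (M1 2 i j <= n ^ 28)%N by rewrite L2.
have := diff_mx_powers (n ^ 15) B1 B2; rewrite -/M2 => -[D2 K2].
have DP : diff_mx M2 3 4 = P.
  rewrite D2 /P /power_mx; have -> : diff_mx M1 3 4 = 1%:M.
    by apply/matrixP => i j; rewrite !mxE L3 L4 subr0.
  rewrite mul1mx; congr (_ ^+ _); apply/matrixP => i j.
  by rewrite !mxE L1 L2.
have K k : k \notin [:: 1; 2; 3; 4; 5; 6] -> M2 k = M k.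
  move=> Hk; rewrite K2 ?L5 //; move: Hk; rewrite !inE !negb_or.
    by move=> /and5P[-> -> -> ->].
  by move=> /and5P[_ _ -> -> /andP[-> ->]].
have := sem_add_density n M2; set tr := (_ - _)%N => -[A8 A9 A10 A0].
have PE i j : P i j = (M2 3 i j)%:R - (M2 4 i j)%:R by rewrite -DP mxE.
have trE : \tr P = tr%:R.
  have : \tr P = (\sum_(i < n) M2 3 i i)%:R - (\sum_(i < n) M2 4 i i)%:R.
    by rewrite !natr_sum -sumrB; apply: eq_bigr => i _; rewrite PE.
  move=> E; move: tr0; rewrite E subr_gt0 ltr_nat => /ltnW H.
  by rewrite -natrB.
have trn : (0 < tr)%N by rewrite trE ltr0n in tr0.
have Pos (i j : 'I_n) : (M2 4 i j <= M2 3 i j)%N -> (M2 3 i j - M2 4 i j <= tr)%N.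
  by move=> H; rewrite -(ler_nat R) natrB // -PE -trE; apply: le_trans (ler_norm _) _.
have Neg (i j : 'I_n) : (M2 3 i j <= M2 4 i j)%N -> (M2 4 i j - M2 3 i j <= tr)%N.
  move=> H; rewrite -(ler_nat R) natrB // -opprB -PE -trE.
  by apply: le_trans (ler_norm _) _; rewrite normrN.
split.
- by rewrite A0 K.
- by move=> i j; rewrite A10 K.
- by move=> i; rewrite A8 K // leq_add2l quotient_le.
- move=> i P0; rewrite A8 K // natrD [_ + _ - (M 8 i i)%:R]addrAC subrr add0r PE trE.
  have H : (M2 4 i i <= M2 3 i i)%N by rewrite -(ler_nat R) -subr_ge0 -PE.
  by have [] := quotient_approx trn H (Pos _ _ H).
- move=> i j; rewrite A8 A9 (K 8) // (K 9) // !natrD PE trE.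
  case: (leqP (M2 4 i j) (M2 3 i j)) => [H|/ltnW H].
    have [-> Hq] := quotient_approx trn H (Pos _ _ H).
    by apply: le_trans Hq; rewrite le_eqVlt; apply/orP; left; apply/eqP; congr `|_|; ring.
  have [-> Hq] := quotient_approx trn H (Neg _ _ H).
  apply: le_trans Hq; rewrite -normrN le_eqVlt; apply/orP; left; apply/eqP; congr `|_|; ring.
Qed.
End Iteration.

(** * Choice of the row used for rounding *)

Definition inconsistent n (B : nat -> nat -> bool) r :=
  \sum_(i < n) \sum_(j < n) ((B r i == B r j) != B i j : nat).

Lemma lex_lt n x y u v : u < n -> v < n ->
  (y * n + v < x * n + u) = (y < x) || (y == x) && (v < u).
Proof.
move=> Hu Hv; case: (ltngtP y x) => [H|H|->] /=; last by rewrite ltn_add2l.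
  have : y.+1 * n <= x * n by rewrite leq_mul2r H orbT.
  by rewrite mulSn; lia.
have : x.+1 * n <= y * n by rewrite leq_mul2r H orbT.
by rewrite mulSn; lia.
Qed.

Lemma rounding_spec n M (B := fun i j => M 9 i j <= M 8 i j) : 0 < n ->
  exists r : 'I_n, (forall s : 'I_n, inconsistent n B r <= inconsistent n B s) /\
    (forall j : 'I_n, (0 < sem n rounding M 13 j j) = B r j).
Proof.
move=> n0; pose cnt := inconsistent n B.
(* Encodes the lexicographic order of (count, index) in one number, so that the minimiser is
   unique. *)
pose key (r : 'I_n) := cnt r * n + r.
have key_lt (r s : 'I_n) : (key s < key r) = (cnt s < cnt r) || (cnt s == cnt r) && (s < r).
  exact: lex_lt.
have [r _ rmin] := @arg_minnP _ (Ordinal n0) predT key isT.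
exists r; split.
  move=> s; rewrite leqNgt; apply/negP => H.
  by have := rmin s isT; rewrite leqNgt key_lt -/(cnt s) H.
move=> j; rewrite /rounding !semE.
set M1 := assign M 11 _; set M2 := assign M1 12 _.
have E11 i i' : M1 11 i i' = B i i'.
  by rewrite /M1 /assign eqxx !evE /= subn_eq0.
have E12 i i' : M2 12 i i' = cnt i.
  rewrite /M2 /assign eqxx !evE; apply: eq_bigr => u _.
  rewrite !evE; apply: eq_bigr => v _; rewrite !evE /= !E11.
  by case: (B i u); case: (B i v); case: (B u v).
have E11' i i' : M2 11 i i' = B i i' by rewrite /M2 /assign /= E11.
rewrite {1}/assign eqxx evE.
pose inner (u : 'I_n) := \sum_(s < n) (if cnt s < cnt u then 1 else if cnt u < cnt s then 0 else u - s).
have -> : \sum_(i < n) ev n M2 [:: nat_of_ord i; nat_of_ord j; nat_of_ord j]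
     (EIf (ESum (EIf (ESub (EMat 12 1 1) (EMat 12 0 0)) (EConst 1)
        (EIf (ESub (EMat 12 0 0) (EMat 12 1 1)) (EConst 0)
             (ESub (EIdx 1) (EIdx 0))))) (EConst 0) (EMat 11 0 1)) =
   \sum_(i < n) if 0 < inner i then 0 else B i j.
  apply: eq_bigr => u _; rewrite ev_if ev_sum.
  have -> : \sum_(i < n) ev n M2 [:: nat_of_ord i; nat_of_ord u; nat_of_ord j; nat_of_ord j]
      (EIf (ESub (EMat 12 1 1) (EMat 12 0 0)) (EConst 1)
        (EIf (ESub (EMat 12 0 0) (EMat 12 1 1)) (EConst 0) (ESub (EIdx 1) (EIdx 0)))) = inner u.
    by apply: eq_bigr => s _; rewrite !evE /= !E12 !subn_gt0.
  by rewrite !evE /= E11'.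
have inner0 : inner r = 0.
  apply: big1 => s _; have := rmin s isT; rewrite leqNgt key_lt negb_or negb_and.
  by case: ltngtP => //= _; lia.
rewrite (bigD1 r) //= inner0 big1 ?addn0 ?lt0b // => u ur.
have : key r < key u.
  rewrite ltn_neqAle rmin // andbT; apply/eqP => E.
  have [H1 H2] : (key u < key r) = false /\ (key r < key u) = false by rewrite E ltnn.
  move: H1 H2; rewrite !key_lt; case: (ltngtP (cnt r) (cnt u)) => //= _.
  by case: (ltngtP r u) => // /ord_inj E' _ _; rewrite E' eqxx in ur.
rewrite key_lt => H.
suff -> : 0 < inner u by [].
rewrite /inner (bigD1 r) //= addn_gt0; apply/orP; left.
by move: H; case: (ltngtP (cnt r) (cnt u)) => //= _; rewrite subn_gt0.
Qed.

End Algorithm.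

(** * The power method *)

Section PowerMethod.
Local Open Scope ring_scope.
Variable R : realFieldType.

(** Cauchy-Schwarz for a semidefinite form, in terms of the discriminant; C = 0 is allowed because a
    linear function bounded below is constant. *)
Lemma discriminant_le (A B C : R) : 0 <= A -> 0 <= C ->
  (forall s, 0 <= A + 2 * s * B + s ^+ 2 * C) -> B ^+ 2 <= A * C.
Proof.
move=> A0 C0 H; have [C00|Cn0] := eqVneq C 0.
  have [->|Bn0] := eqVneq B 0; first by rewrite expr0n mulr_ge0.
  have := H (- (A + 1) / (2 * B)); rewrite C00 mulr0 addr0.
  have -> : A + 2 * (- (A + 1) / (2 * B)) * B = -1 by field.
  by lra.
have Cp : 0 < C by rewrite lt_neqAle eq_sym Cn0.
have := H (- B / C).
have -> : A + 2 * (- B / C) * B + (- B / C) ^+ 2 * C = (A * C - B ^+ 2) / C by field.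
by rewrite pmulr_lge0 ?invr_gt0 // subr_ge0.
Qed.

(** * Log-convex sequences *)

Section LogConvex.
Variable s : nat -> R.
Hypothesis s_ge0 : forall k, 0 <= s k.
Hypothesis s_lc : forall k, s k.+1 ^+ 2 <= s k * s k.+2.
Hypotheses (s0 : 0 < s 0%N) (s1 : 0 < s 1%N).

Lemma logconvex_gt0 k : 0 < s k.
Proof.
suff /andP[] : (0 < s k) && (0 < s k.+1) by [].
elim: k => [|k /andP[H0 H1]]; first by rewrite s0 s1.
rewrite H1 /= lt_neqAle s_ge0 andbT eq_sym; apply/eqP => E.
by have := s_lc k; rewrite E mulr0 leNgt exprn_gt0.
Qed.

Let ratio k := s k.+1 / s k.

(** Log-convexity says that consecutive ratios do not decrease; the two geometric bounds that follow
    compare with the first ratio and with the last one. *)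
Lemma logconvex_ratio k l : (k <= l)%N -> ratio k <= ratio l.
Proof.
elim: l => [|l IH]; first by rewrite leqn0 => /eqP ->.
rewrite leq_eqVlt => /orP[/eqP -> //|]; rewrite ltnS => /IH /le_trans; apply.
rewrite /ratio ler_pdivrMr ?logconvex_gt0 // mulrAC ler_pdivlMr ?logconvex_gt0 //.
by rewrite -expr2 mulrC s_lc.
Qed.

Lemma logconvex_lower k : s 0%N * ratio 0 ^+ k <= s k.
Proof.
elim: k => [|k IH]; first by rewrite expr0 mulr1.
have -> : s k.+1 = s k * ratio k by rewrite /ratio mulrCA divff ?mulr1 ?gt_eqF ?logconvex_gt0.
rewrite exprSr mulrA; apply: ler_pM => //.
- by rewrite mulr_ge0 ?s_ge0 // exprn_ge0 // divr_ge0.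
- by rewrite divr_ge0.
- exact: logconvex_ratio.
Qed.

Lemma logconvex_upper k j : (j <= k)%N -> s j <= s 0%N * ratio k ^+ j.
Proof.
elim: j => [|j IH] jk; first by rewrite expr0 mulr1.
have -> : s j.+1 = s j * ratio j by rewrite /ratio mulrCA divff ?mulr1 ?gt_eqF ?logconvex_gt0.
rewrite exprSr mulrA; apply: ler_pM => //.
- by rewrite divr_ge0.
- exact/IH/ltnW.
- exact/logconvex_ratio/ltnW.
Qed.
End LogConvex.

(** * Positive semidefinite matrices and the moments of their powers *)

Variable n : nat.

(** Rectangular test matrices under the trace cover quadratic forms (Z a column) and traces (Z = 1)
    at once. *)
Definition psd (N : 'M[R]_n) : Prop :=
  forall m (Z : 'M[R]_(n, m)), 0 <= \tr (Z^T *m N *m Z).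

Lemma trace_congr m (N : 'M[R]_n) (Z : 'M[R]_(n, m)) :
  \tr (Z^T *m N *m Z) = \sum_k \sum_i \sum_j N i j * (Z i k * Z j k).
Proof.
apply: eq_bigr => k _; rewrite !mxE exchange_big /=; apply: eq_bigr => j _.
rewrite mxE mulr_suml; apply: eq_bigr => i _; rewrite mxE; ring.
Qed.

Lemma psd1 : psd 1%:M.
Proof.
move=> m Z; rewrite mulmx1; apply: sumr_ge0 => k _; rewrite mxE.
by apply: sumr_ge0 => i _; rewrite mxE -expr2 sqr_ge0.
Qed.

(** Each off-diagonal term is at least - u (x_i ^ 2 + x_j ^ 2) / 2, and the diagonal terms n u x_i ^
    2 pay for all of these. *)
Lemma diag_dominant_psd (N : 'M[R]_n) u : 0 <= u ->
  (forall i j, i != j -> `|N i j| <= u) -> (forall i, n%:R * u <= N i i) -> psd N.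
Proof.
move=> u0 Hoff Hdiag m Z; rewrite trace_congr; apply: sumr_ge0 => k _.
pose x i := Z i k.
have E : \sum_i \sum_j ((if i == j then n%:R * u * x i ^+ 2 else 0) - u * (x i ^+ 2 + x j ^+ 2) / 2) = 0.
  have -> : \sum_i \sum_j ((if i == j then n%:R * u * x i ^+ 2 else 0) - u * (x i ^+ 2 + x j ^+ 2) / 2)
     = \sum_i (n%:R * u * x i ^+ 2) -
       u / 2 * (\sum_(i < n) \sum_(j < n) x i ^+ 2 + \sum_(i < n) \sum_(j < n) x j ^+ 2).
    rewrite -big_split mulr_sumr -sumrB; apply: eq_bigr => i _ /=.
    rewrite sumrB (bigD1 i) //= eqxx big1 ?addr0; last by move=> j /negbTE; rewrite eq_sym => ->.
    congr (_ - _).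
    rewrite -big_split mulr_sumr; apply: eq_bigr => j _ /=; ring.
  have -> : \sum_(i < n) \sum_(j < n) x j ^+ 2 = n%:R * \sum_(j < n) x j ^+ 2.
    by rewrite sumr_const card_ord mulr_natl.
  have -> : \sum_(i < n) \sum_(j < n) x i ^+ 2 = n%:R * \sum_(j < n) x j ^+ 2.
    by rewrite mulr_sumr; apply: eq_bigr => i _; rewrite sumr_const card_ord mulr_natl.
  by rewrite -mulr_sumr; field.
rewrite -[leLHS]E; apply: ler_sum => i _; apply: ler_sum => j _; rewrite -!/(x _).
have [<-|ij] := eqVneq i j.
  have := ler_wpM2r (sqr_ge0 (x i)) (Hdiag i); have := mulr_ge0 u0 (sqr_ge0 (x i)).
  rewrite -expr2; lra.
have := Hoff i j ij; rewrite ler_norml => /andP[H1 H2].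
have Hp := sqr_ge0 (x i + x j); have Hm := sqr_ge0 (x i - x j).
move: (x i) (x j) (N i j) H1 H2 Hp Hm => a b c H1 H2 Hp Hm.
have P1 := mulr_ge0 (_ : 0 <= c + u) Hp; have P2 := mulr_ge0 (_ : 0 <= u - c) Hm.
have := P1 (ltac:(lra)); have := P2 (ltac:(lra)).
rewrite !expr2 !mulrDl !mulrDr; lra.
Qed.

Lemma trmxX (N : 'M[R]_n) k : N^T = N -> (N ^+ k)^T = N ^+ k.
Proof.
move=> HN; elim: k => [|k IH]; first by rewrite !expr0 trmx1.
by rewrite {1}exprS -mulmxE trmx_mul IH HN mulmxE -exprSr.
Qed.

(** In an eigenbasis this is a power sum of the eigenvalues with nonnegative weights, hence
    log-convex in k; the lemmas below obtain this without diagonalising. *)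
Definition moment (N : 'M[R]_n) m (Z : 'M[R]_(n, m)) k := \tr (Z^T *m N ^+ k *m Z).

Section Moments.
Variables (N : 'M[R]_n).
Hypotheses (Nsym : N^T = N) (Npsd : psd N).

Lemma momentE m (Z : 'M[R]_(n, m)) i j e :
  \tr ((N ^+ i *m Z)^T *m N ^+ e *m (N ^+ j *m Z)) = moment N Z (i + e + j).
Proof.
by rewrite /moment trmx_mul trmxX // !exprD -!mulmxE !mulmxA.
Qed.

Lemma psd_parity k : psd (N ^+ odd k).
Proof. by case: (odd k); rewrite ?expr1 ?expr0 //; exact: psd1. Qed.

Lemma moment_ge0 m (Z : 'M[R]_(n, m)) k : 0 <= moment N Z k.
Proof.
have := psd_parity k (N ^+ k./2 *m Z); rewrite momentE.
by have -> : (k./2 + odd k + k./2 = k)%N by rewrite -[RHS]odd_double_half -addnn; ring.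
Qed.

(** With h the integer part of k / 2, this is Cauchy-Schwarz between N^h Z and N^(h + 1) Z for the
    semidefinite form 1 or N, according to the parity of k. *)
Lemma moment_logconvex m (Z : 'M[R]_(n, m)) k :
  moment N Z k.+1 ^+ 2 <= moment N Z k * moment N Z k.+2.
Proof.
apply: discriminant_le; rewrite ?moment_ge0 // => t.
have := psd_parity k (N ^+ k./2 *m Z + t *: (N ^+ k./2.+1 *m Z)).
set A := N ^+ k./2 *m Z; set B := N ^+ k./2.+1 *m Z.
have -> : (A + t *: B)^T = A^T + t *: B^T by apply/matrixP => a b; rewrite !mxE.
rewrite !mulmxDl !mulmxDr -!scalemxAl -!scalemxAr !mxtraceD !mxtraceZ.
rewrite {}/A {}/B.
have Ek : (k./2 + odd k + k./2 = k)%N by rewrite -[RHS]odd_double_half -addnn; ring.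
rewrite !momentE Ek !addnS !addSn Ek => H; apply: le_trans H _.
by rewrite le_eqVlt; apply/orP; left; apply/eqP; ring.
Qed.
End Moments.

Lemma even_power_gram (N : 'M[R]_n) p i j : N^T = N ->
  (N ^+ p.*2) i j = \sum_k (N ^+ p) i k * (N ^+ p) j k.
Proof.
move=> HN; rewrite -addnn exprD -mulmxE mxE; apply: eq_bigr => k _.
by rewrite -{2}(trmxX p HN) mxE.
Qed.

Lemma gram_entry_bound (P : 'I_n -> 'I_n -> R) (I : finType) (u : 'I_n -> I -> R) i j :
  (forall i j, P i j = \sum_k u i k * u j k) -> `|P i j| <= (P i i + P j j) / 2.
Proof.
move=> HP; rewrite !HP; apply: le_trans (ler_norm_sum _ _ _) _.
rewrite -big_split mulr_suml; apply: ler_sum => k _ /=.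
move: (u i k) (u j k) => a b; rewrite ler_norml.
have Hp := sqr_ge0 (a + b); have Hm := sqr_ge0 (a - b).
by apply/andP; split; nra.
Qed.

Lemma gram_trace_bound (P : 'M[R]_n) (I : finType) (u : 'I_n -> I -> R) i j :
  (forall i j, P i j = \sum_k u i k * u j k) -> `|P i j| <= \tr P.
Proof.
move=> HP; apply: le_trans (gram_entry_bound i j HP) _.
have Pge0 i' : 0 <= P i' i' by rewrite HP; apply: sumr_ge0 => k _; rewrite -expr2 sqr_ge0.
have H i' : P i' i' <= \tr P.
  by rewrite /mxtrace (bigD1 i') //= lerDl sumr_ge0.
by have := H i; have := H j; lra.
Qed.

Lemma sign_cauchy_schwarz (x y : 'I_n -> R) : (forall i, x i ^+ 2 = 1) ->
  (\sum_i x i * y i) ^+ 2 <= n%:R * \sum_i y i * y i.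
Proof.
move=> x1.
have : 0 <= \sum_i \sum_j (x i * y i - x j * y j) ^+ 2.
  by apply: sumr_ge0 => i _; apply: sumr_ge0 => j _; rewrite sqr_ge0.
have -> : \sum_i \sum_j (x i * y i - x j * y j) ^+ 2 =
  \sum_(i < n) \sum_(j < n) y i * y i + \sum_(i < n) \sum_(j < n) y j * y j
  - 2 * \sum_i \sum_j (x i * y i) * (x j * y j).
  rewrite mulr_sumr -big_split -sumrB; apply: eq_bigr => i _ /=.
  rewrite mulr_sumr -big_split -sumrB; apply: eq_bigr => j _ /=.
  rewrite sqrrB !exprMn !x1 !mul1r !expr2; ring.
have -> : \sum_i \sum_j (x i * y i) * (x j * y j) = (\sum_i x i * y i) ^+ 2.
  by rewrite expr2 mulr_suml; apply: eq_bigr => i _; rewrite mulr_sumr.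
have -> : \sum_(i < n) \sum_(j < n) y j * y j = n%:R * \sum_(j < n) y j * y j.
  by rewrite sumr_const card_ord mulr_natl.
have -> : \sum_(i < n) \sum_(j < n) y i * y i = n%:R * \sum_(j < n) y j * y j.
  by rewrite mulr_sumr; apply: eq_bigr => i _; rewrite sumr_const card_ord mulr_natl.
lra.
Qed.

Lemma bernoulli_ineq (d : R) k : 0 <= d -> 1 + k%:R * d <= (1 + d) ^+ k.
Proof.
move=> d0; elim: k => [|k IH]; first by rewrite mul0r addr0 expr0.
rewrite exprS; apply: (@le_trans _ _ ((1 + d) * (1 + k%:R * d))); last by rewrite ler_wpM2l // addr_ge0.
have := mulr_ge0 (ler0n R k) (sqr_ge0 d); rewrite -natr1 expr2; lra.
Qed.

(* A large even power of [N] is, after normalisation, almost a maximiser of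
   [<N, X>] over positive semidefinite [X] of trace [n]. *)
Lemma power_oracle (N : 'M[R]_n) (x : 'I_n -> R) p : N^T = N -> psd N ->
  (0 < n)%N -> (0 < p)%N ->
  (forall i, x i ^+ 2 = 1) -> 0 < \tr N ->
  let P := N ^+ p.*2 in let q := \sum_i \sum_j N i j * (x i * x j) in
  0 < \tr P /\
  q - q * n%:R / p.*2%:R <= n%:R * \tr (N *m P) / \tr P.
Proof.
move=> Nsym Npsd n0 p0 x1 trN; cbv zeta.
set K := p.*2; set q := \sum_i _.
pose t := moment N 1%:M; pose z : 'cV[R]_n := \col_i x i; pose a := moment N z.
have tE k : t k = \tr (N ^+ k) by rewrite /t /moment trmx1 mul1mx mulmx1.
have n0' : 0 < n%:R :> R by rewrite ltr0n.
have t0 : t 0%N = n%:R by rewrite tE expr0 mxtrace1.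
have tge0 := moment_ge0 Nsym Npsd 1%:M; have tlc := moment_logconvex Nsym Npsd 1%:M.
have tp k : 0 < t k.
  apply: (logconvex_gt0 tge0 tlc); first by rewrite -/(t 0%N) t0.
  by rewrite -/(t 1%N) tE expr1.
have trP : 0 < \tr (N ^+ K) by rewrite -tE.
split=> //.
have -> : N *m N ^+ K = N ^+ K.+1 by rewrite mulmxE -exprS.
rewrite -!tE -[n%:R * _ / _]mulrA; set r := t K.+1 / t K.
have r0 : 0 <= r by rewrite divr_ge0 // ltW.
have a0 : a 0%N = n%:R.
  rewrite /a /moment expr0 mulmx1 /mxtrace big_ord1 mxE.
  transitivity (\sum_(i < n) (1 : R)); last by rewrite sumr_const card_ord.
  by apply: eq_bigr => i _; rewrite !mxE -expr2 x1.
have a1 : a 1%N = q.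
  rewrite /a /moment expr1 trace_congr big_ord1; apply: eq_bigr => i _.
  by apply: eq_bigr => j _; rewrite !mxE.
have age0 := moment_ge0 Nsym Npsd z; have alc := moment_logconvex Nsym Npsd z.
have q0 : 0 <= q by rewrite -a1.
have K0 : 0 < K%:R :> R by rewrite ltr0n /K double_gt0.
have [qz|qn0] := eqVneq q 0.
  by rewrite qz !mul0r subr0 mulr_ge0 // ltW.
have qp : 0 < q by rewrite lt_neqAle eq_sym qn0.
(* x^T N^(2p) x is the squared length of N^p x, and Cauchy-Schwarz in each coordinate bounds it by n
   tr N^(2p). *)
have aK : a K <= n%:R * t K.
  rewrite tE /a /moment trace_congr big_ord1.
  have -> : \sum_i \sum_j (N ^+ K) i j * (z i ord0 * z j ord0) =
      \sum_k (\sum_i x i * (N ^+ p) i k) ^+ 2.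
    transitivity (\sum_i \sum_j \sum_k (x i * (N ^+ p) i k) * (x j * (N ^+ p) j k)).
      apply: eq_bigr => i _; apply: eq_bigr => j _.
      rewrite even_power_gram // mulr_suml; apply: eq_bigr => k _; rewrite !mxE; ring.
    under eq_bigr do rewrite exchange_big; rewrite exchange_big; apply: eq_bigr => k _.
    by rewrite expr2 mulr_suml; apply: eq_bigr => i _; rewrite mulr_sumr.
  rewrite /mxtrace; under [X in _ * X]eq_bigr do rewrite even_power_gram //.
  rewrite exchange_big mulr_sumr; apply: ler_sum => k _.
  exact: sign_cauchy_schwarz.
have ratio_lower : n%:R * (q / n%:R) ^+ K <= a K.
  have := @logconvex_lower a age0 alc; rewrite a0 a1; apply => //; exact: n0'.
have ratio_upper : t K <= n%:R * r ^+ K.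
  have := @logconvex_upper t tge0 tlc _ _ K K (leqnn K); rewrite t0; apply; exact: n0' || exact: tp.
have [rq|rq] := leP (q / n%:R) r.
  apply: (@le_trans _ _ q); first by rewrite gerBl divr_ge0 // mulr_ge0 // ltW.
  by rewrite mulrC -ler_pdivrMr.
(* Otherwise r < (q / n) (1 - d) with d = n / K. Comparing the two growth rates gives 1 <= n (1 -
   d)^K, whereas (1 - d)^K <= (1 + d)^(-K) <= 1 / (1 + n). *)
rewrite leNgt; apply/negP => Hlt.
pose al := q / n%:R; pose d : R := n%:R / K%:R.
have al0 : 0 < al by rewrite divr_gt0.
have d0 : 0 < d by rewrite divr_gt0.
have rd : r < al * (1 - d).
  rewrite -(ltr_pM2l n0'); apply: (lt_le_trans Hlt).
  by rewrite /al /d le_eqVlt; apply/orP; left; apply/eqP; field; rewrite !gt_eqF.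
have d1 : 0 < 1 - d by rewrite -(pmulr_rgt0 _ al0); apply: le_lt_trans rd.
have H1 : al ^+ K <= n%:R * (al * (1 - d)) ^+ K.
  have : al ^+ K <= t K by rewrite -(ler_pM2l n0'); apply: le_trans aK.
  move/le_trans; apply; apply: (le_trans ratio_upper); rewrite ler_pM2l //.
  by rewrite lerXn2r ?nnegrE // ltW // mulr_gt0.
have H2 : 1 <= n%:R * (1 - d) ^+ K.
  by rewrite -(ler_pM2l (exprn_gt0 K al0)) mulr1 mulrCA -exprMn.
have H3 : ((1 - d) * (1 + d)) ^+ K <= 1.
  by rewrite exprn_ile1 //; nra.
have H4 : 1 + n%:R <= (1 + d) ^+ K.
  have -> : 1 + n%:R = 1 + K%:R * d by rewrite /d mulrCA divff ?mulr1 // gt_eqF.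
  exact: bernoulli_ineq (ltW d0).
rewrite exprMn in H3.
have H5 : 0 < (1 - d) ^+ K by rewrite exprn_gt0.
have := ler_wpM2l (ltW H5) H4; rewrite mulrDr mulr1 [_ * n%:R]mulrC.
move: (_ ^+ K) (_ ^+ K) (n%:R : R) H2 H3 H5 => X Y m; clear; lra.
Qed.

End PowerMethod.

(** * Grothendieck's inequality *)

Local Open Scope ring_scope.

Definition sgr (R : realType) (b : bool) : R := if b then 1 else -1.

Section Grothendieck.
Variable R : realType.

Lemma sgr_norm (x : R) : sgr R (0 <= x) * x = `|x|.
Proof. by rewrite /sgr; case: ger0P => _; rewrite ?mul1r ?mulN1r. Qed.

Definition cut_bounded n (W : 'I_n -> 'I_n -> R) (w : R) : Prop :=
  forall x y : {ffun 'I_n -> bool},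
    \sum_i \sum_j W i j * (sgr R (x i) * sgr R (y j)) <= w.

(** A bilinear form on a box is maximal at a vertex: first x, then y is replaced by M times the
    signs of the factor it multiplies. *)
Lemma cut_bounded_box n (W : 'I_n -> 'I_n -> R) w M x y :
  cut_bounded W w -> 0 <= M ->
  (forall i, `|x i| <= M) -> (forall j, `|y j| <= M) ->
  \sum_i \sum_j W i j * (x i * y j) <= M ^+ 2 * w.
Proof.
move=> HW M0 Hx Hy.
have bound (v r : 'I_n -> R) : (forall i, `|v i| <= M) ->
    \sum_i v i * r i <= M * \sum_i sgr R (0 <= r i) * r i.
  move=> Hv; rewrite mulr_sumr; apply: ler_sum => i _; rewrite sgr_norm.
  by apply: le_trans (ler_norm _) _; rewrite normrM ler_wpM2r.
pose r i := \sum_j W i j * y j.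
have -> : \sum_i \sum_j W i j * (x i * y j) = \sum_i x i * r i.
  by apply: eq_bigr => i _; rewrite mulr_sumr; apply: eq_bigr => j _; ring.
apply: (le_trans (bound _ _ Hx)); rewrite expr2 -mulrA ler_wpM2l //.
pose c j := \sum_i W i j * sgr R (0 <= r i).
have -> : \sum_i sgr R (0 <= r i) * r i = \sum_j y j * c j.
  under eq_bigr do rewrite mulr_sumr; rewrite exchange_big /=.
  by apply: eq_bigr => j _; rewrite mulr_sumr; apply: eq_bigr => i _; ring.
apply: (le_trans (bound _ _ Hy)); rewrite ler_wpM2l //.
have := HW [ffun i => 0 <= r i] [ffun j => 0 <= c j].
apply: le_trans; rewrite exchange_big le_eqVlt; apply/orP; left; apply/eqP.
by apply: eq_bigr => j _; rewrite mulr_sumr; apply: eq_bigr => i _; rewrite !ffunE; ring.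
Qed.

(** Recursive on the list, so that moments of Rademacher sums are computed by adding one sign at a
    time. *)
Fixpoint sign_seq (I : Type) (s : seq I) : finType :=
  if s is _ :: s' then (bool * sign_seq s')%type else unit.

Lemma card_sign_seq (I : Type) (s : seq I) : #|sign_seq s| = (2 ^ size s)%N.
Proof.
elim: s => [|k s IH] /=; first by rewrite card_unit.
by rewrite card_prod card_bool IH expnS.
Qed.

Fixpoint rademacher (I : Type) (u : I -> R) (s : seq I) : sign_seq s -> R :=
  match s with
  | [::] => fun=> 0
  | k :: s' => fun e => sgr R e.1 * u k + rademacher u e.2
  end.

Lemma sum_sign_cons (I : Type) (k : I) s (F : sign_seq (k :: s) -> R) :
  \sum_e F e = \sum_(e : sign_seq s) (F (true, e) + F (false, e)).
Proof.
transitivity (\sum_(p : bool * sign_seq s) F (p.1, p.2)).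
  by apply: eq_bigr => -[].
by rewrite -(pair_bigA _ (fun b (e : sign_seq s) => F (b, e))) big_bool -big_split.
Qed.

Lemma rademacher_dot (I : Type) (u v : I -> R) s :
  \sum_(e : sign_seq s) rademacher u e * rademacher v e =
  2 ^+ size s * \sum_(k <- s) u k * v k.
Proof.
elim: s => [|k s IH].
  by rewrite big_nil mulr0 big1 //= => e _; rewrite mul0r.
rewrite sum_sign_cons big_cons mulrDr exprS -[in X in _ + X]mulrA -IH.
have -> : 2 * 2 ^+ size s * (u k * v k) = \sum_(e : sign_seq s) 2 * (u k * v k).
  by rewrite sumr_const -[RHS]mulr_natl card_sign_seq natrX; ring.
rewrite mulr_sumr -big_split; apply: eq_bigr => e _ /=; rewrite /sgr; ring.
Qed.

(** Averaging (S + u)^4 and (S - u)^4 gives S^4 + 6 u^2 S^2 + u^4, and 3 (u^2 + q)^2 has room for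
    all three terms. *)
Lemma rademacher_fourth_moment (I : Type) (u : I -> R) s :
  \sum_(e : sign_seq s) rademacher u e ^+ 4 <=
  2 ^+ size s * (3 * (\sum_(k <- s) u k ^+ 2) ^+ 2).
Proof.
elim: s => [|k s IH].
  by rewrite big_nil big1 ?expr0n ?mulr0 // => e _ /=; rewrite expr0n.
rewrite sum_sign_cons big_cons.
set q := \sum_(j <- s) _ in IH *.
have -> : \sum_(e : sign_seq s) (rademacher u ((true, e) : sign_seq (k :: s)) ^+ 4
    + rademacher u ((false, e) : sign_seq (k :: s)) ^+ 4) =
  2 * (\sum_(e : sign_seq s) rademacher u e ^+ 4) +
  12 * u k ^+ 2 * (\sum_(e : sign_seq s) rademacher u e * rademacher u e) +
  \sum_(e : sign_seq s) 2 * u k ^+ 4.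
  rewrite !mulr_sumr -!big_split; apply: eq_bigr => e _ /=; rewrite /sgr; ring.
have -> : \sum_(e : sign_seq s) 2 * u k ^+ 4 = 2 ^+ size s * (2 * u k ^+ 4).
  by rewrite sumr_const -[LHS]mulr_natl card_sign_seq natrX.
rewrite rademacher_dot.
have -> : \sum_(j <- s) u j * u j = q by apply: eq_bigr => j _; rewrite expr2.
have -> : 2 ^+ size (k :: s) = 2 * 2 ^+ size s :> R by rewrite /= exprS.
set p := 2 ^+ size s in IH *.
have p0 : 0 <= p by rewrite exprn_ge0.
have := mulr_ge0 p0 (exprn_even_ge0 (u k) (isT : ~~ odd 4)).
move: (\sum_e _) IH => T IH Hu.
have -> : 2 * p * (3 * (u k ^+ 2 + q) ^+ 2) =
  2 * (p * (3 * q ^+ 2)) + 12 * u k ^+ 2 * (p * q) + 6 * (p * u k ^+ 4) by ring.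
lra.
Qed.

Definition clip (M x : R) : R := if M < x then M else if x < - M then - M else x.

Lemma clip_le M x : 0 <= M -> `|clip M x| <= M.
Proof.
move=> M0; rewrite /clip ler_norml.
by case: ltP => H1; [apply/andP; split; lra|case: ltP => H2; apply/andP; split; lra].
Qed.

Lemma clip_sqr M x : 0 <= M -> clip M x ^+ 2 <= x ^+ 2.
Proof.
move=> M0; rewrite /clip.
by case: ltP => H1; [nra|case: ltP => H2; nra].
Qed.

(** Where clipping acts, |x| exceeds M and the excess is at most |x|. *)
Lemma clip_tail M x : 0 <= M -> M ^+ 2 * (x - clip M x) ^+ 2 <= x ^+ 4.
Proof.
move=> M0; have -> : x ^+ 4 = x ^+ 2 * x ^+ 2 by ring.
have e4 : 0 <= x ^+ 2 * x ^+ 2 by rewrite mulr_ge0 // sqr_ge0.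
rewrite /clip; case: ltP => H1; [|case: ltP => H2].
- by apply: ler_pM; rewrite ?sqr_ge0 //; nra.
- by apply: ler_pM; rewrite ?sqr_ge0 //; nra.
- by rewrite subrr expr0n mulr0.
Qed.

(* [gram_bounded W K] bounds the semidefinite relaxation of the norm of [W]; the
   parameter [c] makes it homogeneous without square roots. *)
Definition gram_bounded n (W : 'I_n -> 'I_n -> R) (K : R) : Prop :=
  forall (I : finType) (c : R) (u v : 'I_n -> I -> R), 0 < c ->
    (forall i, \sum_k u i k ^+ 2 <= c) -> (forall j, \sum_k v j k ^+ 2 <= c) ->
    \sum_i \sum_j W i j * \sum_k u i k * v j k <= K * c.

Lemma gram_bounded_trivial n (W : 'I_n -> 'I_n -> R) :
  gram_bounded W (\sum_i \sum_j `|W i j|).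
Proof.
move=> I c u v c0 Hu Hv; rewrite mulr_suml; apply: ler_sum => i _.
rewrite mulr_suml; apply: ler_sum => j _.
apply: le_trans (ler_norm _) _; rewrite normrM ler_wpM2l //.
apply: le_trans (ler_norm_sum _ _ _) _.
apply: (@le_trans _ _ (\sum_k (u i k ^+ 2 + v j k ^+ 2) / 2)).
  apply: ler_sum => k _; rewrite ler_norml; move: (u i k) (v j k) => a b.
  have Hp := sqr_ge0 (a + b); have Hm := sqr_ge0 (a - b).
  by apply/andP; split; nra.
by rewrite -mulr_suml big_split /=; have := Hu i; have := Hv j; lra.
Qed.

Lemma sum_split3 n (W F1 F2 F3 : 'I_n -> 'I_n -> R) :
  \sum_i \sum_j W i j * (F1 i j + F2 i j + F3 i j) =
  \sum_i \sum_j W i j * F1 i j + \sum_i \sum_j W i j * F2 i j +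
  \sum_i \sum_j W i j * F3 i j.
Proof.
rewrite -!big_split; apply: eq_bigr => i _ /=.
by rewrite -!big_split; apply: eq_bigr => j _ /=; ring.
Qed.

(* The inner product of two vectors is the correlation of the Rademacher sums
   they define; after truncation these are bounded, and the tails have small
   second moment, so they are again vectors to which [gram_bounded] applies. *)
Lemma gram_bounded_step n (W : 'I_n -> 'I_n -> R) w K :
  cut_bounded W w -> gram_bounded W K -> gram_bounded W (49 * w + K / 2).
Proof.
move=> HW HK I c u v c0 Hu Hv.
pose s := enum I.
pose f i (e : sign_seq s) := rademacher (u i) e.
pose g i (e : sign_seq s) := rademacher (v i) e.
pose N : R := 2 ^+ size s.
have N0 : 0 < N by rewrite exprn_gt0.
(* With M^2 = 49 c the tails have second moment at most 3 c / 49 < c / 16. They stay below c after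
   scaling by 4, so each of the two tail terms costs K / 4. *)
pose M : R := 7 * Num.sqrt c.
have M0 : 0 <= M by rewrite mulr_ge0 ?sqrtr_ge0.
have M2 : M ^+ 2 = 49 * c.
  by rewrite exprMn sqr_sqrtr ?ltW //; ring.
have sum2 (t : 'I_n -> I -> R) i : (forall i, \sum_k t i k ^+ 2 <= c) ->
    \sum_(e : sign_seq s) rademacher (t i) e ^+ 2 <= N * c.
  move=> Ht; under eq_bigr do rewrite expr2; rewrite rademacher_dot ler_pM2l //.
  rewrite big_enum /=; apply: le_trans (Ht i).
  by apply: ler_sum => k _; rewrite expr2.
have tail2 (t : 'I_n -> I -> R) i : (forall i, \sum_k t i k ^+ 2 <= c) ->
    \sum_(e : sign_seq s) (4 * (rademacher (t i) e - clip M (rademacher (t i) e))) ^+ 2 <= N * c.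
  move=> Ht.
  have H4 : \sum_(e : sign_seq s) rademacher (t i) e ^+ 4 <= N * (3 * c ^+ 2).
    apply: (le_trans (rademacher_fourth_moment _ _)); rewrite ler_pM2l // ler_pM2l //.
    have S0 : 0 <= \sum_k t i k ^+ 2 by apply: sumr_ge0 => k _; rewrite sqr_ge0.
    by rewrite big_enum /= ler_sqr ?nnegrE // ltW.
  rewrite -(ler_pM2l (_ : 0 < 49 * c)); last lra.
  rewrite mulr_sumr; apply: (@le_trans _ _ (16 * \sum_(e : sign_seq s) rademacher (t i) e ^+ 4)).
    rewrite mulr_sumr; apply: ler_sum => e _.
    have := clip_tail (rademacher (t i) e) M0; rewrite M2 => H.
    by rewrite exprMn; lra.
  have Nc : 0 <= N * c ^+ 2 by rewrite mulr_ge0 ?ltW // exprn_gt0.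
  have -> : 49 * c * (N * c) = 49 * (N * c ^+ 2) by ring.
  lra.
have clip2 (t : 'I_n -> I -> R) i : (forall i, \sum_k t i k ^+ 2 <= c) ->
    \sum_(e : sign_seq s) clip M (rademacher (t i) e) ^+ 2 <= N * c.
  move=> Ht; apply: le_trans (sum2 t i Ht); apply: ler_sum => e _; exact: clip_sqr.
rewrite -(ler_pM2l N0).
pose F1 i j := \sum_e clip M (f i e) * clip M (g j e).
pose F2 i j := \sum_e (4 * (f i e - clip M (f i e))) * g j e.
pose F3 i j := \sum_e clip M (f i e) * (4 * (g j e - clip M (g j e))).
have -> : N * (\sum_i \sum_j W i j * \sum_k u i k * v j k) =
  \sum_i \sum_j W i j * (F1 i j + F2 i j / 4 + F3 i j / 4).
  rewrite mulr_sumr; apply: eq_bigr => i _; rewrite mulr_sumr; apply: eq_bigr => j _.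
  rewrite mulrCA; congr (_ * _).
  have := rademacher_dot (u i) (v j) s; rewrite big_enum /= => <-.
  rewrite /F1 /F2 /F3 !mulr_suml -!big_split; apply: eq_bigr => e _ /=; rewrite /f /g; by field.
have /= -> := sum_split3 W F1 (fun i j => F2 i j / 4) (fun i j => F3 i j / 4).
have T1 : \sum_i \sum_j W i j * F1 i j <= N * (49 * c * w).
  have -> : \sum_i \sum_j W i j * (\sum_e clip M (f i e) * clip M (g j e)) =
     \sum_e \sum_i \sum_j W i j * (clip M (f i e) * clip M (g j e)).
    rewrite [RHS]exchange_big; apply: eq_bigr => i _.
    by rewrite [RHS]exchange_big; apply: eq_bigr => j _; rewrite mulr_sumr.
  apply: (@le_trans _ _ (\sum_(e : sign_seq s) 49 * c * w)).
    apply: ler_sum => e _; rewrite -M2; apply: cut_bounded_box => // i; exact: clip_le.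
  by rewrite sumr_const -[X in X <= _]mulr_natl card_sign_seq natrX.
have div4 (F : 'I_n -> 'I_n -> R) : \sum_i \sum_j W i j * (F i j / 4) =
    (\sum_i \sum_j W i j * F i j) / 4.
  rewrite mulr_suml; apply: eq_bigr => i _; rewrite mulr_suml.
  by apply: eq_bigr => j _; rewrite mulrA.
rewrite !div4.
have Nc0 : 0 < N * c by rewrite mulr_gt0.
have T2 := HK _ _ _ g Nc0 (fun i => tail2 u i Hu) (fun i => sum2 v i Hv).
have T3 := HK _ _ _ _ Nc0 (fun i => clip2 u i Hu) (fun i => tail2 v i Hv).
have -> : N * ((49 * w + K / 2) * c) = N * (49 * c * w) + K * (N * c) / 4 + K * (N * c) / 4.
  by field.
rewrite /F2 /F3 /f /g; lra.
Qed.

(** Iterates K -> 49 w + K / 2 from the trivial bound; the fixed point is 98 w. *)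
Theorem grothendieck n (W : 'I_n -> 'I_n -> R) w :
  cut_bounded W w -> gram_bounded W (98 * w).
Proof.
move=> HW; set K0 := \sum_i \sum_j `|W i j|.
have K00 : 0 <= K0 by apply: sumr_ge0 => i _; apply: sumr_ge0 => j _.
have H m : gram_bounded W (98 * w + (K0 - 98 * w) / 2 ^+ m).
  elim: m => [|m IH].
    have -> : 98 * w + (K0 - 98 * w) / 2 ^+ 0 = K0 by rewrite expr0; field.
    exact: gram_bounded_trivial.
  have -> : 98 * w + (K0 - 98 * w) / 2 ^+ m.+1 = 49 * w + (98 * w + (K0 - 98 * w) / 2 ^+ m) / 2.
    rewrite exprS; have : 2 ^+ m != 0 :> R by rewrite expf_neq0 ?pnatr_eq0.
    move: (2 ^+ m) => p p0; by field.
  exact: gram_bounded_step.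
move=> I c u v c0 Hu Hv; set S := \sum_i _.
apply/ler_addgt0Pr => e e0.
pose B := `|K0 - 98 * w| * c / e.
have B0 : 0 <= B by rewrite divr_ge0 ?mulr_ge0 // ltW.
have [m Hm] : exists m : nat, B <= 2 ^+ m.
  exists (Num.bound B); apply: le_trans (ltW (archi_boundP B0)) _.
  by rewrite -natrX ler_nat ltnW // ltn_expl.
have p0 : 0 < 2 ^+ m :> R by rewrite exprn_gt0.
apply: (le_trans (H m I c u v c0 Hu Hv)).
rewrite mulrDl lerD2l mulrAC ler_pdivrMr //.
rewrite /B ler_pdivrMr // in Hm.
apply: le_trans (_ : `|K0 - 98 * w| * c <= _); first by rewrite ler_wpM2r ?ler_norm ?ltW.
by rewrite [e * _]mulrC.
Qed.

End Grothendieck.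

(** * Concentration for the block model *)

Local Open Scope ring_scope.

Section RandomGraph.
Variable R : realType.

Lemma adj_sym n (G : sgraph n) u v : adj G u v = adj G v u.
Proof. by case: G => e H; have /andP[/forallP /(_ u) /forallP /(_ v) /eqP] := H. Qed.

Lemma adj_irr n (G : sgraph n) u : adj G u u = false.
Proof. by case: G => e H; have /andP[_ /forallP /(_ u) /negbTE] := H. Qed.

Definition edge_code n (G : sgraph n) : {ffun 'I_n * 'I_n -> bool} :=
  [ffun e : 'I_n * 'I_n => (e.1 < e.2)%N && adj G e.1 e.2].

Definition graph_fun n (f : {ffun 'I_n * 'I_n -> bool}) : {ffun 'I_n * 'I_n -> bool} :=
  [ffun e : 'I_n * 'I_n => (e.1 < e.2)%N && f e || (e.2 < e.1)%N && f (e.2, e.1)].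

Lemma graph_fun_simple n (f : {ffun 'I_n * 'I_n -> bool}) : simple_graph (graph_fun f).
Proof.
apply/andP; split; apply/forallP => u; last by rewrite ffunE /= ltnn.
by apply/forallP => v; rewrite !ffunE /= orbC.
Qed.

(** Independence of the edges. [edge_code] identifies graphs with the functions that are false off
    the pairs u < v, and a product of sums expands over these. *)
Lemma sum_sgraph n (F : 'I_n * 'I_n -> bool -> R) :
  \sum_(G : sgraph n) \prod_(e : 'I_n * 'I_n | (e.1 < e.2)%N) F e (adj G e.1 e.2) =
  \prod_(e : 'I_n * 'I_n | (e.1 < e.2)%N) (F e true + F e false).
Proof.
have -> : \prod_(e : 'I_n * 'I_n | (e.1 < e.2)%N) (F e true + F e false) =
    \prod_(e : 'I_n * 'I_n | (e.1 < e.2)%N) \sum_(b | predT b) F e b.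
  by apply: eq_bigr => e _; rewrite big_bool.
rewrite (big_distr_big false).
rewrite (reindex_onto (@edge_code n) (fun f => SGraph (graph_fun_simple f))) /=; last first.
  move=> f /pffun_onP [/fintype.subsetP Hs _]; apply/ffunP => -[u v].
  rewrite !ffunE /adj /= ffunE /=.
  case: ltnP => //= Huv; last first.
    apply/esym/negP => H; suff : (u < v)%N by rewrite ltnNge Huv.
    by apply: (Hs (u, v)); rewrite inE /= H.
  by rewrite ltnNge ltnW //= orbF.
apply: eq_big => [G|G _].
  apply/esym/andP; split.
    apply/pffun_onP; split=> //; apply/fintype.subsetP => e.
    by rewrite inE ffunE -[e \in _]/(e.1 < e.2)%N; case: (e.1 < e.2)%N.
  apply/eqP/val_inj/ffunP => -[u v] /=.
  rewrite !ffunE /= -/(adj G u v); case: (ltngtP u v) => [H|H|/ord_inj ->] /=.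
  - by rewrite orbF.
  - by rewrite adj_sym.
  - by rewrite adj_irr.
by apply: eq_bigr => e lt_e; rewrite ffunE lt_e.
Qed.

Lemma sum_offdiag n (Z : 'I_n -> 'I_n -> R) : (forall i, Z i i = 0) ->
  \sum_i \sum_j Z i j =
  \sum_(e : 'I_n * 'I_n | (e.1 < e.2)%N) (Z e.1 e.2 + Z e.2 e.1).
Proof.
move=> Z0; rewrite pair_bigA /= (bigID (fun e : 'I_n * 'I_n => (e.1 < e.2)%N)) /= big_split.
congr (_ + _).
rewrite [LHS](bigID (fun e : 'I_n * 'I_n => (e.2 < e.1)%N)) /= [X in _ + X]big1 ?addr0.
  rewrite [LHS](reindex (fun e : 'I_n * 'I_n => (e.2, e.1))) /=; last first.
    by exists (fun e : 'I_n * 'I_n => (e.2, e.1)) => -[].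
  by apply: eq_bigl => e /=; case: ltngtP.
move=> [u v] /=; case: (ltngtP u v) => // /ord_inj -> _; exact: Z0.
Qed.

(** * Chernoff bound for the noise *)

Lemma expR_le_quadratic (z : R) : z <= 1 / 2 -> expR z <= 1 + z + 2 * z ^+ 2.
Proof.
move=> z2.
have Hm : 1 - z <= expR (- z) by exact: expR_ge1Dx.
have H1 : 0 < 1 - z by lra.
have : (1 - z) * expR z <= 1.
  by have := ler_wpM2r (expR_ge0 z) Hm; rewrite [expR (- z) * _]mulrC expRxMexpNx_1.
move=> H; rewrite -(ler_pM2l H1); apply: (le_trans H).
have -> : (1 - z) * (1 + z + 2 * z ^+ 2) = 1 + z ^+ 2 * (1 - 2 * z) by ring.
have : 0 <= z ^+ 2 * (1 - 2 * z) by rewrite mulr_ge0 ?sqr_ge0 //; lra.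
lra.
Qed.

(** The exponent is proportional to p, unlike in Hoeffding's bound; as edges have p = O(1 / n), this
    is what keeps the noise at O(n sqrt a). *)
Lemma bernoulli_mgf (p z : R) : 0 <= p -> z <= 1 / 2 ->
  p * expR (z * (1 - p)) + (1 - p) * expR (z * (0 - p)) <= expR (2 * p * z ^+ 2).
Proof.
move=> p0 z2.
have -> : z * (1 - p) = z + - (z * p) by ring.
have -> : z * (0 - p) = - (z * p) by ring.
have -> : p * expR (z + - (z * p)) + (1 - p) * expR (- (z * p)) =
   expR (- (z * p)) * (1 + p * (expR z - 1)) by rewrite expRD; ring.
apply: (@le_trans _ _ (expR (- (z * p)) * expR (p * (expR z - 1)))).
  by rewrite ler_wpM2l ?expR_ge0 // expR_ge1Dx.
rewrite -expRD ler_expR.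
have := ler_wpM2l p0 (expR_le_quadratic z2); nra.
Qed.

Definition noise (a b : R) n (s : spins n) (G : sgraph n) (i j : 'I_n) : R :=
  (adj G i j)%:R - (if i == j then 0 else edge_prob a b s i j).

Lemma edge_prob_sym (a b : R) n (s : spins n) i j :
  edge_prob a b s i j = edge_prob a b s j i.
Proof. by rewrite /edge_prob eq_sym. Qed.

Section Bounds.
Variables (a b : R) (n : nat).
Hypotheses (b0 : 0 < b) (ba : b < a) (a16 : 16 <= a) (an : a <= n%:R).

Let n0 : 0 < n%:R :> R. Proof. by have := an; have := a16; lra. Qed.

Lemma edge_prob_ge0 s i j : 0 <= edge_prob a b (n := n) s i j.
Proof.
rewrite /edge_prob; apply: divr_ge0; last exact: ltW.
by case: ifP => _; have := b0; have := ba; lra.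
Qed.

Lemma edge_prob_le s i j : edge_prob a b (n := n) s i j <= a / n%:R.
Proof.
rewrite /edge_prob ler_pM2r ?invr_gt0 //.
by case: ifP => _; have := b0; have := ba; lra.
Qed.

Lemma edge_prob_le1 s i j : edge_prob a b (n := n) s i j <= 1.
Proof. by apply: le_trans (edge_prob_le _ _ _) _; rewrite ler_pdivrMr // mul1r. Qed.

Lemma sbm_pmf_ge0 s (G : sgraph n) : 0 <= sbm_pmf a b s G.
Proof.
rewrite /sbm_pmf mulr_ge0 ?exprn_ge0 ?invr_ge0 ?ler0n //.
apply: prodr_ge0 => e _; case: ifP => _; rewrite ?edge_prob_ge0 //.
by rewrite subr_ge0 edge_prob_le1.
Qed.

Lemma sum_half_spins (x : R) : \sum_(s : spins n) 2^-1 ^+ n * x = x.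
Proof.
rewrite -mulr_suml sumr_const card_ffun card_bool card_ord.
by rewrite -[_ *+ _]mulr_natl natrX -exprMn divff ?expr1n ?mul1r // pnatr_eq0.
Qed.

Lemma sbm_pmf_sum : \sum_(s : spins n) \sum_(G : sgraph n) sbm_pmf a b s G = 1.
Proof.
rewrite -[RHS](sum_half_spins 1); apply: eq_bigr => s _.
rewrite -mulr_sumr; congr (_ * _).
rewrite (sum_sgraph (fun e c => if c then edge_prob a b s e.1 e.2 else 1 - edge_prob a b s e.1 e.2)).
by rewrite big1 // => e _; rewrite subrKC.
Qed.

(** The two orientations of an edge have a joint coefficient c with |c| <= 2. At th = 1 / sqrt a a
    pair adds at most 2 (a / n) th^2 c^2 <= 8 / n to the exponent, and there are at most n^2 pairs.
    From a >= 16 follows th c <= 1 / 2. *)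
Lemma sbm_pmf_exp_moment (s : spins n) (x y : {ffun 'I_n -> bool}) :
  \sum_(G : sgraph n) sbm_pmf a b s G * expR ((Num.sqrt a)^-1 *
     \sum_i \sum_j noise a b s G i j * (sgr R (x i) * sgr R (y j))) <=
  2^-1 ^+ n * expR (8 * n%:R).
Proof.
set th := (Num.sqrt a)^-1.
pose c (e : 'I_n * 'I_n) := sgr R (x e.1) * sgr R (y e.2) + sgr R (x e.2) * sgr R (y e.1).
pose p (e : 'I_n * 'I_n) := edge_prob a b s e.1 e.2.
pose F e (d : bool) := (if d then p e else 1 - p e) * expR (th * c e * (d%:R - p e)).
have sa : 4 <= Num.sqrt a.
  rewrite -(ler_sqr (_ : 4 \is Num.nneg)) ?nnegrE ?sqrtr_ge0 ?sqr_sqrtr //; have := a16; lra.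
have th4 : th <= 1 / 4.
  by rewrite /th mul1r lef_pV2 ?posrE //; lra.
have th0 : 0 <= th by rewrite /th invr_ge0 sqrtr_ge0.
have tha : th ^+ 2 * a = 1.
  rewrite /th exprVn sqr_sqrtr ?mulVf //; have := a16; lra.
have c2 e : `|c e| <= 2.
  rewrite /c; apply: le_trans (ler_normD _ _) _; rewrite !normrM.
  have s1 d : `|sgr R d| = 1 by rewrite /sgr; case: d; rewrite ?normrN normr1.
  by rewrite !s1; lra.
have -> : \sum_(G : sgraph n) sbm_pmf a b s G * expR (th *
     \sum_i \sum_j noise a b s G i j * (sgr R (x i) * sgr R (y j))) =
  2^-1 ^+ n * \sum_(G : sgraph n) \prod_(e : 'I_n * 'I_n | (e.1 < e.2)%N) F e (adj G e.1 e.2).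
  rewrite mulr_sumr; apply: eq_bigr => G _; rewrite /sbm_pmf -mulrA; congr (_ * _).
  rewrite (sum_offdiag (Z := fun i j => noise a b s G i j * (sgr R (x i) * sgr R (y j)))); last first.
    by move=> i; rewrite /noise eqxx adj_irr subrr mul0r.
  rewrite mulr_sumr expR_sum -big_split; apply: eq_bigr => e lt_e /=.
  rewrite /F; congr (_ * expR _).
  have ne : (e.1 == e.2) = false by apply/eqP => E; rewrite E ltnn in lt_e.
  rewrite /noise ?ne ?[e.2 == e.1]eq_sym ?ne (adj_sym G e.2) (edge_prob_sym _ _ _ e.2) /c /p.
  by ring.
rewrite ler_wpM2l ?exprn_ge0 ?invr_ge0 ?ler0n // sum_sgraph.
apply: (@le_trans _ _ (\prod_(e : 'I_n * 'I_n | (e.1 < e.2)%N) expR (8 / n%:R))).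
  apply: ler_prod => e _; apply/andP; split.
    have H0 : 0 <= p e by exact: edge_prob_ge0.
    have H1 : p e <= 1 by exact: edge_prob_le1.
    by rewrite /F addr_ge0 // mulr_ge0 ?expR_ge0 //; lra.
  have H0 : 0 <= p e by exact: edge_prob_ge0.
  have /andP[C1 C2] : - 2 <= c e <= 2 by rewrite -ler_norml.
  have z2 : th * c e <= 1 / 2 by nra.
  apply: (le_trans (bernoulli_mgf H0 z2)); rewrite ler_expR.
  have Hp : p e <= a / n%:R by exact: edge_prob_le.
  have Hc : c e ^+ 2 <= 4 by nra.
  rewrite exprMn; apply: (@le_trans _ _ (2 * (a / n%:R) * (th ^+ 2 * 4))).
    apply: ler_pM; [lra|by rewrite mulr_ge0 ?sqr_ge0|lra|].
    by rewrite ler_wpM2l ?sqr_ge0.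
  have -> : 2 * (a / n%:R) * (th ^+ 2 * 4) = 8 * (th ^+ 2 * a) / n%:R by ring.
  by rewrite tha mulr1.
rewrite -expR_sum ler_expR; apply: (@le_trans _ _ (\sum_(e : 'I_n * 'I_n) 8 / n%:R)).
  rewrite [leRHS](bigID (fun e : 'I_n * 'I_n => (e.1 < e.2)%N)) /= lerDl.
  by apply: sumr_ge0 => e _; rewrite divr_ge0 // ltW.
rewrite sumr_const card_prod card_ord -[_ *+ _]mulr_natl natrM le_eqVlt; apply/orP; left; apply/eqP.
by field; rewrite gt_eqF.
Qed.

(** Markov's inequality: exp (8 n - 11 n) = exp (- 3 n) <= 8^(-n), which beats the 4^n pairs of sign
    vectors. *)
Lemma sbm_pmf_tail (x y : {ffun 'I_n -> bool}) :
  \sum_(s : spins n) \sum_(G : sgraph n |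
     11 * Num.sqrt a * n%:R < \sum_i \sum_j noise a b s G i j * (sgr R (x i) * sgr R (y j)))
     sbm_pmf a b s G <= (1 / 8) ^+ n.
Proof.
have sa0 : 0 < Num.sqrt a by rewrite sqrtr_gt0; have := a16; lra.
apply: (@le_trans _ _ (\sum_(s : spins n) 2^-1 ^+ n * expR (- (3 * n%:R)))); last first.
  rewrite sum_half_spins (_ : - (3 * n%:R) = n%:R * - 3); last by ring.
  rewrite expRM_natl lerXn2r ?nnegrE ?expR_ge0 ?divr_ge0 //.
  have e1 : 2 <= expR 1 :> R by have := expR_ge1Dx (1 : R); lra.
  have e3 : 8 <= expR 3 :> R.
    have -> : expR 3 = expR 1 ^+ 3 :> R by rewrite -expRM_natl mulr1.
    have -> : 8 = 2 ^+ 3 :> R by ring.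
    by rewrite lerXn2r ?nnegrE ?expR_ge0.
  by rewrite expRN mul1r lef_pV2 ?posrE ?expR_gt0.
apply: ler_sum => s _.
pose T G := \sum_i \sum_j noise a b s G i j * (sgr R (x i) * sgr R (y j)).
apply: (@le_trans _ _ (\sum_(G : sgraph n) 
  sbm_pmf a b s G * expR ((Num.sqrt a)^-1 * T G) * expR (- (11 * n%:R)))).
  rewrite big_mkcond; apply: ler_sum => G _; case: ifP => HG; last first.
    by apply: mulr_ge0; rewrite ?expR_ge0 // mulr_ge0 ?expR_ge0 ?sbm_pmf_ge0.
  rewrite -mulrA -expRD -[leLHS]mulr1 ler_wpM2l ?sbm_pmf_ge0 //.
  rewrite -[leLHS]expR0 ler_expR subr_ge0 [_^-1 * _]mulrC ler_pdivlMr //.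
  by rewrite mulrAC; exact: (ltW HG).
rewrite -mulr_suml.
apply: (le_trans (ler_wpM2r (expR_ge0 _) (sbm_pmf_exp_moment s x y))).
rewrite -mulrA -expRD; have -> : 8 * n%:R - 11 * n%:R = - (3 * n%:R) :> R by ring.
by [].
Qed.

(** Union bound over pairs of sign vectors. [E] may be any consequence of the cut bound, in
    particular success against a given adversary. *)
Lemma sbm_prob_ge (E : spins n -> sgraph n -> bool) :
  (forall s G, cut_bounded (noise a b s G) (11 * Num.sqrt a * n%:R) -> E s G) ->
  1 - (1 / 2) ^+ n <= sbm_prob a b E.
Proof.
move=> HE.
pose bad (xy : {ffun 'I_n -> bool} * {ffun 'I_n -> bool}) s G :=
  11 * Num.sqrt a * n%:R < \sum_i \sum_j noise a b s G i j * (sgr R (xy.1 i) * sgr R (xy.2 j)).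
have H : \sum_s \sum_(G | ~~ E s G) sbm_pmf a b s G <=
   \sum_xy \sum_s \sum_(G | bad xy s G) sbm_pmf a b s G.
  rewrite exchange_big; apply: ler_sum => s _.
  under [leRHS]eq_bigr do rewrite big_mkcond.
  rewrite exchange_big big_mkcond; apply: ler_sum => G _.
  have ge0 xy : true -> 0 <= (if bad xy s G then sbm_pmf a b s G else 0).
    by move=> _; case: ifP => _; rewrite ?sbm_pmf_ge0.
  case: ifP => nE; last by apply: sumr_ge0.
  have [xy Hxy] : exists xy, bad xy s G.
    apply: contrapT => Hn; move/negP: nE; apply; apply: HE => x y.
    by rewrite leNgt; apply/negP => Hxy; apply: Hn; exists (x, y).
  by rewrite (bigD1 xy) //= Hxy lerDl sumr_ge0 // => xy' _; apply: ge0.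
have H2 : \sum_xy \sum_s \sum_(G | bad xy s G) sbm_pmf a b s G <= (1 / 2) ^+ n.
  apply: (@le_trans _ _ (\sum_(xy : {ffun 'I_n -> bool} * {ffun 'I_n -> bool}) (1 / 8) ^+ n)).
    by apply: ler_sum => xy _; exact: sbm_pmf_tail.
  rewrite sumr_const card_prod card_ffun card_bool card_ord -[_ *+ _]mulr_natl natrM natrX -!exprMn.
  by have -> : 2 * 2 * (1 / 8) = 1 / 2 :> R by field.
have := sbm_pmf_sum.
have -> : \sum_(s : spins n) \sum_(G : sgraph n) sbm_pmf a b s G =
   sbm_prob a b E + \sum_s \sum_(G | ~~ E s G) sbm_pmf a b s G.
  by rewrite /sbm_prob -big_split; apply: eq_bigr => s _; rewrite [LHS](bigID (E s)).
lra.
Qed.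

Lemma sbm_prob_le1 (E : spins n -> sgraph n -> bool) : sbm_prob a b E <= 1.
Proof.
rewrite -sbm_pmf_sum; apply: ler_sum => s _.
rewrite [leRHS](bigID (E s)) lerDl sumr_ge0 // => G _; exact: sbm_pmf_ge0.
Qed.

End Bounds.
End RandomGraph.

(** * Analysis of the solver *)

Local Open Scope ring_scope.

Section Solver.
Variables (R : realType) (n kappa : nat) (G : sgraph n).
Hypotheses (n100 : (100 <= n)%N) (kn : (kappa <= n)%N).

Let m : R := n%:R.
Let m100 : 100 <= m. Proof. by rewrite /m (ler_nat R 100). Qed.

(** One spare power of n absorbs the numerical constants of the estimates below. *)
Lemma pow_gap k l : (k < l)%N -> 100 * m ^+ k <= m ^+ l.
Proof.
move=> kl; have m1 : 1 <= m by have := m100; lra.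
apply: (@le_trans _ _ (m ^+ k.+1)); last exact: ler_weXn2l.
by rewrite exprS ler_wpM2r // exprn_ge0 //; lra.
Qed.

Lemma pow_pos k : 0 < m ^+ k.
Proof. by rewrite exprn_gt0 //; have := m100; lra. Qed.

Definition run_solver t := iter t (sem n (solver_step kappa)) (adj_arrays G).
Local Notation st := run_solver.

Lemma adj_arraysE (i j : 'I_n) : adj_arrays G 0 i j = adj G i j.
Proof. by rewrite /adj_arrays !valK. Qed.

Definition state_ok t (M : arrays) :=
  [/\ M 0%N = adj_arrays G 0, forall i j, M 10%N i j = (t * n ^ 12)%N &
      forall i : 'I_n, (M 8 i i <= t * n ^ 13)%N].

(** * A single round of the solver *)

Section Step.
Variables (t : nat) (M : arrays).
Hypotheses (ok : state_ok t M) (tT : (t <= n ^ 12)%N).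

Let N := step_mx R n kappa M.

Definition mx_entry (i j : 'I_n) : R := m * (adj G i j)%:R - kappa%:R.

(** Array 8 accumulates the rounded values n ^ 12 X_ii, and t n ^ 12 is what X_ii = 1 would give; so
    the running sum of responses doubles as the vector of multipliers. *)
Definition multiplier (M : arrays) (t : nat) (i : 'I_n) : R :=
  (M 8 i i)%:R - t%:R * m ^+ 12.

Lemma step_mxE i j : N i j = m ^+ 14 * mx_entry i j +
  (if i == j then m ^+ 26 - multiplier M t i else 0).
Proof.
have [E0 E10 _] := ok.
rewrite mxE /pos_part /neg_part E0 E10 adj_arraysE /mx_entry /multiplier.
rewrite -(inj_eq val_inj) /=; case: eqP => [/val_inj ->|_];
  rewrite !natrD !natrM ?natrX -/m; ring.
Qed.

Lemma mx_entry_bound i j : `|mx_entry i j| <= m.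
Proof.
have K : kappa%:R <= m by rewrite ler_nat.
have K0 : 0 <= kappa%:R :> R by [].
have := m100; rewrite /mx_entry ler_norml; case: (adj G i j) => /= ?; apply/andP; split; lra.
Qed.

Let t_le : t%:R * m ^+ 12 <= m ^+ 24 /\ 0 <= t%:R * m ^+ 12.
Proof.
split; last by rewrite mulr_ge0 // ltW ?pow_pos.
by rewrite -[24%N]/(12 + 12)%N exprD ler_pM2r ?pow_pos // /m -natrX ler_nat.
Qed.

Lemma array8_bound (i : 'I_n) : 0 <= (M 8 i i)%:R :> R /\ (M 8 i i)%:R <= m ^+ 25.
Proof.
split=> //; have [_ _ E8] := ok.
apply: (@le_trans _ _ (n ^ 12 * n ^ 13)%N%:R).
  by rewrite ler_nat; apply: leq_trans (E8 i) _; rewrite leq_mul2r tT orbT.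
by rewrite -expnD natrX.
Qed.

Lemma multiplier_bound i : `|multiplier M t i| <= m ^+ 25.
Proof.
have [H1 H2] := array8_bound i; have [H3 H4] := t_le.
have := @pow_gap 24 25 isT; rewrite ler_norml /multiplier => ?.
by have ? := pow_pos 24; apply/andP; split; lra.
Qed.

Lemma step_mx_diag i : m ^+ 16 <= N i i /\ N i i <= 2 * m ^+ 26.
Proof.
have := multiplier_bound i; rewrite step_mxE eqxx ler_norml => /andP[L1 L2].
have := mx_entry_bound i i; rewrite ler_norml => /andP[H1 H2].
have P14 := pow_pos 14.
have := ler_wpM2l (ltW P14) H1; have := ler_wpM2l (ltW P14) H2.
have := @pow_gap 15 26 isT; have := @pow_gap 16 26 isT; have := @pow_gap 25 26 isT.
have := pow_pos 15; have := pow_pos 25; have := pow_pos 26.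
have -> : m ^+ 14 * - m = - m ^+ 15 by ring.
have -> : m ^+ 14 * m = m ^+ 15 by ring.
move: (_ * mx_entry i i) => e; split; lra.
Qed.

Lemma step_mx_off i j : i != j -> `|N i j| <= m ^+ 15.
Proof.
move=> /negbTE ij; rewrite step_mxE ij addr0 normrM ger0_norm ?(ltW (pow_pos _)) //.
by rewrite [m ^+ 15]exprSr ler_pM2l ?pow_pos // mx_entry_bound.
Qed.

Lemma step_mx_bound i j : `|N i j| <= 2 * m ^+ 26.
Proof.
have [->|ij] := eqVneq i j.
  have [H1 H2] := step_mx_diag j; rewrite ger0_norm //.
  by apply: le_trans H1; rewrite ltW ?pow_pos.
apply: le_trans (step_mx_off ij) _.
by have := @pow_gap 15 26 isT; have := pow_pos 15; lra.
Qed.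

Lemma step_mx_sym : N^T = N.
Proof.
apply/matrixP => i j; rewrite mxE !step_mxE eq_sym /mx_entry.
by rewrite (adj_sym G j); case: eqP => [->|].
Qed.

Lemma step_mx_psd : psd N.
Proof.
apply: (@diag_dominant_psd _ _ _ (m ^+ 15)); rewrite ?ltW ?pow_pos //.
  exact: step_mx_off.
by move=> i; have [H _] := step_mx_diag i; rewrite -/m -exprS.
Qed.

Let n0 : (0 < n)%N. Proof. exact: (leq_trans (isT : 0 < 100)%N n100). Qed.

Lemma step_mx_trace : 0 < \tr N.
Proof.
rewrite /mxtrace (bigD1 (Ordinal n0)) //= ltr_pwDl //.
  by have [H _] := step_mx_diag (Ordinal n0); apply: lt_le_trans H; rewrite pow_pos.
by apply: sumr_ge0 => i _; have [H _] := step_mx_diag i; apply: le_trans H; rewrite ltW ?pow_pos.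
Qed.

Lemma pos_part_bound (i j : 'I_n) : (pos_part n M i j <= n ^ 28)%N.
Proof.
have [E0 E10 _] := ok; rewrite -(ler_nat R) /pos_part E0 E10 adj_arraysE.
have [H3 H4] := t_le.
have := @pow_gap 15 28 isT; have := @pow_gap 26 28 isT; have := @pow_gap 24 28 isT.
have := pow_pos 15; have := pow_pos 26; have := pow_pos 28.
case: eqP => _; case: (adj G i j); rewrite ?natrD ?natrM ?natrX -/m /=; lra.
Qed.

Lemma neg_part_bound (i j : 'I_n) : (neg_part n kappa M i j <= n ^ 28)%N.
Proof.
rewrite -(ler_nat R) /neg_part.
have K : kappa%:R * m ^+ 14 <= m ^+ 15.
  by rewrite [m ^+ 15]exprS ler_pM2r ?pow_pos // ler_nat.
have := @pow_gap 15 28 isT; have := @pow_gap 25 28 isT.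
have := pow_pos 15; have := pow_pos 25; have := pow_pos 28.
case: eqP => [/ord_inj ->|_].
  have [_] := array8_bound j.
  rewrite ?natrD ?natrM ?natrX -/m /=; lra.
rewrite ?natrD ?natrM ?natrX -/m /=; lra.
Qed.

Let P := power_mx R n kappa M.
Definition density (M : arrays) : 'M[R]_n :=
  (m / \tr (power_mx R n kappa M)) *: power_mx R n kappa M.
Let X := density M.

Definition gram_factor (M : arrays) : 'M[R]_n := step_mx R n kappa M ^+ (n ^ 15).

Lemma power_mx_gram i j : P i j = \sum_k gram_factor M i k * gram_factor M j k.
Proof. by rewrite /P /power_mx even_power_gram // step_mx_sym. Qed.

(** The power method loses q n / (2 n ^ 15), and q <= 2 n ^ 28 because entries are at most 2 n ^
    26. *)
Lemma step_oracle (x : 'I_n -> R) : (forall i, x i ^+ 2 = 1) ->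
  0 < \tr P /\ \sum_i \sum_j N i j * (x i * x j) - m ^+ 14 <= \sum_i \sum_j N i j * X i j.
Proof.
move=> x1.
have p0 : (0 < n ^ 15)%N by rewrite expn_gt0 n0.
have [trP H] := power_oracle step_mx_sym step_mx_psd n0 p0 x1 step_mx_trace.
split=> //; have EX : \sum_i \sum_j N i j * X i j = m * \tr (N *m P) / \tr P.
  rewrite /mxtrace mulr_sumr mulr_suml; apply: eq_bigr => i _.
  rewrite [(N *m P) i i]mxE mulr_sumr mulr_suml; apply: eq_bigr => j _.
  rewrite [X i j]mxE -/(\tr P).
  have -> : power_mx R n kappa M i j = P j i.
    rewrite -/P !power_mx_gram; apply: eq_bigr => k _; exact: mulrC.
  by rewrite /m; ring.
rewrite EX; apply: le_trans H; rewrite lerD2l lerNl opprK -/m.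
have Hq : \sum_i \sum_j N i j * (x i * x j) <= m ^+ 2 * (2 * m ^+ 26).
  apply: (@le_trans _ _ (\sum_(i < n) \sum_(j < n) (2 * m ^+ 26))).
    apply: ler_sum => i _; apply: ler_sum => j _.
    apply: le_trans (step_mx_bound i j); apply: le_trans (ler_norm _) _.
    have xn k : `|x k| = 1.
      by apply/eqP; rewrite -sqrp_eq1 // -normrX x1 normr1.
    by rewrite !normrM !xn !mulr1.
  by rewrite !sumr_const !card_ord -mulrnA -[leLHS]mulr_natl natrM -/m -expr2.
have p2 : 0 < (n ^ 15).*2%:R :> R by rewrite ltr0n double_gt0.
rewrite ler_pdivrMr // -mul2n natrM natrX -/m.
apply: (le_trans (ler_wpM2r (_ : 0 <= m) Hq)); first by have := m100; lra.
by rewrite le_eqVlt; apply/orP; left; apply/eqP; ring.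
Qed.

Lemma density_bound i j : `|X i j| <= m.
Proof.
have [trP _] := @step_oracle (fun=> 1) (fun i => expr1n _ 2).
have m0 : 0 <= m by have := m100; lra.
rewrite mxE normrM ger0_norm; last by rewrite divr_ge0 // ltW.
rewrite mulrAC ler_pdivrMr // ler_wpM2l //.
exact: gram_trace_bound power_mx_gram.
Qed.

Lemma density_trace : \sum_i X i i = m.
Proof.
have [trP _] := @step_oracle (fun=> 1) (fun i => expr1n _ 2).
rewrite -/(\tr X) /X mxtraceZ mulfVK // gt_eqF //.
Qed.

Let M' := sem n (solver_step kappa) M.

Lemma solver_step_ok :
  [/\ state_ok t.+1 M',
      forall i : 'I_n, `|(multiplier M' t.+1 i - multiplier M t i) - m ^+ 12 * (X i i - 1)| <= 1 &
      forall i j : 'I_n, `|((M' 8 i j)%:R - (M' 9 i j)%:R) - ((M 8 i j)%:R - (M 9 i j)%:R)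
         - m ^+ 12 * X i j| <= 1].
Proof.
have [trP _] := @step_oracle (fun=> 1) (fun i => expr1n _ 2).
have [F0 F10 F8 F8d F] := solver_step_spec pos_part_bound neg_part_bound trP
  (fun i j => gram_trace_bound i j power_mx_gram).
have [E0 E10 E8] := ok.
have EX i j : m ^+ 13 * (P i j / \tr P) = m ^+ 12 * X i j.
  by rewrite mxE -/P; ring.
split.
- split.
  + by rewrite /M' F0 E0.
  + by move=> i j; rewrite /M' F10 E10 mulSn addnC.
  + move=> i; apply: leq_trans (F8 i) _; rewrite mulSn addnC leq_add2l; exact: E8.
- move=> i.
  have Pii : 0 <= P i i.
    by rewrite power_mx_gram; apply: sumr_ge0 => k _; rewrite -expr2 sqr_ge0.
  have := F8d i Pii; rewrite -/M' -/m EX.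
  rewrite /multiplier -natr1 => H; apply: le_trans H.
  by rewrite le_eqVlt; apply/orP; left; apply/eqP; congr `|_|; ring.
- by move=> i j; have := F i j; rewrite -/M' -/m EX.
Qed.

End Step.

(** * Regret of the multiplier updates *)

Let T := (n ^ 12)%N.
Let m0 : 0 <= m. Proof. by have := m100; lra. Qed.

Lemma run_solver_ok t : (t <= T)%N -> state_ok t (st t).
Proof.
elim: t => [|t IH] tT; first by split.
by have [] := solver_step_ok (IH (ltnW tT)) (ltnW tT).
Qed.

Lemma telescope_approx (f g : nat -> R) k :
  (forall t, (t < k)%N -> `|f t.+1 - f t - g t| <= 1) ->
  `|f k - f 0%N - \sum_(t < k) g t| <= k%:R.
Proof.
elim: k => [|k IH] H; first by rewrite big_ord0 subrr subr0 normr0.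
rewrite big_ord_recr /=.
have -> : f k.+1 - f 0%N - (\sum_(t < k) g t + g k) =
  (f k - f 0%N - \sum_(t < k) g t) + (f k.+1 - f k - g k) by ring.
apply: le_trans (ler_normD _ _) _; rewrite -natr1; apply: lerD; last exact: H.
by apply: IH => t tk; apply: H; apply: ltnW.
Qed.

Variable x : 'I_n -> R.
Hypothesis x1 : forall i, x i ^+ 2 = 1.

Let V t := \sum_i \sum_j mx_entry i j * density (st t) i j -
           \sum_i \sum_j mx_entry i j * (x i * x j).
Let L t i := multiplier (st t) t i.

(** The oracle inequality with the shift n ^ 26 I removed, which contributes equally to both sides
    because X and x x^T have trace n. *)
Lemma multiplier_density t : (t <= T)%N ->
  \sum_i L t i * (density (st t) i i - 1) <= m ^+ 14 * (V t + 1).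
Proof.
move=> tT; have ok := run_solver_ok tT.
have [_] := step_oracle ok tT x1.
have split_sum (Z : 'I_n -> 'I_n -> R) :
    \sum_i \sum_j step_mx R n kappa (st t) i j * Z i j =
    m ^+ 14 * (\sum_i \sum_j mx_entry i j * Z i j) + \sum_i (m ^+ 26 - L t i) * Z i i.
  rewrite mulr_sumr -big_split; apply: eq_bigr => i _ /=.
  rewrite mulr_sumr (bigD1 i) //= [in RHS](bigD1 i) //= (step_mxE ok) eqxx.
  rewrite (eq_bigr (fun j => m ^+ 14 * (mx_entry i j * Z i j))) => [|j]; first by rewrite /L; ring.
  by rewrite eq_sym => /negbTE ij; rewrite (step_mxE ok) ij; ring.
rewrite !split_sum.
have -> : \sum_i (m ^+ 26 - L t i) * (x i * x i) = \sum_i (m ^+ 26 - L t i).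
  by apply: eq_bigr => i _; rewrite -expr2 x1 mulr1.
have -> : \sum_i (m ^+ 26 - L t i) * density (st t) i i =
   \sum_i (m ^+ 26 - L t i) - \sum_i L t i * (density (st t) i i - 1).
  rewrite -sumrB.
  transitivity (\sum_i ((m ^+ 26 - L t i - L t i * (density (st t) i i - 1)) +
     m ^+ 26 * (density (st t) i i - 1))).
    by apply: eq_bigr => i _; ring.
  rewrite big_split /= -mulr_sumr [X in _ * X]sumrB (density_trace ok tT).
  by rewrite sumr_const card_ord -/m subrr mulr0 addr0.
rewrite /V; lra.
Qed.

Lemma sum_const_le (F : 'I_n -> R) c : (forall i, F i <= c) -> \sum_i F i <= m * c.
Proof.
move=> H; apply: (@le_trans _ _ (\sum_(i < n) c)); first exact: ler_sum.
by rewrite sumr_const card_ord mulr_natl.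
Qed.

(** The potential of online gradient descent: the cross term 2 n ^ 12 L_i (X_ii - 1) is controlled
    by the oracle, the others by |L_i| <= n ^ 25 and a move of at most 2 n ^ 13. *)
Lemma energy_step t : (t < T)%N ->
  \sum_i L t.+1 i ^+ 2 <=
  \sum_i L t i ^+ 2 + (2 * m ^+ 26 * V t + 4 * m ^+ 26 + 4 * m ^+ 27).
Proof.
move=> tT; have tT' := ltnW tT; have ok := run_solver_ok tT'.
have [_ He _] := solver_step_ok ok tT'.
pose X := density (st t).
pose e i := L t.+1 i - L t i.
pose rho i := e i - m ^+ 12 * (X i i - 1).
have rho1 i : `|rho i| <= 1 by exact: He.
have Lb i : `|L t i| <= m ^+ 25 by exact: (multiplier_bound ok tT').
have Xb i : `|X i i| <= m by exact: (density_bound ok tT').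
have -> : \sum_i L t.+1 i ^+ 2 = \sum_i L t i ^+ 2 +
   (2 * m ^+ 12 * (\sum_i L t i * (X i i - 1)) + \sum_i (2 * (L t i * rho i) + e i ^+ 2)).
  rewrite mulr_sumr -!big_split; apply: eq_bigr => i _ /=; rewrite /rho /e; ring.
rewrite lerD2l.
have H1 := multiplier_density tT'; rewrite -/X in H1.
have H2 : \sum_i (2 * (L t i * rho i) + e i ^+ 2) <= m * (2 * m ^+ 25 + 4 * m ^+ 26).
  apply: sum_const_le => i; apply: lerD.
    rewrite ler_pM2l //; apply: le_trans (ler_norm _) _; rewrite normrM.
    by rewrite -[leRHS]mulr1; apply: ler_pM.
  have He2 : `|e i| <= 2 * m ^+ 13.
    have -> : e i = rho i + m ^+ 12 * (X i i - 1) by rewrite /rho; ring.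
    apply: le_trans (ler_normD _ _) _; rewrite normrM (ger0_norm (ltW (pow_pos 12))).
    have := rho1 i; have := @pow_gap 0 12 isT; have := @pow_gap 12 13 isT.
    have : m ^+ 12 * `|X i i - 1| <= m ^+ 12 * (m + 1).
      rewrite ler_pM2l ?pow_pos //; apply: le_trans (ler_normB _ _) _.
      by rewrite normr1 lerD2r.
    rewrite expr0 (_ : m ^+ 12 * (m + 1) = m ^+ 13 + m ^+ 12); last by ring.
    have := pow_pos 12; lra.
  rewrite -real_normK ?num_real //.
  have -> : 4 * m ^+ 26 = (2 * m ^+ 13) ^+ 2 by ring.
  by rewrite ler_sqr ?nnegrE // mulr_ge0 // ltW ?pow_pos.
have H3 := ler_wpM2l (ltW (pow_pos 12)) H1.
have -> : 2 * m ^+ 26 * V t + 4 * m ^+ 26 + 4 * m ^+ 27 =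
   2 * (m ^+ 12 * (m ^+ 14 * (V t + 1))) + m * (2 * m ^+ 25 + 4 * m ^+ 26) by ring.
by apply: lerD => //; rewrite -mulrA ler_pM2l.
Qed.

(** Serves twice: as the left side is nonnegative, the objective loses little; as V <= 2 n ^ 4, the
    multipliers, and with them the violation of X_ii = 1, stay small. *)
Lemma energy_bound :
  \sum_i L T i ^+ 2 <= 2 * m ^+ 26 * (\sum_(t < T) V t) + m ^+ 12 * (4 * m ^+ 26 + 4 * m ^+ 27).
Proof.
have H k : (k <= T)%N -> \sum_i L k i ^+ 2 <=
    2 * m ^+ 26 * (\sum_(t < k) V t) + k%:R * (4 * m ^+ 26 + 4 * m ^+ 27).
  elim: k => [|k IH] kT.
    rewrite big_ord0 mulr0 mul0r addr0 big1 // => i _.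
    by rewrite /L /multiplier mul0r subr0 expr0n.
  apply: le_trans (energy_step kT) _.
  have := IH (ltnW kT); rewrite big_ord_recr /= -natr1 => {}IH.
  rewrite !mulrDr !mulrDl mul1r in IH *; lra.
by have := H T (leqnn _); rewrite {3}/T natrX.
Qed.

Definition solution (i j : 'I_n) : R := (\sum_(t < T) density (st t) i j) / m ^+ 12.

Let TE : T%:R = m ^+ 12 :> R. Proof. by rewrite natrX. Qed.

Let V_bound t : (t <= T)%N -> V t <= 2 * m ^+ 4.
Proof.
move=> tT; have ok := run_solver_ok tT.
have H1 : \sum_i \sum_j mx_entry i j * density (st t) i j <= m * (m * (m * m)).
  apply: sum_const_le => i; apply: sum_const_le => j.
  apply: le_trans (ler_norm _) _; rewrite normrM; apply: ler_pM => //.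
    exact: mx_entry_bound.
  exact: (density_bound ok tT).
have H2 : \sum_i \sum_j - (mx_entry i j * (x i * x j)) <= m * (m * m).
  apply: sum_const_le => i; apply: sum_const_le => j.
  apply: le_trans (ler_norm _) _; rewrite normrN normrM.
  have xn k : `|x k| = 1 by apply/eqP; rewrite -sqrp_eq1 // -normrX x1 normr1.
  by rewrite normrM !xn !mulr1 mx_entry_bound.
have E : \sum_i \sum_j - (mx_entry i j * (x i * x j)) = - \sum_i \sum_j mx_entry i j * (x i * x j).
  by rewrite -sumrN; apply: eq_bigr => i _; rewrite sumrN.
rewrite E in H2; rewrite /V.
have := @pow_gap 3 4 isT; have := pow_pos 3.
have -> : 2 * m ^+ 4 = m * (m * (m * m)) + m ^+ 4 by ring.
have -> : m ^+ 3 = m * (m * m) by ring.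
lra.
Qed.

Lemma solution_objective :
  \sum_i \sum_j mx_entry i j * (x i * x j) - m ^+ 2 <=
  \sum_i \sum_j mx_entry i j * solution i j.
Proof.
have E0 : 0 <= \sum_i L T i ^+ 2 by apply: sumr_ge0 => i _; rewrite sqr_ge0.
have H := le_trans E0 energy_bound.
have ES : \sum_(t < T) V t = m ^+ 12 * (\sum_i \sum_j mx_entry i j * solution i j -
    \sum_i \sum_j mx_entry i j * (x i * x j)).
  rewrite /V sumrB sumr_const card_ord -[X in _ - X]mulr_natl TE mulrBr; congr (_ - _).
  rewrite exchange_big mulr_sumr; apply: eq_bigr => i _.
  rewrite exchange_big mulr_sumr; apply: eq_bigr => j _.
  by rewrite -mulr_sumr /solution mulrCA; congr (_ * _); rewrite mulrC divfK // gt_eqF ?pow_pos.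
rewrite ES {ES} in H.
move: (\sum_i \sum_j mx_entry i j * solution i j) H => s1.
move: (\sum_i \sum_j _) => s2 H.
have : 0 <= m ^+ 38 * (2 * (s1 - s2) + 4 + 4 * m).
  by apply: le_trans H _; rewrite le_eqVlt; apply/orP; left; apply/eqP; ring.
rewrite pmulr_rge0 ?pow_pos // => {}H.
have := @pow_gap 1 2 isT; rewrite expr1; have := m100; lra.
Qed.

Lemma multiplier_final i : `|L T i| <= 3 * m ^+ 21.
Proof.
have H1 : \sum_(t < T) V t <= m ^+ 12 * (2 * m ^+ 4).
  apply: (@le_trans _ _ (\sum_(t < T) (2 * m ^+ 4))).
    by apply: ler_sum => t _; apply: V_bound; apply: ltnW.
  by rewrite sumr_const card_ord -[leLHS]mulr_natl TE.
have H2 : L T i ^+ 2 <= 9 * m ^+ 42.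
  apply: (@le_trans _ _ (\sum_i L T i ^+ 2)).
    by rewrite [leRHS](bigD1 i) //= lerDl; apply: sumr_ge0 => j _; rewrite sqr_ge0.
  apply: le_trans energy_bound _.
  have P26 : 0 <= 2 * m ^+ 26 by rewrite mulr_ge0 // ltW ?pow_pos.
  have := ler_wpM2l P26 H1.
  have -> : 2 * m ^+ 26 * (m ^+ 12 * (2 * m ^+ 4)) = 4 * m ^+ 42 by ring.
  have -> : m ^+ 12 * (4 * m ^+ 26 + 4 * m ^+ 27) = 4 * m ^+ 38 + 4 * m ^+ 39 by ring.
  have := @pow_gap 38 42 isT; have := @pow_gap 39 42 isT; have := pow_pos 42; lra.
rewrite -ler_sqr ?nnegrE // ?mulr_ge0 // ?(ltW (pow_pos _)) // real_normK ?num_real //.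
by apply: le_trans H2 _; rewrite le_eqVlt; apply/orP; left; apply/eqP; ring.
Qed.

(** Up to rounding, the final multiplier is n ^ 24 (X_ii - 1), while it is at most 3 n ^ 21. *)
Lemma solution_diag i : `|solution i i - 1| <= 1 / m.
Proof.
have := @telescope_approx (fun t => L t i) (fun t => m ^+ 12 * (density (st t) i i - 1)) T.
have H0 : L 0 i = 0 by rewrite /L /multiplier mul0r subr0.
rewrite H0 subr0 => H.
have {}H : `|L T i - \sum_(t < T) m ^+ 12 * (density (st t) i i - 1)| <= m ^+ 12.
  rewrite -[leRHS]TE; apply: H => t tT.
  by have [_ He _] := solver_step_ok (run_solver_ok (ltnW tT)) (ltnW tT); exact: He.
move: H; rewrite -mulr_sumr sumrB sumr_const card_ord -/T TE.
have -> : \sum_(t < T) density (st t) i i = m ^+ 12 * solution i i.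
  by rewrite /solution mulrC divfK // gt_eqF ?pow_pos.
have -> : m ^+ 12 * (m ^+ 12 * solution i i - m ^+ 12) = m ^+ 24 * (solution i i - 1) by ring.
have := multiplier_final i; set d := solution i i - 1 => HL HD.
have : `|m ^+ 24 * d| <= 3 * m ^+ 21 + m ^+ 12.
  have -> : m ^+ 24 * d = L T i - (L T i - m ^+ 24 * d) by ring.
  by apply: le_trans (ler_normB _ _) _; apply: lerD.
rewrite normrM (ger0_norm (ltW (pow_pos 24))) => Hd.
rewrite ler_pdivlMr; last by have := m100; lra.
rewrite -(ler_pM2l (pow_pos 23)) mulr1.
have -> : m ^+ 23 * (`|d| * m) = m ^+ 24 * `|d| by ring.
have := @pow_gap 21 23 isT; have := @pow_gap 12 23 isT; have := pow_pos 23; lra.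
Qed.

Lemma solution_trace : \sum_i solution i i = m.
Proof.
rewrite /solution -mulr_suml exchange_big /=.
rewrite (eq_bigr (fun=> m)) => [|t _].
  by rewrite sumr_const card_ord -[_ *+ _]mulr_natl TE mulrAC divff ?mul1r // gt_eqF ?pow_pos.
exact: (density_trace (run_solver_ok (ltnW (ltn_ord t))) (ltnW (ltn_ord t))).
Qed.

(** Concatenates the scaled Gram factors of all rounds. *)
Lemma solution_gram : exists (I : finType) (u : 'I_n -> I -> R),
  forall i j, solution i j = \sum_k u i k * u j k.
Proof.
pose c (t : 'I_T) := m / \tr (power_mx R n kappa (st t)) / m ^+ 12.
exists ('I_T * 'I_n)%type, (fun i k => Num.sqrt (c k.1) * gram_factor (st k.1) i k.2) => i j.
rewrite /solution mulr_suml -(pair_bigA _ (fun t k =>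
  Num.sqrt (c t) * gram_factor (st t) i k * (Num.sqrt (c t) * gram_factor (st t) j k))) /=.
apply: eq_bigr => t _; have tT := ltnW (ltn_ord t); have ok := run_solver_ok tT.
rewrite mxE (power_mx_gram ok) mulrAC -/(c t) mulr_sumr; apply: eq_bigr => k _.
have [trP _] := step_oracle ok tT (fun i => expr1n R 2 : (fun=> 1 : R) i ^+ 2 = 1).
have c0 : 0 <= c t by rewrite !divr_ge0 // ?ltW ?pow_pos.
by rewrite -{1}(sqr_sqrtr c0); ring.
Qed.

(** Arrays 8 and 9 represent n ^ 24 X up to n ^ 12, so the sign read off them can be wrong only
    where |X_ij| is tiny. *)
Lemma solution_sign (i j : 'I_n) (B := (st T 9 i j <= st T 8 i j)%N) :
  (if B then - solution i j else solution i j) <= 1 / m.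
Proof.
have := @telescope_approx (fun t => (st t 8 i j)%:R - (st t 9 i j)%:R)
  (fun t => m ^+ 12 * density (st t) i j) T.
rewrite subrr subr0 -mulr_sumr TE => H.
have {}H : `|(st T 8 i j)%:R - (st T 9 i j)%:R - m ^+ 24 * solution i j| <= m ^+ 12.
  have -> : m ^+ 24 * solution i j = m ^+ 12 * \sum_(t < T) density (st t) i j.
    rewrite /solution; have := pow_pos 12; move: (\sum_(t < T) _) => s p0.
    rewrite [RHS](_ : _ = m ^+ 12 * (m ^+ 12 * (s / m ^+ 12))); [ring|].
    by rewrite [m ^+ 12 * (s / _)]mulrC divfK // gt_eqF.
  apply: H => t tT.
  by have [_ _ He] := solver_step_ok (run_solver_ok (ltnW tT)) (ltnW tT); exact: He.
move: H; rewrite ler_norml => /andP[H1 H2].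
have Hd : (if B then - (m ^+ 24 * solution i j) else m ^+ 24 * solution i j) <= m ^+ 12.
  rewrite /B; case: leqP => [|/ltnW]; rewrite -(ler_nat R); lra.
rewrite ler_pdivlMr; last by have := m100; lra.
rewrite -(ler_pM2l (pow_pos 23)) mulr1.
have := @pow_gap 12 23 isT; have := pow_pos 12.
have -> : forall y, m ^+ 23 * (y * m) = m ^+ 24 * y by move=> y; ring.
by case: B Hd; lra.
Qed.

End Solver.

(** * Recovery *)

Section Rounding.
Local Open Scope nat_scope.
Variables (n : nat) (s t : spins n) (B : nat -> nat -> bool) (r : 'I_n).

Let mism (i j : 'I_n) := B i j != (s i == s j).
Let E := \sum_(i < n) \sum_(j < n) mism i j.

Lemma agreement_sum : agreement t s = \sum_(v < n) (t v == s v).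
Proof. by rewrite /agreement -sum1_card big_mkcond. Qed.

Lemma agreement_flip : agreement (flip t) s = n - agreement t s.
Proof.
have := cardC [pred v | t v == s v]; rewrite card_ord -/(agreement t s).
set c := (X in _ + X) => H; suff -> : agreement (flip t) s = c by lia.
apply: eq_card => v; rewrite !inE ffunE.
by case: (t v); case: (s v).
Qed.

Lemma agreement_le : agreement t s <= n.
Proof. by have := max_card [pred v | t v == s v]; rewrite card_ord. Qed.

(** A pair is misjudged exactly when one of its two entries agrees with [s] and the other does
    not. *)
Lemma disagreement_pairs :
  \sum_(i < n) \sum_(j < n) ((t i == t j) != (s i == s j)) =
  2 * (agreement t s * (n - agreement t s)).
Proof.
pose g v : nat := t v == s v; pose h v : nat := t v != s v.
have Eg : \sum_(v < n) g v = agreement t s by rewrite agreement_sum.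
have Eh : \sum_(v < n) h v = n - agreement t s.
  have : \sum_(v < n) (g v + h v) = n.
    rewrite (eq_bigr (fun=> 1)) ?sum1_card ?card_ord // => v _.
    by rewrite /g /h; case: eqP.
  by rewrite big_split Eg /=; lia.
transitivity (\sum_(i < n) \sum_(j < n) (g i * h j + h i * g j)).
  apply: eq_bigr => i _; apply: eq_bigr => j _; rewrite /g /h.
  by case: (t i); case: (t j); case: (s i); case: (s j).
rewrite -Eh -Eg.
under eq_bigr do rewrite big_split -!big_distrr /=.
by rewrite big_split -!big_distrl /=; lia.
Qed.

Hypothesis rmin : forall v : 'I_n, inconsistent n B r <= inconsistent n B v.
Hypothesis tB : forall j, t j = B r j.

(** Some row has at most E / n mismatches, so its pattern has at most 3 E inconsistencies. The
    chosen row has no more, hence misjudges at most 4 E pairs. This gives g (n - g) <= n ^ 2 / 5 <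
    (3 / 5) (2 / 5) n ^ 2 for the agreement g, which therefore lies outside the middle range. *)
Lemma rounding_correct : 10 * E <= n ^ 2 ->
  (6 * n <= 10 * agreement t s) \/ (6 * n <= 10 * agreement (flip t) s).
Proof.
move=> HE.
have [v Hv] : exists v, n * (\sum_(j < n) mism v j) <= E.
  have [v _ vmin] := @arg_minnP _ r predT (fun v => \sum_(j < n) mism v j) isT.
  exists v; rewrite -[n in n * _](card_ord n) -sum_nat_const.
  by apply: leq_sum => i _; apply: vmin.
have cv : inconsistent n B v <= 3 * E.
  apply: (@leq_trans (\sum_(i < n) \sum_(j < n) (mism v i + mism v j + mism i j))).
    apply: leq_sum => i _; apply: leq_sum => j _; rewrite /mism.
    by case: (B v i); case: (B v j); case: (B i j); case: (s v); case: (s i); case: (s j).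
  under eq_bigr do rewrite big_split big_split /= sum_nat_const card_ord.
  rewrite big_split big_split /= -big_distrr /= sum_nat_const card_ord -/E.
  by rewrite (_ : 3 * E = E + E + E) ?leq_add //; lia.
have H4 : \sum_(i < n) \sum_(j < n) ((t i == t j) != (s i == s j)) <= 4 * E.
  apply: (@leq_trans (\sum_(i < n) \sum_(j < n) (((B r i == B r j) != B i j) + mism i j))).
    apply: leq_sum => i _; apply: leq_sum => j _; rewrite /mism !tB.
    by case: (_ == B r j); case: (B i j); case: (_ == s j).
  under eq_bigr do rewrite big_split /=.
  rewrite big_split /= -/E -/(inconsistent n B r).
  by have := leq_trans (rmin v) cv; lia.
rewrite disagreement_pairs in H4; rewrite agreement_flip.
have := agreement_le; move: (agreement t s) H4 => g H4 gn.
case: (leqP (6 * n) (10 * g)) => [|H1]; first by left.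
right; rewrite leqNgt; apply/negP => H2.
have : 5 * (g * (n - g)) <= n ^ 2 by lia.
rewrite -(subnKC gn) addKn in H1 H2 *; move: (n - g) H1 H2 => h H1 H2.
rewrite expnS expn1; nia.
Qed.
End Rounding.

Local Open Scope ring_scope.

(** * From the cut bound to recovery *)

Section Recovery.
Variable R : realType.

Definition spin_sign n (s : spins n) (i : 'I_n) : R := sgr R (s i).

Lemma spin_sign_sqr n (s : spins n) i : spin_sign s i ^+ 2 = 1.
Proof. by rewrite /spin_sign /sgr; case: (s i); rewrite ?sqrrN expr1n. Qed.

Lemma spin_signM n (s : spins n) i j :
  spin_sign s i * spin_sign s j = if s i == s j then 1 else -1.
Proof. by rewrite /spin_sign /sgr; case: (s i); case: (s j) => /=; ring. Qed.

Section Deterministic.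
Variables (a b : R) (n kappa : nat) (s : spins n) (G G' : sgraph n).
Hypotheses (n100 : (100 <= n)%N) (kn : (kappa <= n)%N).
Hypotheses (a16 : 16 <= a) (kk : `|(a + b) / 2 - kappa%:R| <= 1).
Hypothesis (cut : cut_bounded (noise a b s G) (11 * Num.sqrt a * n%:R)).
Hypothesis (mono : forall u v, (s u = s v -> adj G u v -> adj G' u v) /\
                               (s u <> s v -> adj G' u v -> adj G u v)).

Let m : R := n%:R.
Let m100 : 100 <= m. Proof. by rewrite /m (ler_nat R 100). Qed.
Let m0 : 0 < m. Proof. by have := m100; lra. Qed.
Let x := spin_sign s.
Let X := solution R kappa G'.
Let x1 := @spin_sign_sqr n s.
Let Xdiag := solution_diag G' n100 kn x1.

Lemma solution_entry_bound i j : `|X i j| <= 1 + 1 / m.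
Proof.
have [I [u Hu]] := solution_gram R G' n100 kn.
apply: le_trans (gram_entry_bound i j Hu) _.
have := Xdiag i; have := Xdiag j; rewrite !ler_norml -/m => /andP[A1 A2] /andP[A3 A4].
lra.
Qed.

Lemma correlation_bound :
  (a - b) / 2 * \sum_i \sum_j (1 - x i * x j * X i j) <= 2169 * Num.sqrt a * m ^+ 2.
Proof.
pose D i j := x i * x j - X i j.
pose W := noise a b s G.
pose w := 11 * Num.sqrt a * m.
have sa : 4 <= Num.sqrt a.
  rewrite -(ler_sqr (_ : 4 \is Num.nneg)) ?nnegrE ?sqrtr_ge0 ?sqr_sqrtr //; have := a16; lra.
have w0 : 0 <= w by rewrite /w !mulr_ge0 // ?sqrtr_ge0 // ltW.
have m1 : 1 / m <= 1 by rewrite ler_pdivrMr //; have := m100; lra.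
have im : 0 < 1 / m by rewrite divr_gt0.
have const c : \sum_(i < n) \sum_(j < n) c = c * m ^+ 2 :> R.
  by rewrite !sumr_const card_ord -mulrnA -[LHS]mulr_natl natrM -/m -expr2 mulrC.
have H1 : \sum_i \sum_j mx_entry R kappa G' i j * D i j <= m ^+ 2.
  have := solution_objective G' n100 kn x1; rewrite lerBlDr addrC -lerBlDr -sumrB -/m.
  apply: le_trans; rewrite le_eqVlt; apply/orP; left; apply/eqP.
  by apply: eq_bigr => i _; rewrite -sumrB; apply: eq_bigr => j _; rewrite /D /X /x; ring.
(* Monotonicity: D_ij >= - 1 / n for equal spins and D_ij <= 1 / n for opposite ones, so an added or
   deleted edge lowers the pairing by at most n (1 / n) = 1. *)
have H2 : \sum_i \sum_j (mx_entry R kappa G i j * D i j - 1) <=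
    \sum_i \sum_j mx_entry R kappa G' i j * D i j.
  apply: ler_sum => i _; apply: ler_sum => j _.
  have := solution_entry_bound i j; rewrite ler_norml => /andP[B1 B2].
  have [mono1 mono2] := mono i j.
  have mm : m * (1 / m) = 1 by rewrite mul1r divff // gt_eqF.
  rewrite /mx_entry -/m -subr_ge0.
  have -> : (m * (adj G' i j)%:R - kappa%:R) * D i j - ((m * (adj G i j)%:R - kappa%:R) * D i j - 1) =
     m * (((adj G' i j)%:R - (adj G i j)%:R) * D i j + 1 / m) by field; rewrite gt_eqF.
  rewrite pmulr_rge0 // /D /x spin_signM; case: eqP => Es.
    move: (mono1 Es); case: (adj G i j); case: (adj G' i j) => /= Ha; lra.
  move: (mono2 Es); case: (adj G i j); case: (adj G' i j) => /= Ha; lra.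
(* Off the diagonal, n times the edge probability is (a + b) / 2 + (a - b) / 2 x_i x_j. On the
   diagonal this formula gives a instead of 0, whence the term with D_ii, which vanishes since both
   traces are n. *)
have H3 : \sum_i \sum_j (mx_entry R kappa G i j * D i j - 1) =
   m * (\sum_i \sum_j W i j * D i j) + ((a + b) / 2 - kappa%:R) * (\sum_i \sum_j D i j)
   + (a - b) / 2 * (\sum_i \sum_j x i * x j * D i j) - a * \sum_i D i i - m ^+ 2.
  rewrite -[m ^+ 2]mul1r -const !mulr_sumr -!big_split -!sumrB; apply: eq_bigr => i _ /=.
  have -> : a * D i i = \sum_j (if i == j then a * D i j else 0).
    by rewrite (bigD1 i) //= eqxx big1 ?addr0 // => j /negbTE; rewrite eq_sym => ->.
  rewrite !mulr_sumr -!big_split -!sumrB; apply: eq_bigr => j _ /=.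
  rewrite /mx_entry /W /noise /edge_prob -/m /x spin_signM.
  have mn : m != 0 by rewrite gt_eqF.
  have [<-|ij] := eqVneq i j; rewrite ?eqxx; first by field.
  by case: (s i == s j); rewrite -/m; field.
have HD : \sum_i D i i = 0.
  rewrite sumrB /X solution_trace // (eq_bigr (fun=> 1)); last by move=> i _; rewrite -expr2 x1.
  by rewrite sumr_const card_ord subrr.
have HDx : \sum_i \sum_j x i * x j * D i j = \sum_i \sum_j (1 - x i * x j * X i j).
  apply: eq_bigr => i _; apply: eq_bigr => j _; rewrite /D mulrBr; congr (_ - _).
  by have := x1 i; have := x1 j; rewrite -/(x i) -/(x j) => E1 E2; rewrite mulrACA -!expr2 E1 E2 mulr1.
have HDs : - (3 * m ^+ 2) <= ((a + b) / 2 - kappa%:R) * (\sum_i \sum_j D i j).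
  have : `|((a + b) / 2 - kappa%:R) * (\sum_i \sum_j D i j)| <= 1 * (3 * m ^+ 2).
    rewrite normrM; apply: ler_pM => //; rewrite -const.
    apply: le_trans (ler_norm_sum _ _ _) _; apply: ler_sum => i _.
    apply: le_trans (ler_norm_sum _ _ _) _; apply: ler_sum => j _.
    have := solution_entry_bound i j; rewrite !ler_norml => /andP[B1 B2].
    by rewrite /D /x spin_signM; case: ifP => _; apply/andP; split; lra.
  by rewrite mul1r ler_norml => /andP[].
(* The cut bound for the pair of sign vectors x, -x. *)
have HWx : - w <= \sum_i \sum_j W i j * (x i * x j).
  have := cut [ffun v => s v] [ffun v => ~~ s v].
  rewrite -/w -lerN2 => H; apply: le_trans H _.
  rewrite le_eqVlt; apply/orP; left; apply/eqP; rewrite -sumrN.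
  apply: eq_bigr => i _; rewrite -sumrN; apply: eq_bigr => j _; rewrite !ffunE /W /x /spin_sign.
  by rewrite /sgr; case: (s j) => /=; ring.
(* The Gram vectors have squared length at most 1 + 1 / n <= 2. *)
have HWX : \sum_i \sum_j W i j * X i j <= 98 * w * 2.
  have [I [u Hu]] := solution_gram R G' n100 kn.
  have Hn i : \sum_k u i k ^+ 2 <= 2.
    have := Xdiag i; rewrite Hu ler_norml -/m => /andP[_ A2].
    have -> : \sum_k u i k ^+ 2 = \sum_k u i k * u i k by apply: eq_bigr => k _; rewrite expr2.
    lra.
  have := grothendieck cut (ltr0n R 2 : 0 < 2) Hn Hn.
  apply: le_trans; rewrite le_eqVlt; apply/orP; left; apply/eqP.
  by apply: eq_bigr => i _; apply: eq_bigr => j _; rewrite /X Hu.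
have HW : - (197 * w) <= \sum_i \sum_j W i j * D i j.
  have -> : \sum_i \sum_j W i j * D i j =
      \sum_i \sum_j W i j * (x i * x j) - \sum_i \sum_j W i j * X i j.
    by rewrite -sumrB; apply: eq_bigr => i _; rewrite -sumrB; apply: eq_bigr => j _; rewrite /D; ring.
  lra.
have := ler_wpM2l (ltW m0) HW.
have := le_trans H2 H1; rewrite H3 HD HDx mulr0 subr0.
have -> : m * - (197 * w) = - (2167 * Num.sqrt a * m ^+ 2) by rewrite /w; ring.
(* The errors m ^ 2, m ^ 2 and 3 m ^ 2 fit into 2 sqrt a m ^ 2; together with 11 * 197 = 2167 this
   makes 2169. *)
have : 5 * m ^+ 2 <= 2 * Num.sqrt a * m ^+ 2.
  by rewrite ler_pM2r ?exprn_gt0 //; lra.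
move: HDs; rewrite -!mulrA; move: (Num.sqrt a * m ^+ 2) => z; lra.
Qed.

Lemma sdp_estimator_recovers : b < a -> 10 ^+ 5 * Num.sqrt a <= (a - b) / 2 ->
  eta_recovers (3 / 5 : R) (sdp_estimator kappa G') s.
Proof.
move=> ba sep.
have n0 : (0 < n)%N by exact: leq_trans n100.
have sa0 : 0 < Num.sqrt a by rewrite sqrtr_gt0; have := a16; lra.
pose M := run_solver kappa G' (n ^ 12).
pose B i j := (M 9 i j <= M 8 i j)%N.
have [r [rmin rB]] := rounding_spec M n0.
pose t := sdp_estimator kappa G'.
have tB j : t j = B r j by rewrite /t ffunE /solver sem_seq sem_loop; exact: rB.
have H : \sum_i \sum_j (1 - x i * x j * X i j) <= 3 / 100 * m ^+ 2.
  have := correlation_bound; set S := \sum_i _ => HS.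
  have H0 : 0 <= 3 / 100 * m ^+ 2 by have := exprn_gt0 2 m0; lra.
  have [S0|S0] := leP S 0; first exact: le_trans H0.
  have : 10 ^+ 5 * Num.sqrt a * S <= 2169 * Num.sqrt a * m ^+ 2.
    by apply: le_trans HS; rewrite ler_pM2r.
  rewrite (_ : 10 ^+ 5 * _ * S = Num.sqrt a * (10 ^+ 5 * S)); last by ring.
  rewrite (_ : 2169 * _ * m ^+ 2 = Num.sqrt a * (2169 * m ^+ 2)); last by ring.
  rewrite ler_pM2l //; have := exprn_gt0 2 m0; lra.
have HE : (10 * (\sum_(i < n) \sum_(j < n) (B i j != (s i == s j))) <= n ^ 2)%N.
  rewrite -(ler_nat R) natrM natrX -/m natr_sum.
  (* A wrong sign costs at least 1 - 1 / n and a right one at least - 1 / n, so at most 2 (3 / 100 +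
     1 / 100) n ^ 2 signs are wrong. *)
  have : \sum_(i < n) \sum_(j < n) ((B i j != (s i == s j))%:R / 2 - 1 / m : R) <= 3 / 100 * m ^+ 2.
    apply: le_trans H; apply: ler_sum => i _; apply: ler_sum => j _.
    have := solution_entry_bound i j; rewrite ler_norml => /andP[B1 B2].
    have im : 1 / m <= 1 / 100 by rewrite !mul1r lef_pV2 ?posrE.
    have im0 : 0 < 1 / m by rewrite divr_gt0.
    have := solution_sign R G' n100 kn i j; rewrite /= -/m -/M -/(B i j) -/X.
    rewrite /x spin_signM; case: (B i j); case: (s i == s j) => /= Hs; lra.
  have -> : \sum_(i < n) \sum_(j < n) ((B i j != (s i == s j))%:R / 2 - 1 / m : R) =
     (\sum_(i < n) (\sum_(j < n) (B i j != (s i == s j)))%N%:R) / 2 - m.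
    have Em : \sum_(i < n) \sum_(j < n) (1 / m) = m.
      rewrite !sumr_const card_ord -mulrnA -[LHS]mulr_natl natrM -/m.
      by field; rewrite gt_eqF.
    rewrite -[X in _ = _ - X]Em.
    rewrite mulr_suml -sumrB; apply: eq_bigr => i _.
    by rewrite natr_sum mulr_suml -sumrB.
  set S := \sum_i _ => HS.
  have : 100 * m <= m ^+ 2 by rewrite expr2 ler_wpM2r // ltW.
  have := exprn_gt0 2 m0; lra.
have [Ht|Ht] := rounding_correct rmin tB HE; apply/orP; rewrite -/t; [left|right].
  by rewrite mulrAC ler_pdivrMr // -!natrM ler_nat; lia.
by rewrite mulrAC ler_pdivrMr // -!natrM ler_nat; lia.
Qed.
End Deterministic.
End Recovery.

Local Open Scope classical_set_scope.

(** * The limit and the choice of constants *)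

Lemma sdp_estimator_partial_recovery (R : realType) (a b : R) kappa :
  0 < b -> b < a -> 16 <= a -> `|(a + b) / 2 - kappa%:R| <= 1 ->
  10 ^+ 5 * Num.sqrt a <= (a - b) / 2 ->
  semirandom_partial_recovery a b (sdp_estimator kappa).
Proof.
move=> b0 ba a16 kk sep; exists (3 / 5); first lra.
move=> A mono.
(* From here on the solver analysis applies (n >= 100, n >= kappa) and edge probabilities are at
   most 1 (n >= a). *)
pose N := (100 + kappa + Num.bound a)%N.
have a0 : 0 <= a by lra.
have Na n : (N <= n)%N -> a <= n%:R.
  move=> Nn; apply: le_trans (ltW (archi_boundP a0)) _.
  by rewrite ler_nat; apply: leq_trans Nn; rewrite leq_addl.
apply: (@squeeze_cvgr _ _ _ _ (fun n => 1 - (1 / 2) ^+ n) (fun=> 1)).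
- exists N => //= n /= Nn; apply/andP; split; last exact: sbm_prob_le1 (Na n Nn) _.
  apply: (sbm_prob_ge b0 ba a16 (Na n Nn)) => s G cut.
  apply: (@sdp_estimator_recovers _ a b n kappa s G) => //.
  + by apply: leq_trans Nn; rewrite /N -addnA leq_addr.
  + by apply: leq_trans Nn; rewrite /N addnAC leq_addl.
- rewrite -[X in _ --> X]subr0; apply: cvgB; first exact: cvg_cst.
  by apply: cvg_expr; rewrite ger0_norm; lra.
- exact: cvg_cst.
Qed.

Theorem theorem2 (R : realType) :
  exists2 C : R, 1 < C &
    forall a b : R, 0 < b -> b < a ->
      let k := (a + b) / 2 in
      let eps := b / (a + b) in
      20 < a -> C < k * (1 - 2 * eps) ^+ 2 ->
      exists f : estimator,
        semirandom_partial_recovery a b f /\ polynomial_time f.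
Proof.
(* As k (1 - 2 eps)^2 = (a - b)^2 / (2 (a + b)), this constant yields (a - b)^2 / 4 > 10 ^ 10 (a +
   b) >= (10 ^ 5 sqrt a)^2. *)
exists (2 * 10 ^+ 10); first by rewrite -natrX; lra.
move=> a b b0 ba; cbv zeta => a20 sep.
have k0 : 0 <= (a + b) / 2 by lra.
have /andP[T1 T2] := truncn_itv k0.
exists (sdp_estimator (Num.truncn ((a + b) / 2))); split; last exact: sdp_estimator_polynomial.
apply: sdp_estimator_partial_recovery => //; first lra.
  move: (Num.truncn _) T1 T2 => q T1; rewrite -[q.+1%:R]natr1 ler_norml => T2.
  by apply/andP; split; lra.
have a0 : 0 <= a by lra.
have c0 : 0 < a + b by lra.
have E : (a + b) / 2 * (1 - 2 * (b / (a + b))) ^+ 2 = (a - b) ^+ 2 / (2 * (a + b)).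
  by field; rewrite gt_eqF.
rewrite E ltr_pdivlMr ?mulr_gt0 // in sep.
have S0 : 0 <= 10 ^+ 5 * Num.sqrt a by rewrite mulr_ge0 ?sqrtr_ge0 ?exprn_ge0.
have D0 : 0 <= (a - b) / 2 by lra.
rewrite -ler_sqr ?nnegrE //.
rewrite exprMn sqr_sqrtr // -exprM exprMn.
have p0 : 0 < 10 ^+ 10 :> R by rewrite exprn_gt0.
move: (10 ^+ 10) p0 sep => p p0 sep.
have := mulr_gt0 p0 b0; have := mulr_ge0 (ltW p0) a0.
rewrite [(2^-1) ^+ 2]exprVn; lra.
Qed.
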